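(* Let $n\in\mathbb{N}$ and let $D\subset\mathbb{T}^n$ be an origin-symmetric convex body. Then $$W_n(D)=W_n^{+}(D):=\sup_{f\in F_+\setminus\{0\}}\frac{\int_{\mathbb{T}^n}|f|^2\,dx}{|D|^{-1}\int_D|f|^2\,dx},$$ where $F_+$ is the set of continuous positive definite functions on $\mathbb{T}^n$.
   Context: $\mathbb{T}^n=\mathbb{R}^n/\mathbb{Z}^n$, identified with $[-1/2,1/2)^n$ and equipped with Lebesgue measure; a set $D\subset\mathbb{T}^n$ which is an origin-symmetric convex body means an origin-symmetric convex body $D\subset\mathbb{R}^n$ contained in $[-1/2,1/2)^n$; $|D|$ is its volume. For $f\in L^1(\mathbb{T}^n)$ (complex-valued), $\widehat f_\nu=\int_{\mathbb{T}^n}f(x)e^{-2\pi i\nu x}\,dx$, $\nu\in\mathbb{Z}^n$, where $\nu x$ is the scalar product. $L^1_+(\mathbb{T}^n)=\{f\in L^1(\mathbb{T}^n):\widehat f_\nu\ge 0\text{ for all }\nu\in\mathbb{Z}^n\}$. The sharp Wiener constant is $$W_n(D)=\sup_{f\in L^1_+(\mathbb{T}^n)\setminus\{0\}}\frac{\int_{\mathbb{T}^n}|f|^2\,dx}{|D|^{-1}\int_D|f|^2\,dx},$$ where functions with $\int_D|f|^2\,dx=\infty$ are disregarded and $c/0=+\infty$ for $c>0$; that is, $W_n(D)$ is the smallest constant $W$ with $\int_{\mathbb{T}^n}|f|^2\,dx\le W|D|^{-1}\int_D|f|^2\,dx$ for all $f\in L^1_+(\mathbb{T}^n)$. A continuous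 function $f$ on $\mathbb{T}^n$ is positive definite if for every finite sequence $x_1,\dots,x_N\in\mathbb{T}^n$ and all complex numbers $c_1,\dots,c_N$ one has $\sum_{i,j=1}^N c_i\overline{c_j}f(x_i-x_j)\ge 0$ (equivalently, $\widehat f_\nu\ge0$ for all $\nu\in\mathbb{Z}^n$). *)

(* Defs.v *)
From HB Require Import structures.
From mathcomp Require Import all_boot all_order all_algebra.
From mathcomp Require Import complex.
From mathcomp Require Import all_classical all_reals all_analysis.

Set Implicit Arguments.
Unset Strict Implicit.
Unset Printing Implicit Defensive.

Import Order.TTheory GRing.Theory Num.Theory.
Import numFieldNormedType.Exports.

Local Open Scope classical_set_scope.
Local Open Scope ring_scope.

(* Row vectors over T carry the product sigma-algebra of T^n; for T := R this is
   the Borel sigma-algebra of R^n. *)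
Definition measure_row_display : measure_display -> measure_display.
Proof. exact. Qed.

Section measurable_row.
Context d (T : measurableType d) (n : nat).

Let coord (i : 'I_n) (x : 'rV[T]_n) : T := x ord0 i.

Let row_set0 : g_sigma_preimage coord set0.
Proof. exact: sigma_algebra0. Qed.

Let row_setC A : g_sigma_preimage coord A -> g_sigma_preimage coord (~` A).
Proof. exact: sigma_algebraC. Qed.

Let row_bigcup (F : (set 'rV[T]_n)^nat) :
  (forall i, g_sigma_preimage coord (F i)) ->
  g_sigma_preimage coord (\bigcup_i (F i)).
Proof. exact: sigma_algebra_bigcup. Qed.

HB.instance Definition _ := @isMeasurable.Build (measure_row_display d)
  'rV[T]_n (g_sigma_preimage coord) row_set0 row_setC row_bigcup.

Lemma measurable_coord (i : 'I_n) :
  measurable_fun [set: 'rV[T]_n] (fun x => x ord0 i).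
Proof.
move=> _ Y mY; rewrite setTI; apply: sub_sigma_algebra => /=.
rewrite -bigcup_seq/=; exists i => /=; first by rewrite mem_index_enum.
by exists Y => //; rewrite setTI.
Qed.

Lemma measurable_fun_rowP d' (U : measurableType d') (f : U -> 'rV[T]_n) :
  (forall i, measurable_fun [set: U] (fun u => f u ord0 i)) ->
  measurable_fun [set: U] f.
Proof.
move=> mf _ Y mY; rewrite setTI; move: Y mY.
pose S := [set Y : set 'rV[T]_n | measurable (f @^-1` Y)].
apply: (@smallest_sub _ _ _ S).
  split=> [|A SA|A SA]; rewrite /S/=.
  - by rewrite preimage_set0.
  - by rewrite setTD preimage_setC; exact: measurableC.
  - by rewrite preimage_bigcup; exact: bigcupT_measurable.
move=> Y; rewrite -bigcup_seq/= => -[i _ [A mA]].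
rewrite setTI => <-; rewrite /S/=.
by have := mf i measurableT A mA; rewrite setTI.
Qed.

End measurable_row.

(* Lebesgue measure on R^n: the image of the product of n copies of the
   one-dimensional Lebesgue measure. *)
Section lebesgue_rV.
Context {R : realType}.

Definition rV_cons n (p : measurableTypeR R * 'rV[R]_n) : 'rV[R]_n.+1 :=
  row_mx (const_mx p.1 : 'rV_1) p.2.

Lemma rV_cons0 n p : @rV_cons n p ord0 ord0 = p.1.
Proof.
rewrite [X in _ X = _](_ : _ = lshift n (ord0 : 'I_1)); last exact/val_inj.
by rewrite /rV_cons (row_mxEl (const_mx p.1 : 'rV_1) p.2) mxE.
Qed.

Lemma rV_consS n p j : @rV_cons n p ord0 (lift ord0 j) = p.2 ord0 j.
Proof.
rewrite (_ : lift ord0 j = rshift 1 j); last exact/val_inj.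
by rewrite /rV_cons (row_mxEr (const_mx p.1 : 'rV_1) p.2).
Qed.

Lemma measurable_rV_cons n :
  measurable_fun [set: measurableTypeR R * 'rV[R]_n] (@rV_cons n).
Proof.
apply: measurable_fun_rowP => i; case: (unliftP ord0 i) => [j|] ->.
- under eq_fun do rewrite rV_consS.
  apply: (@measurableT_comp _ _ _ _ _ _ (fun x : 'rV[R]_n => x ord0 j) _ snd).
  + exact: measurable_coord.
  + exact: measurable_snd.
- by under eq_fun do rewrite rV_cons0; exact: measurable_fst.
Qed.

Section step.
Variables (n : nat) (mu : {sigma_finite_measure set 'rV[R]_n -> \bar R}).

Definition lebesgue_rV_step : set 'rV[R]_n.+1 -> \bar R :=
  pushforward (lebesgue_measure \x mu)%E (@rV_cons n).

Let step0 : lebesgue_rV_step set0 = 0%E.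
Proof. by rewrite /lebesgue_rV_step /pushforward preimage_set0 measure0. Qed.

Let step_ge0 A : (0 <= lebesgue_rV_step A)%E.
Proof. by rewrite /lebesgue_rV_step /pushforward measure_ge0. Qed.

Let measurable_rV_cons_preimage (A : set 'rV[R]_n.+1) :
  measurable A -> measurable (@rV_cons n @^-1` A).
Proof. by move=> mA; rewrite -[X in measurable X]setTI; exact: measurable_rV_cons. Qed.

Let step_sigma_additive : semi_sigma_additive lebesgue_rV_step.
Proof.
move=> F mF tF mUF; rewrite /lebesgue_rV_step /pushforward preimage_bigcup.
apply: measure_semi_sigma_additive.
- by move=> k; exact: measurable_rV_cons_preimage.
- apply/trivIsetP => /= i j _ _ ij; rewrite -preimage_setI.
  by move/trivIsetP : tF => /(_ _ _ _ _ ij) ->//; rewrite preimage_set0.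
- by rewrite -preimage_bigcup; exact: measurable_rV_cons_preimage.
Qed.

HB.instance Definition _ := isMeasure.Build _ _ _
  lebesgue_rV_step step0 step_ge0 step_sigma_additive.

Let rV_uncons (x : 'rV[R]_n.+1) : measurableTypeR R * 'rV[R]_n :=
  (x ord0 ord0, \row_j x ord0 (lift ord0 j)).

Let rV_consK : cancel (@rV_cons n) rV_uncons.
Proof.
move=> [x v]; congr pair; first exact: rV_cons0.
by apply/rowP => j; rewrite mxE rV_consS.
Qed.

Let measurable_rV_uncons : measurable_fun [set: 'rV[R]_n.+1] rV_uncons.
Proof.
apply/measurable_fun_pairP; split => /=; first exact: measurable_coord.
apply: measurable_fun_rowP => i.
under eq_fun do rewrite /= mxE; exact: measurable_coord.
Qed.

Let step_sigma_finite : sigma_finite setT lebesgue_rV_step.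
Proof.
have /sigma_finiteP[F [FT ndF mF]] := sigma_finiteT (@lebesgue_measure R).
have /sigma_finiteP[G [GT ndG mG]] := sigma_finiteT mu.
exists (fun i => rV_uncons @^-1` (F i `*` G i)).
  apply/seteqP; split => // x _.
  have : [set: measurableTypeR R] (rV_uncons x).1 by [].
  have : [set: 'rV[R]_n] (rV_uncons x).2 by [].
  rewrite GT FT => -[k _ Gk] [m _ Fm]; exists (maxn m k) => //; split.
  - by move: Fm; exact/subsetPset/ndF/leq_maxl.
  - by move: Gk; exact/subsetPset/ndG/leq_maxr.
move=> i; have [mFi Fioo] := mF i; have [mGi Gioo] := mG i; split.
  rewrite -[X in measurable X]setTI; apply: measurable_rV_uncons => //.
  exact: measurableX.
rewrite /lebesgue_rV_step /pushforward -comp_preimage.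
rewrite (_ : _ \o _ = id); last by apply/funext => p; exact: rV_consK.
by rewrite preimage_id product_measure1E// lte_mul_pinfty// ge0_fin_numE.
Qed.

HB.instance Definition _ := @Measure_isSigmaFinite.Build _ _ _
  lebesgue_rV_step step_sigma_finite.

End step.

Fixpoint lebesgue_rV n : {sigma_finite_measure set 'rV[R]_n -> \bar R} :=
  if n is m.+1 then lebesgue_rV_step (lebesgue_rV m)
  else dirac (0 : 'rV[R]_0).

End lebesgue_rV.

Lemma lebesgue_rV_box (R : realType) n (A : 'I_n -> set (measurableTypeR R)) :
  (forall i, measurable (A i)) ->
  lebesgue_rV n [set x : 'rV[R]_n | forall i, A i (x ord0 i)] =
  (\prod_(i < n) lebesgue_measure (A i))%E.
Proof.
elim: n => [|n IHn] in A *.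
  move=> _; rewrite big_ord0 /= diracE mem_set //=; by case.
move=> mA; rewrite big_ord_recl -IHn // -product_measure1E //; last first.
  rewrite (_ : [set x | _] =
    \bigcap_(i in [set: 'I_n]) ((fun x : 'rV[R]_n => x ord0 i) @^-1`
      A (lift ord0 i))); last by apply/seteqP; split => x /= xA i *; exact: xA.
  apply: fin_bigcap_measurable => // i _; rewrite -[X in measurable X]setTI.
  by apply: (@measurable_coord _ R n i measurableT); exact: mA.
rewrite /= /lebesgue_rV_step /pushforward; congr (_ \x _)%E.
apply/seteqP; split => -[x v] /= => [xA|[Ax Av] i].
  split; first by have := xA ord0; rewrite rV_cons0.
  by move=> i; have := xA (lift ord0 i); rewrite rV_consS.
by case: (unliftP ord0 i) => [j ->|->]; rewrite ?rV_consS ?rV_cons0.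
Qed.

(* Functions on the torus R^n / Z^n are represented by the Z^n-periodic functions
   on R^n, and integrals over the torus are taken over [unit_cube R n]. *)
Section torus.
Context {R : realType} {n : nat}.
Implicit Types (f : 'rV[R]_n -> R[i]) (D : set 'rV[R]_n).

Definition unit_cube : set 'rV[R]_n :=
  [set x | forall i, x ord0 i \in `[- 2^-1, 2^-1[%R].

Definition Zn_periodic f :=
  forall (x : 'rV[R]_n) (k : 'rV[int]_n), f (x + map_mx intr k) = f x.

Definition torus_integral f : R[i] :=
  Complex (\int[lebesgue_rV n]_(x in unit_cube) complex.Re (f x))%R
          (\int[lebesgue_rV n]_(x in unit_cube) complex.Im (f x))%R.

(* e^{-2 pi i nu x} *)
Definition character (nu : 'rV[int]_n) (x : 'rV[R]_n) : R[i] :=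
  let t := 2 * pi * \sum_(i < n) (nu ord0 i)%:~R * x ord0 i in
  Complex (cos t) (- sin t).

Definition fourier_coef f (nu : 'rV[int]_n) : R[i] :=
  torus_integral (fun x => f x * character nu x).

Definition torus_L1 f :=
  [/\ Zn_periodic f,
      (lebesgue_rV n).-integrable unit_cube (fun x => (complex.Re (f x))%:E) &
      (lebesgue_rV n).-integrable unit_cube (fun x => (complex.Im (f x))%:E)].

(* In [R[i]], [0 <= z] means that z is real and nonnegative. *)
Definition torus_L1_plus f :=
  torus_L1 f /\ forall nu : 'rV[int]_n, 0 <= fourier_coef f nu.

Definition positive_definite f :=
  forall (N : nat) (x : 'I_N -> 'rV[R]_n) (c : 'I_N -> R[i]),
    0 <= \sum_(i < N) \sum_(j < N) c i * (c j)^*%C * f (x i - x j).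

Definition torus_continuous_posdef f :=
  [/\ Zn_periodic f, continuous (f : 'rV[R]_n -> R[i]^o) & positive_definite f].

Definition convex_body D :=
  [/\ compact D, convex_set (D : set (convex_lmodType 'rV[R]_n)) & D^° !=set0].

Definition origin_symmetric D := forall x, D x -> D (- x).

Definition sqr_integral D f : \bar R :=
  (\int[lebesgue_rV n]_(x in D) (ComplexField.Normc.normc (f x) ^+ 2)%:E)%E.

(* Extended-real division: [c / 0 = +oo] for [0 < c]. *)
Definition wiener_ratio D f : \bar R :=
  (sqr_integral unit_cube f / ((lebesgue_rV n D)^-1 * sqr_integral D f))%E.

(* Elements of L^1 are almost-everywhere classes, so that being nonzero means not
   vanishing almost everywhere. *)
Definition wiener_constant D : \bar R :=
  ereal_sup [set wiener_ratio D f | f in [set f |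
    [/\ torus_L1_plus f,
        ~ (\forall x \ae lebesgue_rV n, unit_cube x -> f x = 0) &
        (sqr_integral D f < +oo)%E]]].

Definition wiener_constant_plus D : \bar R :=
  ereal_sup [set wiener_ratio D f | f in [set f |
    torus_continuous_posdef f /\ f <> cst 0]].

End torus.

(* Main.v *)
Require Import Defs.
From mathcomp Require Import all_boot all_order all_algebra.
From mathcomp Require Import complex.
From mathcomp Require Import all_classical all_reals all_analysis.
From mathcomp Require Import measurable_realfun.
From mathcomp Require Import ring lra.

Set Implicit Arguments.
Unset Strict Implicit.
Unset Printing Implicit Defensive.

Import Order.TTheory GRing.Theory Num.Theory.
Import numFieldNormedType.Exports.

Local Open Scope classical_set_scope.
Local Open Scope ring_scope.

(** Positive definite continuous functions have nonnegative Fourier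
    coefficients: a regular grid with an even number of points per side is a
    group modulo the periods, so a positive definite form on the grid whose
    coefficients are the values of a character is a multiple of a Riemann sum of
    the Fourier coefficient ([posdef_fourier_ge0]). Bounded by periodicity, they
    compete in the supremum over the larger class, which is one inequality.

    For the other inequality let [f] be integrable with nonnegative coefficients
    and square integrable over [D]. The heart of the matter is that [f] is then
    square integrable over the whole torus, by an argument in the manner of
    Wiener ([wiener_bound]). Let [h] be the autocorrelation of the indicator
    function of a small box around the origin: it lies between [0] and [1], is
    supported in [D], and multiplication by [h] multiplies the mean of a
    function with nonnegative coefficients by at least the constant term [c] of
    [h] ([kernel_ge_mean]). The last property is inherited from autocorrelations
    of trigonometric polynomials that converge boundedly to the indicator
    function of the box; these are obtained from powers of the sine by
    Bernoulli's inequality ([sharpen_cvg]). For a finite set of frequencies with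
    partial sum [S] of [f], the functions [S S^*] and [(f - S) S^*] have
    nonnegative coefficients. Hence the integral of [h |S|^2] is at least [c]
    times the sum of the squared coefficients of [S], and at most the real part
    of the integral of [h f S^*], thus at most that of
    [h |f|^2 / 2 + h |S|^2 / 2]. So [c] times any finite sum of squared
    coefficients is at most the integral of [|f|^2] over [D].

    Square summable coefficients make an integrable function square integrable
    ([sqn_integrable_of_coef]): the truncations of [f] are approximated by
    trigonometric polynomials in mean square with respect to the weight
    [1 + |Re f| + |Im f|], which makes the error small when paired with [f]. The
    density of trigonometric polynomials for such a weight
    ([bounded_approximable]) comes from a sigma-algebra argument, since the
    indicator functions of arcs are bounded limits of trigonometric polynomials.

    Now the partial sums of [f] converge to [f] in mean square for a suitable
    choice of frequencies. They are continuous and positive definite, so that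
    the inequality of the smaller class holds for them, and it passes to the
    limit with the same constant ([sqn_int_transfer]). *)

(** * Riemann sums on the torus *)

Lemma Rintegral_dominated d (T : measurableType d) (R : realType)
    (mu : {measure set T -> \bar R}) (A : set T) (f_ : nat -> T -> R)
    (f g : T -> R) : measurable A ->
  (forall k, measurable_fun A (f_ k)) ->
  (forall x, A x -> f_ k x @[k --> \oo] --> f x) ->
  mu.-integrable A (EFin \o g) ->
  (forall k x, A x -> `|f_ k x| <= g x) ->
  mu.-integrable A (EFin \o f) /\
  (\int[mu]_(x in A) f_ k x)%R @[k --> \oo] --> (\int[mu]_(x in A) f x)%R.
Proof.
move=> mA mf cf ig fg.
have [|||||if_ _ cv] := @dominated_convergence _ _ _ mu A mA
    (fun k => EFin \o f_ k) (EFin \o f) (EFin \o g).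
- by move=> k; exact/measurable_EFinP.
- by apply/measurable_EFinP; exact: (measurable_fun_cvg mf cf).
- apply: aeW => x Ax; apply/fine_cvgP; split; first exact: nearW.
  exact: cf.
- exact: ig.
- by apply: aeW => x k Ax; rewrite /= lee_fin; exact: fg.
split => //; move: cv.
rewrite -[X in _ --> X -> _](fineK (integrable_fin_num mA if_)).
by move/fine_cvgP => [].
Qed.

Section riemann.
Context {R : realType} {n : nat}.
Implicit Types (x y : 'rV[R]_n) (N : nat).
Notation mu := (@lebesgue_rV R n).
Notation cube := (@unit_cube R n).

(** An even number of cells per side makes the corner of the cube a multiple
    of the mesh, so that the corners of the cells form a group modulo the
    lattice of periods. *)
Definition mesh N : R := (N.*2.+2)%:R.

Definition grid N := 'rV['I_N.*2.+2]_n.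

Definition lattice_pt N (d : grid N) : 'rV[R]_n :=
  \row_i ((d ord0 i)%:R / mesh N).

Definition corner N (d : grid N) : 'rV[R]_n :=
  lattice_pt d - const_mx 2^-1.

Definition cell N (d : grid N) : set 'rV[R]_n :=
  [set x | forall i, x ord0 i \in
     `[corner d ord0 i, corner d ord0 i + (mesh N)^-1[%R].

Lemma mesh_gt0 N : 0 < mesh N.
Proof. by rewrite ltr0n. Qed.

Lemma cornerE N (d : grid N) i :
  corner d ord0 i = (d ord0 i)%:R / mesh N - 2^-1.
Proof. by rewrite !mxE. Qed.

Lemma mesh_half N : mesh N * 2^-1 = (N.+1)%:R.
Proof.
by rewrite /mesh -doubleS -muln2 natrM mulfK // pnatr_eq0.
Qed.

Lemma cell_sub_cube N (d : grid N) : cell d `<=` cube.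
Proof.
move=> x dx i; have := dx i; rewrite !in_itv /= cornerE => /andP[h1 h2].
have M0 := mesh_gt0 N.
have dM : (d ord0 i)%:R + 1 <= mesh N.
  by rewrite natr1 ler_nat ltn_ord.
apply/andP; split.
  by apply: le_trans h1; rewrite lerBrDr addNr divr_ge0 // ltW.
have : ((d ord0 i)%:R + 1) / mesh N <= 1 by rewrite ler_pdivrMr // mul1r.
rewrite mulrDl mul1r => h3.
set b := (mesh N)^-1 in h2 h3 *; lra.
Qed.

Lemma exists_cell N x : cube x -> exists d : grid N, cell d x.
Proof.
move=> Cx; have M0 := mesh_gt0 N.
pose t i := Num.truncn (mesh N * (x ord0 i + 2^-1)).
have tP i : (t i)%:R <= mesh N * (x ord0 i + 2^-1) < (t i).+1%:R.
  apply: truncn_itv; apply: mulr_ge0; first exact: ltW.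
  by have := Cx i; rewrite in_itv /= => /andP[? ?]; lra.
have tlt i : (t i < N.*2.+2)%N.
  rewrite -(ltr_nat R); case/andP: (tP i) => + _; move/le_lt_trans; apply.
  rewrite -/(mesh N) -[ltRHS]mulr1 ltr_pM2l //.
  by have := Cx i; rewrite in_itv /= => /andP[? ?]; lra.
exists (\row_i Ordinal (tlt i)) => i.
rewrite in_itv /= cornerE mxE /=; case/andP: (tP i) => h1 h2.
apply/andP; split.
  by rewrite lerBlDr ler_pdivrMr // mulrC.
rewrite addrAC ltrBrDr -[X in _ < _ + X]mul1r -mulrDl natr1 ltr_pdivlMr //.
by rewrite mulrC.
Qed.

Lemma cell_inj N (d e : grid N) x : cell d x -> cell e x -> d = e.
Proof.
move=> dx ex; apply/rowP => i; apply/val_inj => /=.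
have := dx i; have := ex i; rewrite !in_itv /= !cornerE.
have M0 := mesh_gt0 N.
have sub (a b : nat) : a%:R / mesh N - 2^-1 <= x ord0 i ->
    x ord0 i < b%:R / mesh N - 2^-1 + (mesh N)^-1 -> (a <= b)%N.
  move=> h1 h2; have := le_lt_trans h1 h2.
  rewrite addrAC ltrD2r -[X in _ < _ + X]mul1r -mulrDl ltr_pM2r ?invr_gt0 //.
  by rewrite natr1 ltr_nat ltnS.
move=> /andP[a1 a2] /andP[b1 b2]; apply/eqP; rewrite eqn_leq.
by apply/andP; split; [exact: sub b1 a2 | exact: sub a1 b2].
Qed.

Lemma measurable_row_box (A : 'I_n -> set (measurableTypeR R)) :
  (forall i, measurable (A i)) ->
  measurable [set x : 'rV[R]_n | forall i, A i (x ord0 i)].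
Proof.
move=> mA; rewrite (_ : [set x | _] =
    \bigcap_(i in [set: 'I_n]) ((fun x : 'rV[R]_n => x ord0 i) @^-1` A i)).
  apply: fin_bigcap_measurable => // i _; rewrite -[X in measurable X]setTI.
  by apply: (@measurable_coord _ R n i measurableT); exact: mA.
by apply/seteqP; split => x /= xA i *; exact: xA.
Qed.

Lemma measurable_cell N (d : grid N) : measurable (cell d).
Proof.
by apply: (measurable_row_box (A := fun i => [set` Interval _ _])) => i;
  exact: measurable_itv.
Qed.

Lemma measurable_cube : measurable cube.
Proof.
apply: (measurable_row_box
  (A := fun i => [set` `[- 2^-1, 2^-1[%R])) => i.
exact: measurable_itv.
Qed.

Lemma lebesgue_cube_row (a : 'rV[R]_n) (l : R) : 0 < l ->
  mu [set x | forall i, x ord0 i \in `[a ord0 i, a ord0 i + l[%R] =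
  (l ^+ n)%:E.
Proof.
move=> l0; rewrite (@lebesgue_rV_box R n
  (fun i => [set` `[a ord0 i, a ord0 i + l[%R])); last first.
  by move=> i; exact: measurable_itv.
rewrite (eq_bigr (fun=> l%:E)); last first.
  move=> i _; rewrite lebesgue_measure_itv /= lte_fin ltrDl l0 -EFinD.
  by rewrite addrAC subrr add0r.
by rewrite prodEFin prodr_const card_ord.
Qed.

Lemma mu_cube : mu cube = 1%E.
Proof.
have := lebesgue_cube_row (const_mx (- 2^-1)) (ltr01 : 0 < 1 :> R).
rewrite expr1n => <-; congr (mu _).
apply/seteqP; split => x /= h i; have := h i; rewrite !mxE;
  by rewrite (_ : - 2^-1 + 1 = 2^-1 :> R) //; field.
Qed.

Lemma mu_cell N (d : grid N) : mu (cell d) = ((mesh N)^-1 ^+ n)%:E.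
Proof. by rewrite lebesgue_cube_row // invr_gt0 mesh_gt0. Qed.

Lemma mesh_cvg0 : ((mesh N)^-1) @[N --> \oo] --> (0 : R).
Proof.
apply: (@squeeze_cvgr _ _ _ _ (cst 0) (fun N => N.+1%:R^-1)).
- near=> N; rewrite invr_ge0 ltW ?mesh_gt0 //=.
  rewrite lef_pV2 ?posrE ?mesh_gt0 ?ltr0n // ler_nat.
  by rewrite -doubleS -addnn leq_addr.
- exact: cvg_cst.
- exact: cvg_harmonic.
Unshelve. all: by end_near. Qed.

Lemma row_ballP x y (e : R) : 0 < e ->
  ball x e y <-> forall i, `|x ord0 i - y ord0 i| < e.
Proof.
move=> e0; split.
  by move=> [_ h] i; exact: h.
move=> h; split => // i j; rewrite (ord1 i); exact: h.
Qed.

Lemma cell_ball N (d : grid N) x y (e : R) : (mesh N)^-1 <= e ->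
  cell d x -> cell d y -> ball x e y.
Proof.
move=> Me dx dy; have M0 := mesh_gt0 N.
have Mi0 : 0 < (mesh N)^-1 by rewrite invr_gt0.
apply/row_ballP; first exact: lt_le_trans Me.
move=> i; have := dx i; have := dy i; rewrite !in_itv /=.
move=> /andP[a1 a2] /andP[b1 b2].
set b := (mesh N)^-1 in Me Mi0 a2 b2 *.
rewrite ltr_norml; apply/andP; split; lra.
Qed.

Lemma corner_cell N (d : grid N) : cell d (corner d).
Proof.
by move=> i; rewrite in_itv /= lexx /= ltrDl invr_gt0 mesh_gt0.
Qed.

Definition step_fun (g : 'rV[R]_n -> R) N x : R :=
  \sum_(d : grid N) g (corner d) * \1_(cell d) x.

Lemma step_funE g N (d : grid N) x : cell d x -> step_fun g N x = g (corner d).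
Proof.
move=> dx; rewrite /step_fun (bigD1 d) //= indicE mem_set // mulr1 big1 ?addr0 //.
move=> e ed; rewrite indicE memNset ?mulr0 // => ex.
by move: ed; rewrite (cell_inj ex dx) eqxx.
Qed.

Lemma measurable_step_fun g N (A : set 'rV[R]_n) : measurable_fun A (step_fun g N).
Proof.
apply: measurable_sum => d; apply: measurable_funM; first exact: measurable_cst.
exact: measurable_indic (measurable_cell d).
Qed.

Lemma step_fun_cvg (g : 'rV[R]_n -> R) x : cube x -> {for x, continuous g} ->
  step_fun g N x @[N --> \oo] --> g x.
Proof.
move=> Cx cg; apply/cvgrPdist_lt => e e0.
have /cvgrPdist_lt /(_ e e0) := cg.
rewrite -nbhs_ballE => -[r /= r0 hr].
have /cvgrPdist_lt /(_ r r0) := mesh_cvg0.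
apply: filterS => N /=; rewrite sub0r normrN gtr0_norm ?invr_gt0 ?mesh_gt0 // => Mr.
have [d dx] := exists_cell N Cx; rewrite (step_funE _ dx).
by apply: hr; apply: (cell_ball (ltW Mr) dx); exact: corner_cell.
Qed.

(** A continuous function is the pointwise limit of the step functions that
    sample it at the corners of the cells. *)
Lemma continuous_measurable_cube (g : 'rV[R]_n -> R) : continuous g ->
  measurable_fun cube g.
Proof.
move=> cg; apply: (measurable_fun_cvg (h := fun N => step_fun g N)).
  by move=> N; exact: measurable_step_fun.
by move=> x Cx; apply: step_fun_cvg => //; exact: cg.
Qed.

(** A closed set is the intersection over all meshes of the unions of the
    cells that meet it. *)
Lemma closed_measurable_cube (D : set 'rV[R]_n) : closed D -> D `<=` cube ->
  measurable D.
Proof.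
move=> cD DC.
rewrite (_ : D = \bigcap_N \big[setU/set0]_(d <- enum (grid N) | `[< D `&` cell d !=set0 >]) cell d).
  apply: bigcap_measurableType => N _; apply: bigsetU_measurable => d _.
  exact: measurable_cell.
apply/seteqP; split => [x Dx N _|x h].
  have [d dx] := exists_cell N (DC x Dx).
  rewrite -bigcup_seq_cond; exists d => //=; rewrite mem_enum; apply/andP; split => //.
  by apply/asboolP; exists x.
apply: cD => A; rewrite -nbhs_ballE => -[r /= r0 hr].
have /cvgrPdist_lt /(_ r r0) [N _ /(_ N (leqnn N))] := mesh_cvg0.
rewrite /= sub0r normrN gtr0_norm ?invr_gt0 ?mesh_gt0 // => Mr.
have := h N I; rewrite -bigcup_seq_cond => -[d /= /andP[_ /asboolP[y [Dy dy]]] dx].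
exists y; split => //; apply: hr; exact: (cell_ball (ltW Mr) dx).
Qed.

Lemma integrable_bounded_cube (g : 'rV[R]_n -> R) (B : R) : measurable_fun cube g ->
  (forall x, cube x -> `|g x| <= B) -> mu.-integrable cube (EFin \o g).
Proof.
move=> mg gB; apply: measurable_bounded_integrable => //.
- exact: measurable_cube.
- by apply: (@le_lt_trans _ _ 1%E); rewrite ?ltry // -mu_cube.
- exists B; split; first exact: num_real.
  by move=> b Bb x Cx /=; exact: le_trans (gB x Cx) (ltW Bb).
Qed.

Lemma Rintegral_sum (A : set 'rV[R]_n) (I : Type) (s : seq I)
    (h : I -> 'rV[R]_n -> R) : measurable A ->
  (forall i, mu.-integrable A (EFin \o h i)) ->
  (\int[mu]_(x in A) \sum_(i <- s) h i x)%R =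
  \sum_(i <- s) (\int[mu]_(x in A) h i x)%R.
Proof.
move=> mA ih; elim: s => [|i s IHs].
  rewrite big_nil -[RHS](mulr0 (fine (mu A))) mulrC -Rintegral_cst //.
  by apply: eq_Rintegral => x _; rewrite big_nil.
rewrite big_cons -IHs -RintegralD //.
  by apply: eq_Rintegral => x _; rewrite big_cons.
have := @integrable_sum _ _ _ mu A mA I s xpredT (fun i x => (h i x)%:E) (fun i _ => ih i).
by apply: eq_integrable => // x _; rewrite /= sumEFin.
Qed.

Lemma integral_step_fun g N :
  (\int[mu]_(x in cube) step_fun g N x)%R =
  (mesh N)^-1 ^+ n * \sum_(d : grid N) g (corner d).
Proof.
have iI (d : grid N) : mu.-integrable cube (EFin \o \1_(cell d)).
  apply: (@integrable_bounded_cube _ 1).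
    exact: measurable_indic (measurable_cell d).
  by move=> x _; rewrite indicE; case: (_ \in _); rewrite ?normr1 ?normr0.
rewrite Rintegral_sum; last 2 first.
- exact: measurable_cube.
- move=> d; rewrite (_ : _ \o _ = fun x => (g (corner d))%:E * (\1_(cell d) x)%:E)%E //.
  by apply: integrableZl; [exact: measurable_cube | exact: iI].
rewrite mulr_sumr; apply: eq_bigr => d _.
rewrite RintegralZl //; last exact: measurable_cube.
rewrite mulrC; congr (_ * _); rewrite /Rintegral integral_indic.
- by rewrite setIidl; [rewrite [X in fine X]mu_cell | exact: cell_sub_cube].
- exact: measurable_cube.
- exact: measurable_cell.
Qed.

Lemma riemann_cvg (g : 'rV[R]_n -> R) (B : R) : continuous g ->
  (forall x, `|g x| <= B) ->
  (mesh N)^-1 ^+ n * (\sum_(d : grid N) g (corner d)) @[N --> \oo] -->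
  (\int[mu]_(x in cube) g x)%R.
Proof.
move=> cg gB; have mC := measurable_cube.
have mg := continuous_measurable_cube cg.
have ig : mu.-integrable cube (EFin \o g).
  by apply: (integrable_bounded_cube (B := B)) => // x _; exact: gB.
have iB : mu.-integrable cube (EFin \o cst B).
  apply: (@integrable_bounded_cube (cst B) `|B|); first exact: measurable_cst.
  by [].
have [|N x Cx|_ +] := @Rintegral_dominated _ _ _ mu cube _ g _ mC
    (fun N => @measurable_step_fun g N cube) _ iB; first move=> x Cx.
- by apply: step_fun_cvg => //; exact: cg.
- by have [d dx] := exists_cell N Cx; rewrite (step_funE g dx).
by under eq_fun do rewrite integral_step_fun.
Qed.

End riemann.

(** * Integration of complex functions over the torus *)

Notation Re := complex.Re.
Notation Im := complex.Im.

Section complex_integration.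
Context {R : realType} {n : nat}.
Implicit Types (f g h : 'rV[R]_n -> R[i]) (z w : R[i]) (x y : 'rV[R]_n).
Notation mu := (@lebesgue_rV R n).
Notation cube := (@unit_cube R n).
Definition sqn z : R := ComplexField.Normc.normc z ^+ 2.

Lemma ReD z w : Re (z + w) = Re z + Re w. Proof. by case: z; case: w. Qed.
Lemma ImD z w : Im (z + w) = Im z + Im w. Proof. by case: z; case: w. Qed.
Lemma ReB z w : Re (z - w) = Re z - Re w. Proof. by case: z; case: w. Qed.
Lemma ImB z w : Im (z - w) = Im z - Im w. Proof. by case: z; case: w. Qed.
Lemma ReM z w : Re (z * w) = Re z * Re w - Im z * Im w.
Proof. by case: z; case: w. Qed.
Lemma ImM z w : Im (z * w) = Re z * Im w + Im z * Re w.
Proof. by case: z; case: w. Qed.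
Lemma Re_conj z : Re z^*%C = Re z. Proof. by case: z. Qed.
Lemma Im_conj z : Im z^*%C = - Im z. Proof. by case: z. Qed.

Lemma sqnE z : sqn z = Re z ^+ 2 + Im z ^+ 2.
Proof. by case: z => a b; rewrite /sqn /= sqr_sqrtr // addr_ge0 ?sqr_ge0. Qed.

Lemma sqn_ge0 z : 0 <= sqn z. Proof. exact: sqr_ge0. Qed.

Lemma sqnM z w : sqn (z * w) = sqn z * sqn w.
Proof. by rewrite /sqn ComplexField.Normc.normcM exprMn. Qed.

Lemma sqnN z : sqn (- z) = sqn z.
Proof. by rewrite !sqnE; case: z => a b /=; ring. Qed.

Lemma sqn0 : sqn 0 = 0. Proof. by rewrite sqnE /= !expr0n addr0. Qed.

Lemma sqn_eq0 z : sqn z = 0 -> z = 0.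
Proof.
rewrite sqnE => /eqP; rewrite paddr_eq0 ?sqr_ge0 // !sqrf_eq0.
by case: z => a b /= /andP[/eqP -> /eqP ->].
Qed.

Lemma Re_mul_conj z : Re (z * z^*%C) = sqn z.
Proof. by rewrite sqnE ReM Re_conj Im_conj; ring. Qed.

Lemma Re_sum (I : Type) (s : seq I) (F : I -> R[i]) :
  Re (\sum_(i <- s) F i) = \sum_(i <- s) Re (F i).
Proof. by elim/big_ind2: _ => // z a w b <- <-; rewrite ReD. Qed.

Lemma Im_sum (I : Type) (s : seq I) (F : I -> R[i]) :
  Im (\sum_(i <- s) F i) = \sum_(i <- s) Im (F i).
Proof. by elim/big_ind2: _ => // z a w b <- <-; rewrite ImD. Qed.

Lemma complex_ext z w : Re z = Re w -> Im z = Im w -> z = w.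
Proof. by case: z => a b; case: w => c d /= -> ->. Qed.

Lemma complex_ge0 z : (0 <= z) = (Im z == 0) && (0 <= Re z).
Proof. by rewrite lecE. Qed.

Lemma Re_le_sqn z : `|Re z| ^+ 2 <= sqn z.
Proof. by rewrite sqnE real_normK ?num_real // lerDl sqr_ge0. Qed.

Lemma Im_le_sqn z : `|Im z| ^+ 2 <= sqn z.
Proof. by rewrite sqnE real_normK ?num_real // lerDr sqr_ge0. Qed.

(** Bounds on complex functions are bounds on [sqn], which is polynomial in the
    coordinates; a bound on it also bounds the real and imaginary parts. *)
Lemma norm_le_sqr_bound (a B : R) : a ^+ 2 <= B -> `|a| <= 1 + B.
Proof.
move=> aB; have B0 : 0 <= B by apply: le_trans aB; rewrite sqr_ge0.
rewrite ler_norml; apply/andP; split; nra.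
Qed.

Definition cmeasurable f :=
  measurable_fun cube (fun x => Re (f x)) /\
  measurable_fun cube (fun x => Im (f x)).

Definition cintegrable f :=
  mu.-integrable cube (fun x => (Re (f x))%:E) /\
  mu.-integrable cube (fun x => (Im (f x))%:E).

Definition cbounded (B : R) f := forall x, cube x -> sqn (f x) <= B.

Let mC : measurable cube := measurable_cube.

Lemma cintegrable_measurable f : cintegrable f -> cmeasurable f.
Proof. by move=> [/measurable_int/measurable_EFinP ? /measurable_int/measurable_EFinP ?]. Qed.

Lemma cmeasurable_cst z : cmeasurable (cst z).
Proof. by split; exact: measurable_cst. Qed.

Lemma cmeasurableD f g : cmeasurable f -> cmeasurable g ->
  cmeasurable (fun x => f x + g x).
Proof.
move=> [? ?] [? ?]; split.
  by under eq_fun do rewrite ReD; exact: measurable_funD.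
by under eq_fun do rewrite ImD; exact: measurable_funD.
Qed.

Lemma cmeasurableM f g : cmeasurable f -> cmeasurable g ->
  cmeasurable (fun x => f x * g x).
Proof.
move=> [? ?] [? ?]; split.
  by under eq_fun do rewrite ReM; apply: measurable_funB; exact: measurable_funM.
by under eq_fun do rewrite ImM; apply: measurable_funD; exact: measurable_funM.
Qed.

Lemma cmeasurable_conj f : cmeasurable f -> cmeasurable (fun x => (f x)^*%C).
Proof.
move=> [? ?]; split.
  by under eq_fun do rewrite Re_conj.
by under eq_fun do rewrite Im_conj; exact: measurable_funN.
Qed.

Lemma cmeasurableB f g : cmeasurable f -> cmeasurable g ->
  cmeasurable (fun x => f x - g x).
Proof.
move=> [? ?] [? ?]; split.
  by under eq_fun do rewrite ReB; exact: measurable_funB.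
by under eq_fun do rewrite ImB; exact: measurable_funB.
Qed.

Lemma measurable_sqn f : cmeasurable f -> measurable_fun cube (fun x => sqn (f x)).
Proof.
move=> [? ?]; under eq_fun do rewrite sqnE.
by apply: measurable_funD; exact: measurable_funX.
Qed.

Lemma integrable_mul_bounded (a b : 'rV[R]_n -> R) (B : R) :
  mu.-integrable cube (EFin \o a) -> measurable_fun cube b ->
  (forall x, cube x -> `|b x| <= B) ->
  mu.-integrable cube (fun x => (a x * b x)%:E).
Proof.
move=> ia mb bB; apply: (integrableMl mC ia mb).
exists B; split; first exact: num_real.
by move=> c Bc x Cx /=; exact: le_trans (bB x Cx) (ltW Bc).
Qed.

Lemma cbounded_Re B f x : cbounded B f -> cube x -> `|Re (f x)| <= 1 + B.
Proof.
move=> fB Cx; apply: norm_le_sqr_bound; rewrite -real_normK ?num_real //.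
exact: le_trans (Re_le_sqn _) (fB x Cx).
Qed.

Lemma cbounded_Im B f x : cbounded B f -> cube x -> `|Im (f x)| <= 1 + B.
Proof.
move=> fB Cx; apply: norm_le_sqr_bound; rewrite -real_normK ?num_real //.
exact: le_trans (Im_le_sqn _) (fB x Cx).
Qed.

Lemma cintegrableM_bounded B f g : cintegrable f -> cmeasurable g ->
  cbounded B g -> cintegrable (fun x => f x * g x).
Proof.
move=> [iR iI] [mR mI] gB; split.
  under eq_fun do rewrite ReM EFinB.
  apply: integrableB => //.
    by apply: integrable_mul_bounded => // x Cx; exact: cbounded_Re gB Cx.
  by apply: integrable_mul_bounded => // x Cx; exact: cbounded_Im gB Cx.
under eq_fun do rewrite ImM EFinD.
apply: integrableD => //.
  by apply: integrable_mul_bounded => // x Cx; exact: cbounded_Im gB Cx.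
by apply: integrable_mul_bounded => // x Cx; exact: cbounded_Re gB Cx.
Qed.

Lemma cbounded_cst z : cbounded (sqn z) (cst z).
Proof. by []. Qed.

Lemma cintegrable_bounded B f : cmeasurable f -> cbounded B f -> cintegrable f.
Proof.
move=> [mR mI] fB; split; apply: integrable_bounded_cube => // x Cx.
  exact: cbounded_Re fB Cx.
exact: cbounded_Im fB Cx.
Qed.

Lemma cintegrableD f g : cintegrable f -> cintegrable g ->
  cintegrable (fun x => f x + g x).
Proof.
move=> [? ?] [? ?]; split.
  by under eq_fun do rewrite ReD EFinD; exact: integrableD.
by under eq_fun do rewrite ImD EFinD; exact: integrableD.
Qed.

Lemma cintegrableB f g : cintegrable f -> cintegrable g ->
  cintegrable (fun x => f x - g x).
Proof.
move=> [? ?] [? ?]; split.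
  by under eq_fun do rewrite ReB EFinB; exact: integrableB.
by under eq_fun do rewrite ImB EFinB; exact: integrableB.
Qed.

Lemma cintegrableZ z f : cintegrable f -> cintegrable (fun x => z * f x).
Proof.
move=> fi; rewrite (_ : (fun x => _) = fun x => f x * cst z x).
  exact: cintegrableM_bounded fi (cmeasurable_cst z) (cbounded_cst z).
by apply/funext => x; rewrite mulrC.
Qed.

Lemma cintegrable0 : cintegrable (fun=> 0).
Proof. exact: cintegrable_bounded (cmeasurable_cst 0) (cbounded_cst 0). Qed.

Lemma cintegrable_sum (I : Type) (s : seq I) (F : I -> 'rV[R]_n -> R[i]) :
  (forall i, cintegrable (F i)) -> cintegrable (fun x => \sum_(i <- s) F i x).
Proof.
move=> Fi; elim: s => [|i s IHs].
  by under eq_fun do rewrite big_nil; exact: cintegrable0.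
by under eq_fun do rewrite big_cons; exact: cintegrableD.
Qed.

Lemma eq_torus_integral f g : (forall x, cube x -> f x = g x) ->
  torus_integral f = torus_integral g.
Proof.
move=> fg; rewrite /torus_integral; congr Complex; apply: eq_Rintegral => x;
  by rewrite inE => /fg ->.
Qed.

Lemma torus_integralD f g : cintegrable f -> cintegrable g ->
  torus_integral (fun x => f x + g x) = torus_integral f + torus_integral g.
Proof.
move=> [? ?] [? ?]; apply: complex_ext; rewrite ?ReD ?ImD /=.
  by rewrite -RintegralD //; apply: eq_Rintegral => x _; rewrite ReD.
by rewrite -RintegralD //; apply: eq_Rintegral => x _; rewrite ImD.
Qed.

Lemma torus_integralZ z f : cintegrable f ->
  torus_integral (fun x => z * f x) = z * torus_integral f.
Proof.
case: z => a b [iR iI].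
have iZ (r : R) (h : 'rV[R]_n -> R) : mu.-integrable cube (EFin \o h) ->
    mu.-integrable cube (EFin \o (fun x => r * h x)).
  by move=> ih; exact: (integrableZl mC r ih).
apply: complex_ext; rewrite ?ReM ?ImM /=.
  rewrite -!RintegralZl // -RintegralB //; [|exact: iZ|exact: iZ].
  by apply: eq_Rintegral => x _; rewrite ReM.
rewrite -!RintegralZl // -RintegralD //; [|exact: iZ|exact: iZ].
by apply: eq_Rintegral => x _; rewrite ImM.
Qed.

Lemma torus_integral0 : torus_integral (cst 0 : 'rV[R]_n -> R[i]) = 0.
Proof.
rewrite -[RHS](mul0r (torus_integral (cst 0 : 'rV[R]_n -> R[i]))) -torus_integralZ; last first.
  exact: cintegrable0.
by apply: eq_torus_integral => x _; rewrite mul0r.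
Qed.

Lemma torus_integralB f g : cintegrable f -> cintegrable g ->
  torus_integral (fun x => f x - g x) = torus_integral f - torus_integral g.
Proof.
move=> fi gi; rewrite -[- torus_integral g]mulN1r -torus_integralZ //.
rewrite -torus_integralD //; last exact: cintegrableZ.
by apply: eq_torus_integral => x _; rewrite mulN1r.
Qed.

Lemma torus_integral_sum (I : Type) (s : seq I) (F : I -> 'rV[R]_n -> R[i]) :
  (forall i, cintegrable (F i)) ->
  torus_integral (fun x => \sum_(i <- s) F i x) =
  \sum_(i <- s) torus_integral (F i).
Proof.
move=> Fi; elim: s => [|i s IHs].
  rewrite big_nil -[RHS]torus_integral0.
  by apply: eq_torus_integral => x _; rewrite big_nil.
rewrite big_cons -IHs -torus_integralD //; last exact: cintegrable_sum.
by apply: eq_torus_integral => x _; rewrite big_cons.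
Qed.

Lemma torus_integral_cst z : torus_integral (cst z : 'rV[R]_n -> R[i]) = z.
Proof.
by apply: complex_ext; rewrite /= Rintegral_cst // [X in fine X]mu_cube mulr1.
Qed.

Lemma torus_integral_dominated (f : 'rV[R]_n -> R[i])
    (P_ : nat -> 'rV[R]_n -> R[i]) h B : cintegrable f ->
  (forall k, cmeasurable (P_ k)) -> (forall k, cbounded B (P_ k)) ->
  (forall x, cube x -> Re (P_ k x) @[k --> \oo] --> Re (h x)) ->
  (forall x, cube x -> Im (P_ k x) @[k --> \oo] --> Im (h x)) ->
  Re (torus_integral (fun x => f x * P_ k x)) @[k --> \oo] -->
    Re (torus_integral (fun x => f x * h x)) /\
  Im (torus_integral (fun x => f x * P_ k x)) @[k --> \oo] -->
    Im (torus_integral (fun x => f x * h x)).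
Proof.
move=> fi mP PB cR cI; have [iR iI] := fi; have [mR mI] := cintegrable_measurable fi.
pose G x := (`|Re (f x)| + `|Im (f x)|) * (1 + B).
have iG : mu.-integrable cube (EFin \o G).
  rewrite (_ : _ \o _ = fun x => (1 + B)%:E * (`|Re (f x)| + `|Im (f x)|)%:E)%E.
    apply: integrableZl => //; under eq_fun do rewrite EFinD.
    by apply: integrableD => //; [exact: (integrable_norm (f := fun x => Re (f x)))
      |exact: (integrable_norm (f := fun x => Im (f x)))].
  by apply/funext => x; rewrite /= /G mulrC EFinM.
have bnd (a b c d : R) : `|c| <= 1 + B -> `|d| <= 1 + B ->
    `|a * c| + `|b * d| <= (`|a| + `|b|) * (1 + B).
  by move=> c1 d1; rewrite !normrM mulrDl lerD // ler_wpM2l.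
split.
- have [|x Cx|||_ cv] := @Rintegral_dominated _ _ _ mu cube
      (fun k x => Re (f x * P_ k x)) (fun x => Re (f x * h x)) G mC => //.
  + by move=> k; case: (cmeasurableM (cintegrable_measurable fi) (mP k)).
  + under eq_fun do rewrite ReM; rewrite ReM.
    by apply: cvgB; (apply: cvgM; first exact: cvg_cst); [exact: cR|exact: cI].
  + move=> k x Cx; rewrite ReM; apply: le_trans (ler_normB _ _) _.
    by apply: bnd; [exact: cbounded_Re (PB k) Cx|exact: cbounded_Im (PB k) Cx].
- have [|x Cx|||_ cv] := @Rintegral_dominated _ _ _ mu cube
      (fun k x => Im (f x * P_ k x)) (fun x => Im (f x * h x)) G mC => //.
  + by move=> k; case: (cmeasurableM (cintegrable_measurable fi) (mP k)).
  + under eq_fun do rewrite ImM; rewrite ImM.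
    by apply: cvgD; (apply: cvgM; first exact: cvg_cst); [exact: cI|exact: cR].
  + move=> k x Cx; rewrite ImM; apply: le_trans (ler_normD _ _) _.
    by apply: bnd; [exact: cbounded_Im (PB k) Cx|exact: cbounded_Re (PB k) Cx].
Qed.

End complex_integration.

(** * Characters *)

Section continuous_pointwise.
Context {R : realType} {T : topologicalType}.
Implicit Types u v : T -> R.

Lemma continuous_addf u v : continuous u -> continuous v ->
  continuous (fun x => u x + v x).
Proof. by move=> cu cv x; apply: cvgD; [exact: cu | exact: cv]. Qed.

Lemma continuous_subf u v : continuous u -> continuous v ->
  continuous (fun x => u x - v x).
Proof. by move=> cu cv x; apply: cvgB; [exact: cu | exact: cv]. Qed.

Lemma continuous_mulf u v : continuous u -> continuous v ->
  continuous (fun x => u x * v x).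
Proof. by move=> cu cv x; apply: cvgM; [exact: cu | exact: cv]. Qed.

Lemma continuous_cstf (a : R) : continuous (fun _ : T => a).
Proof. exact: cst_continuous. Qed.

Lemma continuous_oppf u : continuous u -> continuous (fun x => - u x).
Proof. by move=> cu x; apply: cvgN; exact: cu. Qed.

End continuous_pointwise.

Section characters.
Context {R : realType} {n : nat}.
Implicit Types (f g h : 'rV[R]_n -> R[i]) (x y : 'rV[R]_n) (nu kappa : 'rV[int]_n).
Notation mu := (@lebesgue_rV R n).
Notation cube := (@unit_cube R n).

Definition pairing nu x : R := \sum_(i < n) (nu ord0 i)%:~R * x ord0 i.

Lemma characterE nu x :
  character nu x = Complex (cos (2 * pi * pairing nu x)) (- sin (2 * pi * pairing nu x)).
Proof. by []. Qed.

Lemma pairingDr nu x y : pairing nu (x + y) = pairing nu x + pairing nu y.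
Proof. by rewrite -big_split; apply: eq_bigr => i _; rewrite mxE mulrDr. Qed.

Lemma pairingDl nu kappa x : pairing (nu + kappa) x = pairing nu x + pairing kappa x.
Proof. by rewrite -big_split; apply: eq_bigr => i _; rewrite mxE intrD mulrDl. Qed.

Lemma pairingNl nu x : pairing (- nu) x = - pairing nu x.
Proof. by rewrite -sumrN; apply: eq_bigr => i _; rewrite mxE mulrNz mulNr. Qed.

Lemma pairing_int nu (k : 'rV[int]_n) :
  exists m : int, pairing nu (map_mx intr k) = m%:~R.
Proof.
exists (\sum_(i < n) nu ord0 i * k ord0 i); rewrite /pairing.
rewrite (big_morph (fun m : int => m%:~R : R) (@intrD R) (erefl : (0 : int)%:~R = 0 :> R)).
by apply: eq_bigr => i _; rewrite mxE intrM.
Qed.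

Lemma cosD2pi_int (t : R) (m : int) :
  (cos (t + 2 * pi * m%:~R) = cos t) * (sin (t + 2 * pi * m%:~R) = sin t).
Proof.
have p0 (k : nat) (s : R) :
    (cos (s + 2 * pi * k%:R) = cos s) * (sin (s + 2 * pi * k%:R) = sin s).
  elim: k s => [|k IHk] s; first by rewrite mulr0 addr0.
  have -> : s + 2 * pi * k.+1%:R = s + 2 * pi * k%:R + pi *+ 2.
    by rewrite -natr1 mulr2n; ring.
  by rewrite cosD2pi sinD2pi !IHk.
case: m => k; first exact: p0.
rewrite NegzE mulrNz.
have := p0 k.+1 (t + 2 * pi * - k.+1%:R).
have -> : t + 2 * pi * - k.+1%:R + 2 * pi * k.+1%:R = t by ring.
by move=> [-> ->].
Qed.

Lemma character_periodic nu : Zn_periodic (character nu : 'rV[R]_n -> R[i]).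
Proof.
move=> x k; rewrite !characterE pairingDr; have [m ->] := pairing_int nu k.
by rewrite (mulrDr (2 * pi)) !cosD2pi_int.
Qed.

Lemma characterD nu x y : character nu (x + y) = character nu x * character nu y.
Proof.
rewrite !characterE pairingDr (mulrDr (2 * pi)); apply: complex_ext.
  by rewrite ReM /= cosD; ring.
by rewrite ImM /= sinD; ring.
Qed.

Lemma characterMl nu kappa x :
  character nu x * character kappa x = character (nu + kappa) x.
Proof.
rewrite !characterE pairingDl (mulrDr (2 * pi)); apply: complex_ext.
  by rewrite ReM /= cosD; ring.
by rewrite ImM /= sinD; ring.
Qed.

Lemma character0l x : character 0 x = 1.
Proof.
rewrite characterE (_ : pairing 0 x = 0); last first.
  by rewrite /pairing big1 // => i _; rewrite mxE mul0r.
by rewrite mulr0 cos0 sin0 oppr0.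
Qed.

Lemma character_conj nu x : (character nu x)^*%C = character (- nu) x.
Proof. by rewrite !characterE pairingNl mulrN cosN sinN /=. Qed.

Lemma characterN nu x : character nu (- x) = character (- nu) x.
Proof.
rewrite !characterE pairingNl (_ : pairing nu (- x) = - pairing nu x) //.
by rewrite -sumrN; apply: eq_bigr => i _; rewrite mxE mulrN.
Qed.

Lemma sqn_character nu x : sqn (character nu x) = 1.
Proof. by rewrite characterE sqnE /= sqrrN cos2Dsin2. Qed.

Definition ccontinuous f :=
  continuous (fun x => Re (f x)) /\ continuous (fun x => Im (f x)).

Lemma pairing_continuous nu : continuous (pairing nu : 'rV[R]_n -> R).
Proof.
rewrite /pairing; elim: (index_enum _) => [|i s IHs].
  by under eq_fun do rewrite big_nil; exact: cst_continuous.
under eq_fun do rewrite big_cons.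
apply: continuous_addf IHs.
by apply: continuous_mulf; [exact: continuous_cstf | exact: coord_continuous].
Qed.

Lemma character_ccontinuous nu : ccontinuous (character nu).
Proof.
have cp : continuous (fun x : 'rV[R]_n => 2 * pi * pairing nu x).
  by apply: continuous_mulf; [exact: continuous_cstf | exact: pairing_continuous].
have cc (F : R -> R) : continuous F ->
    continuous (fun x : 'rV[R]_n => F (2 * pi * pairing nu x)).
  by move=> cF x; apply: continuous_comp; [exact: cp | exact: cF].
by split; [exact: cc (@continuous_cos R) | exact/continuous_oppf/cc/continuous_sin].
Qed.

Lemma ccontinuousM f g : ccontinuous f -> ccontinuous g ->
  ccontinuous (fun x => f x * g x).
Proof.
move=> [fR fI] [gR gI]; split.
  under eq_fun do rewrite ReM.
  by apply: continuous_subf; exact: continuous_mulf.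
under eq_fun do rewrite ImM.
by apply: continuous_addf; exact: continuous_mulf.
Qed.

Lemma ccontinuousD f g : ccontinuous f -> ccontinuous g ->
  ccontinuous (fun x => f x + g x).
Proof.
move=> [fR fI] [gR gI]; split.
  under eq_fun do rewrite ReD; exact: continuous_addf.
under eq_fun do rewrite ImD; exact: continuous_addf.
Qed.

Lemma ccontinuous_cst (z : R[i]) : ccontinuous (cst z).
Proof. by split; exact: continuous_cstf. Qed.

Lemma ccontinuous_measurable f : ccontinuous f -> cmeasurable f.
Proof.
by move=> [cR cI]; split; [exact: (continuous_measurable_cube cR)
  | exact: (continuous_measurable_cube cI)].
Qed.

Lemma character_cmeasurable nu : cmeasurable (character nu : 'rV[R]_n -> R[i]).
Proof. exact/ccontinuous_measurable/character_ccontinuous. Qed.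

Lemma character_cbounded nu : cbounded 1 (character nu : 'rV[R]_n -> R[i]).
Proof. by move=> x _; rewrite sqn_character. Qed.

Lemma cintegrable_character nu : cintegrable (character nu : 'rV[R]_n -> R[i]).
Proof. exact: cintegrable_bounded (character_cmeasurable nu) (character_cbounded nu). Qed.

Lemma cintegrableM_character f nu : cintegrable f ->
  cintegrable (fun x => f x * character nu x).
Proof.
move=> fi; exact: cintegrableM_bounded fi (character_cmeasurable nu) (character_cbounded nu).
Qed.

(** * Sums over the grid *)

Lemma lattice_ptD N (d e : grid N) : exists k : 'rV[int]_n,
  lattice_pt (d + e) + map_mx intr k = lattice_pt d + lattice_pt e :> 'rV[R]_n.
Proof.
exists (\row_i ((d ord0 i + e ord0 i) %/ N.*2.+2)%N%:Z).
apply/rowP => i; rewrite !mxE -mulrDl -natrD /=.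
rewrite [in RHS](divn_eq (d ord0 i + e ord0 i) N.*2.+2) natrD natrM -/(mesh N).
rewrite addrC mulrDl mulfK // gt_eqF //; exact: mesh_gt0.
Qed.

Lemma periodic_lattice_ptD f N (d e : grid N) x : Zn_periodic f ->
  f (lattice_pt (d + e) + x) = f (lattice_pt d + lattice_pt e + x).
Proof.
move=> pf; have [k <-] := lattice_ptD d e.
by rewrite addrAC pf.
Qed.

Lemma periodic_lattice_ptB f N (d e : grid N) : Zn_periodic f ->
  f (lattice_pt (d - e)) = f (lattice_pt d - lattice_pt e).
Proof.
move=> pf; rewrite -[in RHS](subrK e d).
have [k E] := lattice_ptD (d - e) e.
by rewrite -(pf (_ - _) k) addrAC E addrK.
Qed.

Lemma sum_corner f N : Zn_periodic f ->
  \sum_(d : grid N) f (corner d) = \sum_(d : grid N) f (lattice_pt d).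
Proof.
move=> pf; pose h : @grid n N := const_mx (inord N.+1).
have hE : lattice_pt h = const_mx 2^-1 :> 'rV[R]_n.
  apply/rowP => i; rewrite !mxE inordK; last by rewrite !ltnS -addnn leq_addr.
  by rewrite -mesh_half mulrAC mulfV ?mul1r // gt_eqF // mesh_gt0.
rewrite [RHS](reindex_inj (@addIr _ (- h))) /=; apply: eq_bigr => d _.
by rewrite periodic_lattice_ptB // hE.
Qed.

(** The Riemann sums of a nontrivial character vanish for fine meshes, because
    they are multiplied by a nontrivial root of unity when the grid is
    translated by one step. *)
Lemma sum_character N nu i : nu ord0 i != 0 ->
  (`|nu ord0 i| < N)%N -> \sum_(d : grid N) character nu (corner d : 'rV[R]_n) = 0.
Proof.
move=> nui0 nuN; pose e : @grid n N := \row_j (if j == i then inord 1 else 0).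
have eE j : lattice_pt e ord0 j = (if j == i then (mesh N : R)^-1 else 0).
  rewrite !mxE; case: ifP => _; last by rewrite mul0r.
  by rewrite inordK // mul1r.
pose w : R[i] := character nu (lattice_pt e).
have pE : pairing nu (lattice_pt e) = (nu ord0 i)%:~R / (mesh N : R).
  rewrite /pairing (bigD1 i) //= eE eqxx big1 ?addr0 // => j ji.
  by rewrite eE (negbTE ji) mulr0.
have w1 : w != 1.
  apply/eqP => /(congr1 (fun z : R[i] => Re z)); rewrite /w characterE /= pE.
  set t := pi * ((nu ord0 i)%:~R / (mesh N : R)).
  have -> : 2 * pi * ((nu ord0 i)%:~R / (mesh N : R)) = t *+ 2.
    by rewrite mulr2n /t; ring.
  have t0 : t != 0.
    by rewrite !mulf_neq0 ?intr_eq0 ?invr_eq0 // gt_eqF ?pi_gt0 ?mesh_gt0.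
  have tpi : `|t| < pi.
    rewrite /t normrM gtr0_norm ?pi_gt0 // gtr_pMr ?pi_gt0 // normrM.
    rewrite normfV (gtr0_norm (mesh_gt0 _)) ltr_pdivrMr ?mesh_gt0 // mul1r.
    rewrite -intr_norm -abszE -[(_%:~R)]/(_%:R) ltr_nat.
    by apply: (ltn_trans nuN); rewrite -addnn -addSn -addnS leq_addr.
  have s0 : sin t != 0.
    have [tp|tn] := ltrP 0 t.
      by rewrite gt_eqF // sin_gt0_pi // tp /= -(gtr0_norm tp).
    have tn' : 0 < - t by rewrite oppr_gt0 lt_neqAle t0.
    by rewrite -[t]opprK sinN oppr_eq0 gt_eqF // sin_gt0_pi // tn' /= -(gtr0_norm tn') normrN.
  rewrite cos_mulr2n => /eqP; rewrite -subr_eq0 cos2sin2.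
  have -> : (1 - sin t ^+ 2) *+ 2 - 1 - 1 = - (sin t ^+ 2 *+ 2) by rewrite !mulr2n; ring.
  by rewrite oppr_eq0 mulrn_eq0 /= sqrf_eq0 (negbTE s0).
set S := LHS; apply/eqP.
have SE : S = w * S.
  rewrite mulr_sumr /S (reindex_inj (@addrI _ e)) /=; apply: eq_bigr => d _.
  rewrite /corner periodic_lattice_ptD; last exact: character_periodic.
  by rewrite /w -characterD addrA.
move/eqP: SE; rewrite -subr_eq0 -[X in X - _]mul1r -mulrBl mulf_eq0 subr_eq0.
by rewrite eq_sym (negbTE w1).
Qed.

Lemma complex_riemann_cvg f (B : R) : ccontinuous f -> (forall x, sqn (f x) <= B) ->
  (mesh N : R)^-1 ^+ n * Re (\sum_(d : grid N) f (corner d)) @[N --> \oo] --> Re (torus_integral f) /\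
  (mesh N : R)^-1 ^+ n * Im (\sum_(d : grid N) f (corner d)) @[N --> \oo] --> Im (torus_integral f).
Proof.
move=> [cR cI] fB; split.
  under eq_fun do rewrite Re_sum.
  apply: (@riemann_cvg R n _ (1 + B) cR) => x /=.
  apply: norm_le_sqr_bound; rewrite -real_normK ?num_real //.
  exact: le_trans (Re_le_sqn _) (fB x).
under eq_fun do rewrite Im_sum.
  apply: (@riemann_cvg R n _ (1 + B) cI) => x /=.
apply: norm_le_sqr_bound; rewrite -real_normK ?num_real //.
exact: le_trans (Im_le_sqn _) (fB x).
Qed.

Lemma torus_integral_character nu :
  torus_integral (character nu : 'rV[R]_n -> R[i]) = (nu == 0)%:R.
Proof.
have [->|nu0] := eqVneq nu 0.
  rewrite -[RHS](torus_integral_cst (n := n)).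
  by apply: eq_torus_integral => x _; rewrite character0l.
have [i nui] : exists i, nu ord0 i != 0.
  apply/existsP; apply: contraNT nu0 => /existsPn h; apply/eqP/rowP => i.
  by rewrite mxE; apply/eqP; rewrite -[_ == _]negbK h.
have [|cR cI] := complex_riemann_cvg (B := 1) (character_ccontinuous nu).
  by move=> x; rewrite sqn_character.
have ev (F : R[i] -> R) : F 0 = 0 -> (mesh N : R)^-1 ^+ n *
    F (\sum_(d : grid N) character nu (corner d : 'rV[R]_n)) @[N --> \oo] --> (0 : R).
  move=> F0; apply: cvg_near_cst; near=> N.
  rewrite (sum_character nui) ?F0 ?mulr0 //.
  by near: N; exists `|nu ord0 i|.+1.
apply: complex_ext => /=.
  by apply: (cvg_unique _ cR); [exact: Rhausdorff | exact: ev].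
by apply: (cvg_unique _ cI); [exact: Rhausdorff | exact: ev].
Unshelve. all: by end_near. Qed.

(** For the points of a grid and the coefficients given by a character, the
    positive definite form is a multiple of the Riemann sum of the Fourier
    coefficient, because the grid is a group modulo periods. *)
Lemma posdef_fourier_ge0 f (B : R) : Zn_periodic f -> ccontinuous f ->
  (forall x, sqn (f x) <= B) -> positive_definite f ->
  forall nu, 0 <= fourier_coef f nu.
Proof.
move=> pf cf fB pdf nu.
pose g x := f x * character nu x.
have pg : Zn_periodic g by move=> x k; rewrite /g pf character_periodic.
have cg : ccontinuous g by exact: ccontinuousM cf (character_ccontinuous nu).
have gB x : sqn (g x) <= B by rewrite sqnM sqn_character mulr1.
have [cR cI] := complex_riemann_cvg cg gB.
have sum_ge0 N : 0 <= \sum_(d : grid N) g (corner d).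
  rewrite sum_corner //; set S := (X in 0 <= X).
  have S2 : 0 <= \sum_(d : grid N) \sum_(e : grid N)
      character nu (lattice_pt d) * (character nu (lattice_pt e))^*%C *
      f (lattice_pt d - lattice_pt e).
    have := pdf #|@grid n N| (fun i : 'I_#|@grid n N| => lattice_pt (enum_val i))
      (fun i : 'I_#|@grid n N| => character nu (lattice_pt (enum_val i))).
    have en (G : grid N -> R[i]) :
        \sum_(d : grid N) G d = \sum_(i < #|@grid n N|) G (enum_val i).
      exact: (reindex _ (onW_bij _ (@enum_val_bij _))).
    by rewrite en; under [X in _ -> 0 <= X]eq_bigr do rewrite en.
  have SE : \sum_(d : grid N) \sum_(e : grid N)
      character nu (lattice_pt d) * (character nu (lattice_pt e))^*%C *
      f (lattice_pt d - lattice_pt e) = S *+ #|@grid n N|.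
    rewrite exchange_big -sumr_const; apply: eq_bigr => e _.
    rewrite /S [RHS](reindex_inj (@addIr _ (- e))); apply: eq_bigr => d _.
    rewrite periodic_lattice_ptB // /g mulrC; congr (_ * _).
    by rewrite characterD character_conj characterN.
  move: S2; rewrite SE pmulrn_lge0 //; apply/card_gt0P; by exists 0.
rewrite complex_ge0; apply/andP; split.
  apply/eqP; apply: (cvg_unique _ cI) => //; apply: cvg_near_cst; apply: nearW => N.
  by have := sum_ge0 N; rewrite complex_ge0 => /andP[/eqP -> _]; rewrite mulr0.
apply: (closed_cvg (fun r : R => 0 <= r)) cR; first exact: closed_ge.
apply: nearW => N; have := sum_ge0 N; rewrite complex_ge0 => /andP[_ h].
by rewrite mulr_ge0 // exprn_ge0 // invr_ge0 ltW // mesh_gt0.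
Qed.

End characters.

(** * Sharpening polynomials *)

Section sharpen.
Context {R : realType}.
Implicit Types u v r : R.

Lemma bernoulli_ge v m : 0 <= v <= 1 -> 1 - m%:R * v <= (1 - v) ^+ m.
Proof.
case/andP=> v0 v1; elim: m => [|m IHm]; first by rewrite mul0r subr0 expr0.
rewrite exprS -natr1; apply: (le_trans _ (ler_wpM2l _ IHm)); last by rewrite subr_ge0.
have : 0 <= m%:R * v * v by rewrite !mulr_ge0.
by rewrite mulrDl mul1r; move: (m%:R * v) => a ?; nra.
Qed.

Lemma bernoulli_le v m : 0 <= v <= 1 -> (1 - v) ^+ m <= (1 + m%:R * v)^-1.
Proof.
case/andP=> v0 v1.
have p : 0 < 1 + m%:R * v by rewrite ltr_pwDl // mulr_ge0.
rewrite -[X in _ <= X]mul1r ler_pdivlMr //.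
have h : 1 + m%:R * v <= (1 + v) ^+ m.
  elim: m {p} => [|m IHm]; first by rewrite mul0r addr0 expr0.
  rewrite exprS -natr1; apply: (le_trans _ (ler_wpM2l _ IHm)); last by rewrite addr_ge0.
  have : 0 <= m%:R * v * v by rewrite !mulr_ge0.
  by rewrite mulrDl mul1r; move: (m%:R * v) => a ?; nra.
apply: (le_trans (ler_wpM2l _ h)); first by rewrite exprn_ge0 // subr_ge0.
rewrite -exprMn exprn_ile1 //; nra.
Qed.

Lemma cvg_natmul_geometric r : 0 <= r < 1 -> j%:R * r ^+ j @[j --> \oo] --> (0 : R).
Proof.
case/andP=> r0 r1; have [->|rn0] := eqVneq r 0.
  by apply: cvg_near_cst; exists 1%N => // j /= j0; rewrite expr0n gtn_eqF // mulr0.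
have rp : 0 < r by rewrite lt_neqAle eq_sym rn0.
pose s := Num.sqrt r.
have sp : 0 < s by rewrite sqrtr_gt0.
have s1 : s < 1 by rewrite -sqrtr1 ltr_sqrt.
pose d := s^-1 - 1.
have dp : 0 < d by rewrite subr_gt0 invf_gt1.
have js j : j%:R * s ^+ j <= d^-1.
  have h : 1 + j%:R * d <= (s^-1) ^+ j.
    rewrite -(subrK 1 (s^-1)) -/d addrC [X in X ^+ _]addrC.
    elim: j => [|j IHj]; first by rewrite mul0r add0r expr0.
    rewrite exprS -natr1; apply: (le_trans _ (ler_wpM2l _ IHj)); last by rewrite addr_ge0 // ltW.
    have : 0 <= j%:R * d * d by rewrite !mulr_ge0 // ltW.
    by rewrite mulrDl mul1r; move: (j%:R * d) => a ?; nra.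
  rewrite -[X in _ <= X]mul1r ler_pdivlMr //.
  have sj : 0 < s ^+ j by rewrite exprn_gt0.
  rewrite -(ler_pM2l sj) in h.
  have : s ^+ j * s^-1 ^+ j = 1 by rewrite -exprMn mulfV ?expr1n // gt_eqF.
  by move=> E; rewrite E in h; nra.
apply: (@squeeze_cvgr _ _ _ _ (cst 0) (fun j => d^-1 * s ^+ j)).
- apply: nearW => j; rewrite mulr_ge0 ?exprn_ge0 //=.
  rewrite -[r]sqr_sqrtr // -/s -exprM mulnC exprM expr2 mulrA.
  by rewrite ler_wpM2r ?exprn_ge0 // ltW.
- exact: cvg_cst.
- by apply: cvg_geometric; rewrite ger0_norm ?ltW.
Qed.

Definition sharpen (K j : nat) u : R := (1 - u ^+ j) ^+ (j * K ^ j).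

Lemma sharpen_itv K j u : 0 <= u <= 1 -> 0 <= sharpen K j u <= 1.
Proof.
case/andP=> u0 u1.
have h0 : 0 <= 1 - u ^+ j by rewrite subr_ge0 exprn_ile1.
by rewrite exprn_ge0 //= exprn_ile1 // gerBl exprn_ge0.
Qed.

(** The exponent [j * K ^ j] makes [j * (K * u) ^ j] the critical quantity in
    both Bernoulli inequalities. The factor [j] decides the boundary case
    [K * u = 1]. *)
Lemma sharpen_cvg K u : 0 <= u <= 1 ->
  sharpen K j u @[j --> \oo] --> ((K%:R * u < 1 :> R)%:R : R).
Proof.
move=> u01; have [u0 u1] := andP u01.
have uj j : 0 <= u ^+ j <= 1 by rewrite exprn_ge0 //= exprn_ile1.
have Kuj j : (j * K ^ j)%:R * u ^+ j = j%:R * (K%:R * u) ^+ j.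
  by rewrite natrM natrX exprMn mulrA.
have [Ku|Ku] := ltrP.
- apply: (@squeeze_cvgr _ _ _ _ (fun j => 1 - j%:R * (K%:R * u) ^+ j) (cst 1)).
  + apply: nearW => j; have /andP[_ ->] := sharpen_itv K j u01; rewrite andbT.
    by rewrite -Kuj bernoulli_ge.
  + rewrite -[X in _ --> X]subr0; apply: cvgB; first exact: cvg_cst.
    by apply: cvg_natmul_geometric; rewrite Ku mulr_ge0.
  + exact: cvg_cst.
- apply: (@squeeze_cvgr _ _ _ _ (cst 0) (fun j => j.+1%:R^-1)).
  + apply: nearW => j; have /andP[-> _] := sharpen_itv K j u01; rewrite /=.
    apply: le_trans (bernoulli_le _ (uj j)) _; rewrite Kuj.
    rewrite lef_pV2 ?posrE ?ltr0n //; last first.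
      by rewrite ltr_pwDl // mulr_ge0 // exprn_ge0 // (le_trans ler01).
    by rewrite -nat1r lerD2l ler_peMr // exprn_ege1.
  + exact: cvg_cst.
  + exact: cvg_harmonic.
Qed.

End sharpen.

(** * Trigonometric polynomials *)

Section trigonometric_polynomials.
Context {R : realType} {n : nat}.
Implicit Types (f g h P Q : 'rV[R]_n -> R[i]) (x y : 'rV[R]_n) (nu kappa : 'rV[int]_n).
Notation mu := (@lebesgue_rV R n).
Notation cube := (@unit_cube R n).

Inductive trigpoly : ('rV[R]_n -> R[i]) -> Prop :=
| trigpoly_character nu : trigpoly (character nu)
| trigpolyZ z P : trigpoly P -> trigpoly (fun x => z * P x)
| trigpolyD P Q : trigpoly P -> trigpoly Q -> trigpoly (fun x => P x + Q x).

Lemma eq_trigpoly P Q : (forall x, P x = Q x) -> trigpoly P -> trigpoly Q.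
Proof. by move=> /funext ->. Qed.

Lemma trigpoly_cst z : trigpoly (cst z).
Proof.
apply: eq_trigpoly (trigpolyZ z (trigpoly_character 0)) => x.
by rewrite character0l mulr1.
Qed.

Lemma trigpolyM P Q : trigpoly P -> trigpoly Q -> trigpoly (fun x => P x * Q x).
Proof.
move=> tP tQ; elim: tP => [nu|z P' _ IH|P1 P2 _ IH1 _ IH2].
- elim: tQ => [kappa|z Q' _ IH|Q1 Q2 _ IH1 _ IH2].
  + apply: eq_trigpoly (trigpoly_character (nu + kappa)) => x.
    by rewrite characterMl.
  + by apply: eq_trigpoly (trigpolyZ z IH) => x; rewrite mulrCA.
  + by apply: eq_trigpoly (trigpolyD IH1 IH2) => x; rewrite mulrDr.
- by apply: eq_trigpoly (trigpolyZ z IH) => x; rewrite mulrA.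
- by apply: eq_trigpoly (trigpolyD IH1 IH2) => x; rewrite mulrDl.
Qed.

Lemma trigpolyB P Q : trigpoly P -> trigpoly Q -> trigpoly (fun x => P x - Q x).
Proof.
move=> tP tQ; apply: eq_trigpoly (trigpolyD tP (trigpolyZ (-1) tQ)) => x.
by rewrite mulN1r.
Qed.

Lemma trigpolyX P m : trigpoly P -> trigpoly (fun x => P x ^+ m).
Proof.
move=> tP; elim: m => [|m IHm].
  by apply: eq_trigpoly (trigpoly_cst 1) => x; rewrite expr0.
by apply: eq_trigpoly (trigpolyM tP IHm) => x; rewrite exprS.
Qed.

Lemma trigpoly_prod (I : Type) (s : seq I) (F : I -> 'rV[R]_n -> R[i]) :
  (forall i, trigpoly (F i)) -> trigpoly (fun x => \prod_(i <- s) F i x).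
Proof.
move=> tF; elim: s => [|i s IHs].
  by apply: eq_trigpoly (trigpoly_cst 1) => x; rewrite big_nil.
by apply: eq_trigpoly (trigpolyM (tF i) IHs) => x; rewrite big_cons.
Qed.

Lemma trigpoly_sum (I : Type) (s : seq I) (F : I -> 'rV[R]_n -> R[i]) :
  (forall i, trigpoly (F i)) -> trigpoly (fun x => \sum_(i <- s) F i x).
Proof.
move=> tF; elim: s => [|i s IHs].
  by apply: eq_trigpoly (trigpoly_cst 0) => x; rewrite big_nil.
by apply: eq_trigpoly (trigpolyD (tF i) IHs) => x; rewrite big_cons.
Qed.

Lemma trigpoly_periodic P : trigpoly P -> Zn_periodic P.
Proof.
elim=> [nu|z P' _ IH|P1 P2 _ IH1 _ IH2] x k; first exact: character_periodic.
  by rewrite IH.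
by rewrite IH1 IH2.
Qed.

Lemma trigpoly_ccontinuous P : trigpoly P -> ccontinuous P.
Proof.
elim=> [nu|z P' _ IH|P1 P2 _ IH1 _ IH2]; first exact: character_ccontinuous.
  exact: ccontinuousM (ccontinuous_cst z) IH.
exact: ccontinuousD.
Qed.

Lemma sqnD (z w : R[i]) : sqn (z + w) <= 2 * sqn z + 2 * sqn w.
Proof.
case: z => a b; case: w => c d; rewrite !sqnE /= -subr_ge0.
rewrite (_ : _ - _ = (a - c) ^+ 2 + (b - d) ^+ 2); last by ring.
by rewrite addr_ge0 ?sqr_ge0.
Qed.

Lemma trigpoly_bounded P : trigpoly P -> exists B, forall x, sqn (P x) <= B.
Proof.
elim=> [nu|z P' _ [B h]|P1 P2 _ [B1 h1] _ [B2 h2]].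
- by exists 1 => x; rewrite sqn_character.
- by exists (sqn z * B) => x; rewrite sqnM ler_wpM2l // sqn_ge0.
- exists (2 * B1 + 2 * B2) => x; apply: le_trans (sqnD _ _) _.
  by apply: lerD; rewrite ler_wpM2l.
Qed.

Lemma trigpoly_cmeasurable P : trigpoly P -> cmeasurable P.
Proof. by move=> tP; exact/ccontinuous_measurable/trigpoly_ccontinuous. Qed.

Lemma cintegrableM_trigpoly f P : cintegrable f -> trigpoly P ->
  cintegrable (fun x => f x * P x).
Proof.
move=> fi tP; have [B PB] := trigpoly_bounded tP.
by apply: (cintegrableM_bounded (B := B) fi (trigpoly_cmeasurable tP)) => x _; exact: PB.
Qed.

Lemma cintegrable_trigpoly P : trigpoly P -> cintegrable P.
Proof.
move=> tP; have [B PB] := trigpoly_bounded tP.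
by apply: (cintegrable_bounded (B := B) (trigpoly_cmeasurable tP)) => x _; exact: PB.
Qed.

Lemma fourier_coefD f g nu : cintegrable f -> cintegrable g ->
  fourier_coef (fun x => f x + g x) nu = fourier_coef f nu + fourier_coef g nu.
Proof.
move=> fi gi; rewrite /fourier_coef -torus_integralD; try exact: cintegrableM_character.
by apply: eq_torus_integral => x _; rewrite mulrDl.
Qed.

Lemma fourier_coefB f g nu : cintegrable f -> cintegrable g ->
  fourier_coef (fun x => f x - g x) nu = fourier_coef f nu - fourier_coef g nu.
Proof.
move=> fi gi; rewrite /fourier_coef -torus_integralB; try exact: cintegrableM_character.
by apply: eq_torus_integral => x _; rewrite mulrBl.
Qed.

Lemma fourier_coefZ z f nu : cintegrable f ->
  fourier_coef (fun x => z * f x) nu = z * fourier_coef f nu.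
Proof.
move=> fi; rewrite /fourier_coef -torus_integralZ; last exact: cintegrableM_character.
by apply: eq_torus_integral => x _; rewrite mulrA.
Qed.

Lemma fourier_coef_character kappa nu :
  fourier_coef (character kappa : 'rV[R]_n -> R[i]) nu = (kappa + nu == 0)%:R.
Proof.
rewrite -torus_integral_character; apply: eq_torus_integral => x _.
by rewrite characterMl.
Qed.

Lemma fourier_coef_mul_character f kappa nu :
  fourier_coef (fun x => f x * character kappa x) nu = fourier_coef f (kappa + nu).
Proof. by apply: eq_torus_integral => x _; rewrite -mulrA characterMl. Qed.

Lemma fourier_coef0 f : fourier_coef f 0 = torus_integral f.
Proof. by apply: eq_torus_integral => x _; rewrite character0l mulr1. Qed.

Lemma torus_integral_conj f : cintegrable f ->
  torus_integral (fun x => (f x)^*%C) = (torus_integral f)^*%C.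
Proof.
move=> [iR iI]; apply: complex_ext; rewrite ?Re_conj ?Im_conj /=.
  by apply: eq_Rintegral => x _; rewrite Re_conj.
rewrite -[RHS]mulN1r -RintegralZl //; last exact: measurable_cube.
by apply: eq_Rintegral => x _; rewrite Im_conj mulN1r.
Qed.

Lemma conjM (z w : R[i]) : (z * w)^*%C = z^*%C * w^*%C.
Proof. exact: (rmorphM (@conjc R)). Qed.

Lemma conjD (z w : R[i]) : (z + w)^*%C = z^*%C + w^*%C.
Proof. exact: (rmorphD (@conjc R)). Qed.

Definition fourier_sum (L : seq 'rV[int]_n) f x : R[i] :=
  \sum_(nu <- L) fourier_coef f nu * character (- nu) x.

Lemma trigpoly_fourier_sum L f : trigpoly (fourier_sum L f).
Proof. by apply: trigpoly_sum => nu; exact/trigpolyZ/trigpoly_character. Qed.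

Lemma fourier_coef_fourier_sum L f nu : uniq L ->
  fourier_coef (fourier_sum L f) nu = if nu \in L then fourier_coef f nu else 0.
Proof.
move=> uL; rewrite /fourier_coef /fourier_sum.
under eq_torus_integral => x _ do rewrite mulr_suml.
rewrite torus_integral_sum; last first.
  by move=> kappa; apply/cintegrableM_character/cintegrableZ/cintegrable_character.
rewrite (eq_bigr (fun kappa => fourier_coef f kappa * (kappa == nu)%:R)); last first.
  move=> kappa _.
  rewrite -[LHS]/(fourier_coef _ nu) fourier_coefZ; last exact: cintegrable_character.
  by rewrite fourier_coef_character addrC subr_eq0 eq_sym.
case: ifPn => [nuL|nuL].
  rewrite (bigD1_seq nu) //= eqxx mulr1 big1 ?addr0 // => kappa /negbTE ->.
  by rewrite mulr0.
by rewrite big_seq big1 // => kappa; case: eqVneq => [->|]; rewrite ?(negbTE nuL) ?mulr0.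
Qed.

(** The spectrum may be enlarged at will, so that several polynomials can be
    expanded over one list of frequencies. *)
Lemma trigpoly_spectrum P : trigpoly P ->
  exists L0 : seq 'rV[int]_n, forall L, uniq L -> {subset L0 <= L} ->
    P = fourier_sum L P.
Proof.
elim=> [nu|z P' tP [L0 h]|P1 P2 tP1 [L1 h1] tP2 [L2 h2]].
- exists [:: - nu] => L uL sL; apply/funext => x; rewrite /fourier_sum.
  rewrite (bigD1_seq (- nu)) //=; last by apply: sL; rewrite mem_head.
  rewrite fourier_coef_character subrr eqxx mul1r opprK big1 ?addr0 // => kappa kn.
  by rewrite fourier_coef_character addrC addr_eq0 (negbTE kn) mul0r.
- exists L0 => L uL sL; apply/funext => x; rewrite [in LHS](h L uL sL) /fourier_sum mulr_sumr.
  apply: eq_bigr => nu _; rewrite mulrA fourier_coefZ //.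
  exact: cintegrable_trigpoly.
- exists (L1 ++ L2) => L uL sL; apply/funext => x.
  have -> : P1 x + P2 x = fourier_sum L P1 x + fourier_sum L P2 x.
    congr (_ + _).
      by rewrite -(h1 L uL) // => nu nuL; apply: sL; rewrite mem_cat nuL.
    by rewrite -(h2 L uL) // => nu nuL; apply: sL; rewrite mem_cat nuL orbT.
  rewrite -big_split; apply: eq_bigr => nu _.
  by rewrite fourier_coefD ?mulrDl //; exact: cintegrable_trigpoly.
Qed.

Lemma torus_integral_mul_fourier_sum f g L : cintegrable f ->
  torus_integral (fun x => f x * (fourier_sum L g x)^*%C) =
  \sum_(nu <- L) fourier_coef f nu * (fourier_coef g nu)^*%C.
Proof.
move=> fi; transitivity (\sum_(nu <- L) torus_integral (fun x =>
    (fourier_coef g nu)^*%C * (f x * character nu x))); last first.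
  apply: eq_bigr => nu _; rewrite torus_integralZ; first exact: mulrC.
  exact: cintegrableM_character.
rewrite -torus_integral_sum; last first.
  by move=> nu; apply: cintegrableZ; exact: cintegrableM_character.
apply: eq_torus_integral => x _; rewrite /fourier_sum rmorph_sum mulr_sumr.
apply: eq_bigr => nu _.
have E : (fourier_coef g nu * character (- nu) x)^*%C =
    (fourier_coef g nu)^*%C * character nu x.
  by rewrite conjM character_conj opprK.
by rewrite [X in f x * X]E mulrCA.
Qed.

End trigonometric_polynomials.

(** * Functions with nonnegative Fourier coefficients *)

Section positive_coefficients.
Context {R : realType} {n : nat}.
Implicit Types (f g h P Q : 'rV[R]_n -> R[i]) (x y : 'rV[R]_n) (nu kappa : 'rV[int]_n).
Notation mu := (@lebesgue_rV R n).
Notation cube := (@unit_cube R n).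

Definition pos_coef g := cintegrable g /\ forall nu, 0 <= fourier_coef g nu.

(** A product of trigonometric polynomials with nonnegative coefficients has
    nonnegative coefficients. Taken as a definition, this closure property makes
    convolutions of coefficient families unnecessary. *)
Definition pos_multiplier P :=
  forall g, pos_coef g -> pos_coef (fun x => g x * P x).

Lemma eq_pos_multiplier P Q : (forall x, P x = Q x) ->
  pos_multiplier P -> pos_multiplier Q.
Proof. by move=> /funext ->. Qed.

Lemma pos_multiplier_character nu : pos_multiplier (character nu).
Proof.
move=> g [gi gp]; split; first exact: cintegrableM_character.
by move=> kappa; rewrite fourier_coef_mul_character.
Qed.

Lemma pos_multiplierZ (z : R[i]) P : 0 <= z -> pos_multiplier P ->
  pos_multiplier (fun x => z * P x).
Proof.
move=> z0 pP g gp; have [gPi gPp] := pP g gp.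
have -> : (fun x => g x * (z * P x)) = fun x => z * (g x * P x).
  by apply/funext => x; rewrite mulrCA.
split; first exact: cintegrableZ.
by move=> nu; rewrite fourier_coefZ // mulr_ge0.
Qed.

Lemma pos_coefD f g : pos_coef f -> pos_coef g -> pos_coef (fun x => f x + g x).
Proof.
move=> [fi fp] [gi gp]; split; first exact: cintegrableD.
by move=> nu; rewrite fourier_coefD // addr_ge0.
Qed.

Lemma pos_multiplierD P Q : pos_multiplier P -> pos_multiplier Q ->
  pos_multiplier (fun x => P x + Q x).
Proof.
move=> pP pQ g gp; have := pos_coefD (pP g gp) (pQ g gp).
by congr pos_coef; apply/funext => x; rewrite mulrDr.
Qed.

Lemma pos_coef0 : pos_coef (fun=> 0).
Proof.
split=> [|nu]; first exact: cintegrable0.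
rewrite (_ : fourier_coef _ _ = torus_integral (cst 0 : 'rV[R]_n -> R[i])).
  by rewrite torus_integral0.
by apply: eq_torus_integral => x _; rewrite mul0r.
Qed.

Lemma pos_multiplier_sum (I : Type) (s : seq I) (F : I -> 'rV[R]_n -> R[i]) :
  (forall i, pos_multiplier (F i)) -> pos_multiplier (fun x => \sum_(i <- s) F i x).
Proof.
move=> pF; elim: s => [|i s IHs].
  move=> g _; have := pos_coef0; congr pos_coef.
  by apply/funext => x; rewrite big_nil mulr0.
by apply: eq_pos_multiplier (pos_multiplierD (pF i) IHs) => x; rewrite big_cons.
Qed.

Lemma pos_coef_integral g : pos_coef g -> 0 <= torus_integral g.
Proof. by move=> [_ gp]; rewrite -fourier_coef0. Qed.

Lemma mul_conj_ge0 (z : R[i]) : 0 <= z * z^*%C.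
Proof.
rewrite complex_ge0 Re_mul_conj sqn_ge0 andbT; case: z => a b.
by rewrite ImM /=; apply/eqP; ring.
Qed.

Lemma mul_conjE (z : R[i]) : z * z^*%C = (sqn z)%:C%C.
Proof.
apply: complex_ext; first by rewrite Re_mul_conj.
by case: z => a b; rewrite ImM /=; ring.
Qed.

Definition autocorrelation (q : 'rV[R]_n -> R[i]) x : R[i] :=
  torus_integral (fun y => q (x + y) * (q y)^*%C).

Lemma autocorrelationE q : trigpoly q ->
  exists L0 : seq 'rV[int]_n, forall L, uniq L -> {subset L0 <= L} ->
    forall x, autocorrelation q x = \sum_(nu <- L)
      (fourier_coef q nu * (fourier_coef q nu)^*%C) * character (- nu) x.
Proof.
move=> tq; have [L0 h] := trigpoly_spectrum tq; exists L0 => L uL sL x.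
have qE y : q y = fourier_sum L q y by rewrite -(h L uL sL).
have iq nu : cintegrable (fun y => character (- nu) y * (q y)^*%C).
  have [B qB] := trigpoly_bounded tq.
  apply: (cintegrableM_bounded (B := B)).
  - exact: cintegrable_character.
  - exact/cmeasurable_conj/trigpoly_cmeasurable.
  - by move=> y _; move: (qB y); rewrite !sqnE Re_conj Im_conj sqrrN.
rewrite /autocorrelation.
transitivity (torus_integral (fun y => \sum_(nu <- L)
    (fourier_coef q nu * character (- nu) x) * (character (- nu) y * (q y)^*%C))).
  apply: eq_torus_integral => y _; rewrite [X in X * _]qE /fourier_sum mulr_suml.
  by apply: eq_bigr => nu _; rewrite characterD !mulrA.
rewrite torus_integral_sum; last by move=> nu; exact: cintegrableZ.
apply: eq_bigr => nu _; rewrite torus_integralZ // [RHS]mulrAC; congr (_ * _).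
rewrite -torus_integral_conj; last exact/cintegrableM_character/cintegrable_trigpoly.
by apply: eq_torus_integral => y _; rewrite conjM character_conj mulrC.
Qed.

Lemma trigpoly_autocorrelation q : trigpoly q -> trigpoly (autocorrelation q).
Proof.
move=> tq; have [L0 h] := autocorrelationE tq.
apply: eq_trigpoly (fun x => esym (h (undup L0) (undup_uniq _) _ x)) _.
  by move=> _ nu; rewrite mem_undup.
by apply: trigpoly_sum => nu; exact/trigpolyZ/trigpoly_character.
Qed.

(** The Fourier coefficients of the autocorrelation of [q] are the squares of
    the moduli of those of [q]; the constant term can be split off. *)
Lemma pos_multiplier_autocorrelation q : trigpoly q ->
  pos_multiplier (fun x => autocorrelation q x - (sqn (torus_integral q))%:C%C).
Proof.
move=> tq; have [L0 h] := autocorrelationE tq.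
pose L := undup (0 :: L0).
have hL x := h L (undup_uniq _) _ x.
have pm : pos_multiplier (fun x => \sum_(nu <- rem 0 L)
    (fourier_coef q nu * (fourier_coef q nu)^*%C) * character (- nu) x).
  apply: pos_multiplier_sum => nu; apply: pos_multiplierZ; first exact: mul_conj_ge0.
  exact: pos_multiplier_character.
apply: eq_pos_multiplier pm => x; rewrite hL; last first.
  by move=> nu; rewrite mem_undup inE => ->; rewrite orbT.
have L0L : 0 \in L by rewrite mem_undup mem_head.
rewrite [in RHS](perm_big _ (perm_to_rem L0L)) big_cons.
rewrite fourier_coef0 oppr0 character0l mulr1.
by rewrite mul_conjE addrAC subrr add0r.
Qed.

End positive_coefficients.

(** * A kernel of small support *)

Section kernel.
Context {R : realType} {n : nat}.
Implicit Types (x y : 'rV[R]_n) (p q : 'rV[R]_n -> R).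
Notation mu := (@lebesgue_rV R n).
Notation cube := (@unit_cube R n).

Definition rtrigpoly p := trigpoly (fun x => (p x)%:C%C).

Lemma eq_rtrigpoly p q : (forall x, p x = q x) -> rtrigpoly p -> rtrigpoly q.
Proof. by move=> /funext ->. Qed.

Lemma rtrigpoly_cst (a : R) : rtrigpoly (cst a).
Proof. exact: (trigpoly_cst a%:C%C). Qed.

Lemma rtrigpolyB p q : rtrigpoly p -> rtrigpoly q -> rtrigpoly (fun x => p x - q x).
Proof.
by move=> tp tq; apply: eq_trigpoly (trigpolyB tp tq) => x; rewrite rmorphB.
Qed.

Lemma rtrigpolyM p q : rtrigpoly p -> rtrigpoly q -> rtrigpoly (fun x => p x * q x).
Proof.
by move=> tp tq; apply: eq_trigpoly (trigpolyM tp tq) => x; rewrite rmorphM.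
Qed.

Lemma rtrigpolyX p m : rtrigpoly p -> rtrigpoly (fun x => p x ^+ m).
Proof.
by move=> tp; apply: eq_trigpoly (trigpolyX m tp) => x; rewrite rmorphXn.
Qed.

Lemma rtrigpoly_prod (I : Type) (s : seq I) (F : I -> 'rV[R]_n -> R) :
  (forall i, rtrigpoly (F i)) -> rtrigpoly (fun x => \prod_(i <- s) F i x).
Proof.
by move=> tF; apply: eq_trigpoly (trigpoly_prod s tF) => x; rewrite rmorph_prod.
Qed.

Lemma pairing_delta i x : pairing (delta_mx ord0 i) x = x ord0 i.
Proof.
rewrite /pairing (bigD1 i) //= mxE !eqxx mul1r big1 ?addr0 // => j ji.
by rewrite mxE (negbTE ji) andbF mul0r.
Qed.

Lemma rtrigpoly_cos i : rtrigpoly (fun x => cos (2 * pi * x ord0 i)).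
Proof.
apply: eq_trigpoly (trigpolyZ (2^-1)%:C%C (trigpolyD
  (trigpoly_character (delta_mx ord0 i)) (trigpoly_character (- delta_mx ord0 i)))) => x.
rewrite !characterE pairingNl pairing_delta mulrN cosN sinN.
by apply: complex_ext; rewrite ?ReM ?ImM /=; field.
Qed.

Lemma rtrigpoly_sin i : rtrigpoly (fun x => sin (2 * pi * x ord0 i)).
Proof.
apply: eq_trigpoly (trigpolyZ (Complex 0 (- 2^-1)) (trigpolyB
  (trigpoly_character (- delta_mx ord0 i)) (trigpoly_character (delta_mx ord0 i)))) => x.
rewrite !characterE pairingNl pairing_delta mulrN cosN sinN.
by apply: complex_ext; rewrite ?ReM ?ImM /=; field.
Qed.

Lemma rtrigpoly_sin2 i (c : R) : rtrigpoly (fun x => sin (pi * (x ord0 i - c)) ^+ 2).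
Proof.
have t := rtrigpolyB (rtrigpolyB (rtrigpoly_cst 2^-1)
  (rtrigpolyM (rtrigpoly_cst (2^-1 * cos (2 * pi * c))) (rtrigpoly_cos i)))
  (rtrigpolyM (rtrigpoly_cst (2^-1 * sin (2 * pi * c))) (rtrigpoly_sin i)).
apply: eq_rtrigpoly t => x /=.
have E : 2 * pi * x ord0 i - 2 * pi * c = (pi * (x ord0 i - c)) *+ 2.
  by rewrite -mulrBr mulr2n -mulrA; ring.
have := cosB (2 * pi * x ord0 i) (2 * pi * c).
rewrite E cos_mulr2n cos2sin2 mulr2n => h.
have -> : 2^-1 - 2^-1 * cos (2 * pi * c) * cos (2 * pi * x ord0 i) -
    2^-1 * sin (2 * pi * c) * sin (2 * pi * x ord0 i) =
    2^-1 * (1 - (cos (2 * pi * x ord0 i) * cos (2 * pi * c) +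
      sin (2 * pi * x ord0 i) * sin (2 * pi * c))) by ring.
by rewrite -h; field.
Qed.

Lemma rtrigpoly_sharpen K j p : rtrigpoly p -> rtrigpoly (fun x => sharpen K j (p x)).
Proof.
by move=> tp; apply/rtrigpolyX/rtrigpolyB; [exact: rtrigpoly_cst | exact: rtrigpolyX].
Qed.

Lemma sin2_itv (t : R) : 0 <= sin t ^+ 2 <= 1.
Proof. by rewrite sqr_ge0 /= sin2cos2 gerBl sqr_ge0. Qed.

Definition box_approx K j x : R := \prod_(i < n) sharpen K j (sin (pi * x ord0 i) ^+ 2).

Definition box_indic K x : R := \prod_(i < n) (K%:R * sin (pi * x ord0 i) ^+ 2 < 1 :> R)%:R.

Lemma rtrigpoly_box_approx K j : rtrigpoly (box_approx K j).
Proof.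
apply: rtrigpoly_prod => i; apply: rtrigpoly_sharpen.
by apply: eq_rtrigpoly (rtrigpoly_sin2 i 0) => x; rewrite subr0.
Qed.

Lemma prod_itv01 (I : Type) (s : seq I) (F : I -> R) :
  (forall i, 0 <= F i <= 1) -> 0 <= \prod_(i <- s) F i <= 1.
Proof.
move=> hF; elim: s => [|i s /andP[IH0 IH1]]; first by rewrite big_nil ler01 lexx.
rewrite big_cons; have /andP[F0 F1] := hF i.
by rewrite mulr_ge0 //= mulr_ile1.
Qed.

Lemma box_approx_itv K j x : 0 <= box_approx K j x <= 1.
Proof. by apply: prod_itv01 => i; exact/sharpen_itv/sin2_itv. Qed.

Lemma box_indic_itv K x : 0 <= box_indic K x <= 1.
Proof. by apply: prod_itv01 => i; rewrite ler0n; case: (_ < _); rewrite ?ler01 ?lexx. Qed.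

Lemma box_approx_cvg K x : box_approx K j x @[j --> \oo] --> box_indic K x.
Proof.
rewrite /box_approx /box_indic; elim: (index_enum _) => [|i s IHs].
  by rewrite big_nil; under eq_fun do rewrite big_nil; exact: cvg_cst.
rewrite big_cons; under eq_fun do rewrite big_cons.
by apply: cvgM; [exact/sharpen_cvg/sin2_itv | exact: IHs].
Qed.

Lemma box_indic_neq0 K x i : box_indic K x != 0 -> K%:R * sin (pi * x ord0 i) ^+ 2 < 1.
Proof.
by move/prodf_neq0 => /(_ i isT); case: (_ < _); rewrite ?eqxx.
Qed.

(** The autocorrelation of the indicator function of the points with all
    coordinates close to integers. It acts on nonnegative coefficients as the
    autocorrelation of a trigonometric polynomial does, but its support modulo
    the periods is small, which no trigonometric polynomial achieves. *)
Definition kernel K x : R := (\int[mu]_(y in cube) (box_indic K (x + y) * box_indic K y))%R.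

End kernel.

Section kernel_limit.
Context {R : realType} {n : nat}.
Implicit Types (x y : 'rV[R]_n) (p q : 'rV[R]_n -> R).
Notation mu := (@lebesgue_rV R n).
Notation cube := (@unit_cube R n).

Lemma trigpoly_translate (P : 'rV[R]_n -> R[i]) x : trigpoly P -> trigpoly (fun y => P (x + y)).
Proof.
elim=> [nu|z P' _ IH|P1 P2 _ IH1 _ IH2].
- apply: eq_trigpoly (trigpolyZ (character nu x) (trigpoly_character nu)) => y.
  by rewrite characterD.
- exact: trigpolyZ.
- exact: trigpolyD.
Qed.

Lemma rtrigpoly_measurable p : rtrigpoly p -> measurable_fun cube p.
Proof. by case/trigpoly_cmeasurable. Qed.

Lemma Rintegral_cube0 p : (forall x, p x = 0) -> (\int[mu]_(x in cube) p x)%R = 0.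
Proof.
move=> /funext ->.
by rewrite Rintegral_cst ?mul0r //; exact: measurable_cube.
Qed.

Definition box_poly K j x : R[i] := (box_approx K j x)%:C%C.

Lemma trigpoly_box_poly K j : trigpoly (box_poly K j).
Proof. exact: rtrigpoly_box_approx. Qed.

Lemma autocorrelation_box_measurable K j : cmeasurable (autocorrelation (box_poly K j)).
Proof. exact/trigpoly_cmeasurable/trigpoly_autocorrelation/trigpoly_box_poly. Qed.

Lemma Re_autocorrelation_box K j x :
  Re (autocorrelation (box_poly K j) x) =
  (\int[mu]_(y in cube) (box_approx K j (x + y) * box_approx K j y))%R.
Proof.
by apply: eq_Rintegral => y _; rewrite ReM /=; ring.
Qed.

Lemma Im_autocorrelation_box K j x : Im (autocorrelation (box_poly K j) x) = 0.
Proof.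
by apply: Rintegral_cube0 => y; rewrite ImM /=; ring.
Qed.

Lemma torus_integral_box K j :
  torus_integral (box_poly K j) = (\int[mu]_(y in cube) box_approx K j y)%R%:C%C.
Proof.
by apply: complex_ext => //=; exact: Rintegral_cube0.
Qed.

Lemma integrable_one : mu.-integrable cube (EFin \o cst (1 : R)).
Proof. by apply: (integrable_bounded_cube (B := 1)) => [|x _ /=]; rewrite ?normr1. Qed.

Lemma mul_itv01 (a b : R) : 0 <= a <= 1 -> 0 <= b <= 1 -> 0 <= a * b <= 1.
Proof. by move=> /andP[a0 a1] /andP[b0 b1]; rewrite mulr_ge0 //= mulr_ile1. Qed.

Lemma norm_itv01 (a : R) : 0 <= a <= 1 -> `|a| <= 1.
Proof. by case/andP=> a0 a1; rewrite ger0_norm. Qed.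

Lemma box_indic_measurable K : measurable_fun cube (box_indic K).
Proof.
apply: (measurable_fun_cvg (h := fun j => box_approx K j)).
  by move=> j; exact: rtrigpoly_measurable (rtrigpoly_box_approx K j).
by move=> x _; exact: box_approx_cvg.
Qed.

Lemma autocorrelation_box_cvg K x :
  Re (autocorrelation (box_poly K j) x) @[j --> \oo] --> kernel K x.
Proof.
under eq_fun do rewrite Re_autocorrelation_box.
have [j|y _||j y _|] // := @Rintegral_dominated _ _ _ mu cube
  (fun j y => box_approx K j (x + y) * box_approx K j y)
  (fun y => box_indic K (x + y) * box_indic K y) (cst 1) measurable_cube.
- apply: measurable_funM; last exact: rtrigpoly_measurable (rtrigpoly_box_approx K j).
  apply: rtrigpoly_measurable.
  exact: (trigpoly_translate x (rtrigpoly_box_approx K j)).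
- by apply: cvgM; exact: box_approx_cvg.
- exact: integrable_one.
- by apply: norm_itv01; apply: mul_itv01; exact: box_approx_itv.
Qed.

Lemma integral_box_cvg K :
  (\int[mu]_(y in cube) box_approx K j y)%R @[j --> \oo] -->
  (\int[mu]_(y in cube) box_indic K y)%R.
Proof.
have [j|y _||j y _|] // := @Rintegral_dominated _ _ _ mu cube
  (fun j => box_approx K j) (box_indic K) (cst 1) measurable_cube.
- exact: rtrigpoly_measurable (rtrigpoly_box_approx K j).
- exact: box_approx_cvg.
- exact: integrable_one.
- exact/norm_itv01/box_approx_itv.
Qed.

Lemma Rintegral_itv01 p : (forall y, 0 <= p y <= 1) -> measurable_fun cube p ->
  0 <= (\int[mu]_(y in cube) p y)%R <= 1.
Proof.
move=> p01 mp; rewrite Rintegral_ge0 /=; last by move=> y _; case/andP: (p01 y).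
have := @le_Rintegral _ _ _ mu cube p (cst 1) measurable_cube.
rewrite Rintegral_cst ?[X in fine X]mu_cube ?mulr1; last exact: measurable_cube.
apply.
- by apply: (integrable_bounded_cube (B := 1)) => // y _; exact: norm_itv01.
- exact: integrable_one.
- by move=> y _; case/andP: (p01 y).
Qed.

Lemma box_indic_shift_measurable K x :
  measurable_fun cube (fun y => box_indic K (x + y)).
Proof.
apply: (measurable_fun_cvg (h := fun j y => box_approx K j (x + y))).
  move=> j; apply: rtrigpoly_measurable.
  exact: (trigpoly_translate x (rtrigpoly_box_approx K j)).
by move=> y _; exact: box_approx_cvg.
Qed.

Lemma kernel_itv K x : 0 <= kernel K x <= 1.
Proof.
apply: Rintegral_itv01; first by move=> y; apply: mul_itv01; exact: box_indic_itv.
by apply: measurable_funM; [exact: box_indic_shift_measurable | exact: box_indic_measurable].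
Qed.

Lemma autocorrelation_box_bounded K j : cbounded 1 (autocorrelation (box_poly K j)).
Proof.
move=> x _; rewrite sqnE Im_autocorrelation_box expr0n addr0 Re_autocorrelation_box.
have /andP[h0 h1] : 0 <= (\int[mu]_(y in cube) (box_approx K j (x + y) * box_approx K j y))%R <= 1.
  apply: Rintegral_itv01; first by move=> y; apply: mul_itv01; exact: box_approx_itv.
  apply: measurable_funM; last exact: rtrigpoly_measurable (rtrigpoly_box_approx K j).
  apply: rtrigpoly_measurable.
  exact: (trigpoly_translate x (rtrigpoly_box_approx K j)).
by rewrite exprn_ile1.
Qed.

Lemma kernel_measurable K : measurable_fun cube (kernel K).
Proof.
apply: (measurable_fun_cvg (h := fun j x => Re (autocorrelation (box_poly K j) x))).
  by move=> j; case: (autocorrelation_box_measurable K j).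
by move=> x _; exact: autocorrelation_box_cvg.
Qed.

(** The autocorrelations of the polynomials [box_poly K j] have nonnegative
    coefficients, with constant term the squared mean of [box_poly K j]. The
    inequality that expresses this passes to the limit. *)
Lemma kernel_ge_mean K (g : 'rV[R]_n -> R[i]) : pos_coef g ->
  (\int[mu]_(y in cube) box_indic K y)%R ^+ 2 * Re (torus_integral g) <=
  Re (torus_integral (fun x => g x * (kernel K x)%:C%C)).
Proof.
move=> gp; have [gi _] := gp.
have [||cR _] := torus_integral_dominated gi
  (autocorrelation_box_measurable K)
  (autocorrelation_box_bounded K) (h := fun x => (kernel K x)%:C%C).
- by move=> x _; exact: autocorrelation_box_cvg.
- move=> x _; under eq_fun do rewrite Im_autocorrelation_box.
  exact: cvg_cst.
have cL : ((\int[mu]_(y in cube) box_approx K j y)%R ^+ 2 * Re (torus_integral g))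
    @[j --> \oo] --> (\int[mu]_(y in cube) box_indic K y)%R ^+ 2 * Re (torus_integral g).
  apply: cvgM; last exact: cvg_cst.
  by rewrite expr2; under eq_fun do rewrite expr2; apply: cvgM; exact: integral_box_cvg.
apply: (ler_cvg_to cL cR).
apply: nearW => j.
have tq := trigpoly_box_poly K j.
have := pos_coef_integral (pos_multiplier_autocorrelation tq gp).
set c := (sqn _)%:C%C.
rewrite (_ : torus_integral _ = torus_integral (fun x => g x * autocorrelation (box_poly K j) x)
    - c * torus_integral g); last first.
  rewrite -torus_integralZ // -torus_integralB.
  - by apply: eq_torus_integral => x _; rewrite mulrBr [c * _]mulrC.
  - exact: cintegrableM_trigpoly gi (trigpoly_autocorrelation tq).
  - exact: cintegrableZ.
have -> : c = ((\int[mu]_(y in cube) box_approx K j y)%R ^+ 2)%:C%C.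
  by rewrite /c torus_integral_box sqnE /= expr0n addr0.
by rewrite complex_ge0 ReB ReM => /andP[_]; rewrite /= mul0r subr0 subr_ge0.
Qed.

Lemma box_indic_near0 K : (0 < K)%N -> exists2 r : R, 0 < r &
  forall x, (forall i, 0 <= x ord0 i < r) -> box_indic K x = 1.
Proof.
move=> K0.
pose F (t : R) := sin (pi * t) * sin (pi * t).
have cF : continuous F.
  have h : continuous (fun t : R => sin (pi * t)).
    move=> t; apply: continuous_comp; last exact: continuous_sin.
    by apply: continuous_mulf; [exact: continuous_cstf | move=> s; exact: cvg_id].
  exact: continuous_mulf.
have F0 : F 0 = 0 by rewrite /F mulr0 sin0 mul0r.
have Ki : 0 < (K%:R : R)^-1 by rewrite invr_gt0 ltr0n.
have /cvgrPdist_lt /(_ _ Ki) := cF 0.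
rewrite -nbhs_ballE => -[r /= r0 hr]; exists r => // x xr.
rewrite /box_indic big1 // => i _; have /andP[x0 xr'] := xr i.
have /hr : ball (0 : R) r (x ord0 i) by rewrite /ball /= sub0r normrN ger0_norm.
rewrite F0 sub0r normrN ger0_norm -?expr2 ?sqr_ge0 // => h.
by rewrite mulrC -ltr_pdivlMr ?ltr0n // mul1r h.
Qed.

Lemma integral_box_indic_gt0 K : (0 < K)%N ->
  0 < (\int[mu]_(y in cube) box_indic K y)%R.
Proof.
move=> K0; have [r r0 hr] := box_indic_near0 K0.
pose l := Num.min r 2^-1.
have l0 : 0 < l by rewrite lt_min r0 invr_gt0 ltr0n.
pose A := [set x : 'rV[R]_n | forall i, x ord0 i \in `[(0 : 'rV[R]_n) ord0 i, (0 : 'rV[R]_n) ord0 i + l[%R].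
have AE x : A x -> forall i, 0 <= x ord0 i < l.
  by move=> Ax i; have := Ax i; rewrite in_itv /= mxE add0r.
have AC : A `<=` cube.
  move=> x /AE Ax i; rewrite in_itv /=; have /andP[h1 h2] := Ax i.
  have : l <= 2^-1 by rewrite ge_min lexx orbT.
  by move=> ?; apply/andP; split; lra.
have mA : measurable A.
  apply: (measurable_row_box (A := fun i => [set` Interval _ _])) => i.
  exact: measurable_itv.
have muA : mu A = (l ^+ n)%:E by exact: lebesgue_cube_row.
apply: (@lt_le_trans _ _ (\int[mu]_(y in cube) \1_A y)%R).
  rewrite /Rintegral integral_indic //; last exact: measurable_cube.
  by rewrite setIidl // [X in fine X]muA exprn_gt0.
apply: le_Rintegral; first exact: measurable_cube.
- apply: (integrable_bounded_cube (B := 1)); first exact: measurable_indic.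
  by move=> x _; rewrite indicE; case: (_ \in _); rewrite ?normr1 ?normr0.
- apply: (integrable_bounded_cube (B := 1)); first exact: box_indic_measurable.
  by move=> x _; exact/norm_itv01/box_indic_itv.
- move=> x _; rewrite indicE; have [xA|_] := boolP (x \in A).
    rewrite hr // => i; move: xA; rewrite inE => /AE /(_ i) /andP[-> h] /=.
    by apply: lt_le_trans h _; rewrite ge_min lexx.
  by case/andP: (box_indic_itv K x).
Qed.

Lemma sin2_ge (d t : R) : 0 < d -> d <= `|t| -> `|t| <= 2^-1 ->
  sin (pi * d) ^+ 2 <= sin (pi * t) ^+ 2.
Proof.
move=> d0 dt t1.
have -> : sin (pi * t) ^+ 2 = sin (pi * `|t|) ^+ 2.
  have [t0|t0] := ger0P t; first by rewrite ?ger0_norm.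
  by rewrite mulrN sinN sqrrN.
have p0 := pi_gt0 R.
rewrite ler_pXn2r ?nnegrE //; last 2 first.
- by apply: sin_ge0_pi; apply/andP; split; nra.
- by apply: sin_ge0_pi; apply/andP; split; nra.
move: dt; rewrite le_eqVlt => /predU1P[->//|dt].
rewrite ltW // ltr_sin ?in_itv /=; first by rewrite ltr_pM2l.
- by apply/andP; split; nra.
- by apply/andP; split; nra.
Qed.

(** Where the kernel does not vanish, two points with difference [x] lie in the
    support of [box_indic K]; hence [x] is small modulo the periods. The squared
    sine of a difference is at most twice the sum of the squared sines, whence
    the constant [4]. *)
Lemma kernel_support K x (d : R) : 0 < d -> cube x ->
  4 <= K%:R * sin (pi * d) ^+ 2 -> (exists i, d <= `|x ord0 i|) -> kernel K x = 0.
Proof.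
move=> d0 Cx Kd [i di]; rewrite /kernel.
apply: Rintegral_cube0 => y; apply/eqP; apply: contraT.
rewrite mulf_eq0 negb_or => /andP[h1 h2].
have {}h1 := box_indic_neq0 i h1; have {}h2 := box_indic_neq0 i h2.
have xi : `|x ord0 i| <= 2^-1.
  by have := Cx i; rewrite in_itv /= ler_norml => /andP[? ?]; apply/andP; split; lra.
have := sin2_ge d0 di xi.
have E : sin (pi * x ord0 i) = sin (pi * (x + y) ord0 i) * cos (pi * y ord0 i) -
    cos (pi * (x + y) ord0 i) * sin (pi * y ord0 i).
  by rewrite -sinB mxE; congr sin; ring.
have := cos2Dsin2 (pi * y ord0 i); have := cos2Dsin2 (pi * (x + y) ord0 i).
move: h1 h2 Kd; rewrite E.
set a := sin (pi * (x + y) ord0 i); set b := sin (pi * y ord0 i).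
set c := cos (pi * (x + y) ord0 i); set e := cos (pi * y ord0 i).
move: (sin (pi * d) ^+ 2) => s h1 h2 Kd ca eb sab.
exfalso.
have K0 : (0 : R) <= K%:R by [].
have c1 : c ^+ 2 <= 1 by rewrite -ca lerDl sqr_ge0.
have e1 : e ^+ 2 <= 1 by rewrite -eb lerDl sqr_ge0.
have q : (a * e - c * b) ^+ 2 <= 2 * a ^+ 2 + 2 * b ^+ 2.
  have h : (a * e - c * b) ^+ 2 <= 2 * (a ^+ 2 * e ^+ 2) + 2 * (c ^+ 2 * b ^+ 2).
    rewrite -subr_ge0 (_ : _ - _ = (a * e + c * b) ^+ 2); [exact: sqr_ge0|ring].
  apply: (le_trans h); apply: lerD; rewrite ler_pM2l //.
    by rewrite ler_piMr // sqr_ge0.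
  by rewrite ler_piMl // sqr_ge0.
have : K%:R * s <= K%:R * (2 * a ^+ 2 + 2 * b ^+ 2).
  by rewrite ler_wpM2l // (le_trans sab).
lra.
Qed.

End kernel_limit.

(** * A qualitative Wiener inequality *)

Section wiener_bound.
Context {R : realType} {n : nat}.
Implicit Types (x y : 'rV[R]_n) (f g : 'rV[R]_n -> R[i]).
Notation mu := (@lebesgue_rV R n).
Notation cube := (@unit_cube R n).

Lemma Re_mul_conj_le (z w : R[i]) : Re (z * w^*%C) <= 2^-1 * sqn z + 2^-1 * sqn w.
Proof.
case: z => a b; case: w => c d; rewrite !sqnE ReM /= -subr_ge0.
rewrite (_ : _ - _ = 2^-1 * ((a - c) ^+ 2 + (b - d) ^+ 2)); last by field.
by rewrite mulr_ge0 // ?invr_ge0 // addr_ge0 ?sqr_ge0.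
Qed.

Lemma pos_multiplier_conj_fourier_sum f L : pos_coef f ->
  pos_multiplier (fun x => (fourier_sum L f x)^*%C).
Proof.
move=> [_ fp]; have pm : pos_multiplier (fun x => \sum_(nu <- L)
    fourier_coef f nu * character nu x).
  by apply: pos_multiplier_sum => nu; apply/pos_multiplierZ/pos_multiplier_character.
apply: eq_pos_multiplier pm => x; rewrite /fourier_sum.
rewrite [RHS](rmorph_sum (@conjc R)); apply: eq_bigr => nu _.
rewrite [RHS]conjM character_conj opprK; congr (_ * _).
have := fp nu; rewrite complex_ge0 => /andP[/eqP I0 _].
by apply: complex_ext; rewrite ?Re_conj ?Im_conj // I0 oppr0.
Qed.

Lemma pos_coef_sub_fourier_sum f L : uniq L -> pos_coef f ->
  pos_coef (fun x => f x - fourier_sum L f x).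
Proof.
move=> uL [fi fp]; have tS := trigpoly_fourier_sum L f.
split; first exact: cintegrableB fi (cintegrable_trigpoly tS).
move=> nu; rewrite fourier_coefB //; last exact: cintegrable_trigpoly.
rewrite fourier_coef_fourier_sum //; case: ifP => _; first by rewrite subrr.
by rewrite subr0.
Qed.

Lemma pos_coef_fourier_sum f L : uniq L -> pos_coef f -> pos_coef (fourier_sum L f).
Proof.
move=> uL [fi fp]; split; first exact/cintegrable_trigpoly/trigpoly_fourier_sum.
by move=> nu; rewrite fourier_coef_fourier_sum //; case: ifP.
Qed.

Lemma torus_integral_sqn_fourier_sum f L : uniq L ->
  torus_integral (fun x => fourier_sum L f x * (fourier_sum L f x)^*%C) =
  \sum_(nu <- L) (sqn (fourier_coef f nu))%:C%C.
Proof.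
move=> uL; rewrite torus_integral_mul_fourier_sum; last first.
  exact/cintegrable_trigpoly/trigpoly_fourier_sum.
rewrite big_seq [RHS]big_seq; apply: eq_bigr => nu nuL.
by rewrite fourier_coef_fourier_sum // nuL mul_conjE.
Qed.

(** Write [S] for the partial sum and [h] for the kernel. Since [f - S] has
    nonnegative coefficients, the integral of [|S|^2 h] is at most that of
    [f S^* h], hence, by the inequality between arithmetic and geometric means,
    at most that of [|f|^2 h], which only sees [D]; on the other hand it
    dominates a multiple of the integral of [|S|^2]. *)
Lemma wiener_bound K (D : set 'rV[R]_n) f L : measurable D -> D `<=` cube ->
  (forall x, cube x -> ~ D x -> kernel K x = 0) -> pos_coef f ->
  mu.-integrable D (fun x => (sqn (f x))%:E) -> uniq L ->
  (\int[mu]_(y in cube) box_indic K y)%R ^+ 2 *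
    \sum_(nu <- L) sqn (fourier_coef f nu) <=
  (\int[mu]_(x in D) sqn (f x))%R.
Proof.
move=> mD DC hD fp iD uL; have [fi _] := fp.
pose S := fourier_sum L f; have tS : trigpoly S := trigpoly_fourier_sum L f.
pose h x : R := kernel K x.
have mC := @measurable_cube R n.
have pm := pos_multiplier_conj_fourier_sum L fp.
have p1 := pm _ (pos_coef_fourier_sum uL fp); have p2 := pm _ (pos_coef_sub_fourier_sum uL fp).
have h1 := kernel_ge_mean K p1; have h2 := kernel_ge_mean K p2.
have kb : cbounded 1 (fun x => (kernel K x)%:C%C).
  move=> x _; rewrite sqnE /= expr0n addr0; have /andP[k0 k1] := kernel_itv K x.
  by rewrite exprn_ile1.
have km : cmeasurable (fun x => (kernel K x)%:C%C).
  by split; [exact: kernel_measurable | exact: measurable_cst].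
have i1 : cintegrable (fun x => S x * (S x)^*%C * (h x)%:C%C).
  by apply: cintegrableM_bounded km kb; case: p1.
have p3 := pm _ fp.
have i3 : cintegrable (fun x => f x * (S x)^*%C * (h x)%:C%C).
  by apply: cintegrableM_bounded km kb; case: p3.
have le13 : Re (torus_integral (fun x => S x * (S x)^*%C * (h x)%:C%C)) <=
    Re (torus_integral (fun x => f x * (S x)^*%C * (h x)%:C%C)).
  rewrite -subr_ge0 -ReB -torus_integralB //.
  rewrite (_ : torus_integral _ = torus_integral (fun x =>
      (f x - fourier_sum L f x) * (fourier_sum L f x)^*%C * (kernel K x)%:C%C)).
    apply: le_trans h2; rewrite mulr_ge0 ?sqr_ge0 //.
    by have := pos_coef_integral p2; rewrite complex_ge0 => /andP[].
  by apply: eq_torus_integral => x _; rewrite -!mulrBl.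
have h0 x : 0 <= h x by case/andP: (kernel_itv K x).
have hle1 x : h x <= 1 by case/andP: (kernel_itv K x).
have RS x : Re (S x * (S x)^*%C * (h x)%:C%C) = sqn (S x) * h x.
  by rewrite ReM Re_mul_conj /= mulr0 subr0.
have iS : mu.-integrable cube (EFin \o (fun x => sqn (S x) * h x)).
  case: i1 => + _; apply: eq_integrable => // x _; by rewrite /= RS.
have iD' : mu.-integrable cube (EFin \o ((fun x => sqn (f x)) \_ D)).
  have := iD; rewrite -{1}(setIidr DC) integrable_restrict //.
  by apply: eq_integrable => // x _; rewrite restrict_EFin.
have le3 : Re (torus_integral (fun x => f x * (S x)^*%C * (h x)%:C%C)) <=
    2^-1 * (\int[mu]_(x in D) sqn (f x))%R + 2^-1 * (\int[mu]_(x in cube) (sqn (S x) * h x))%R.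
  have iZ (p : 'rV[R]_n -> R) : mu.-integrable cube (EFin \o p) ->
      mu.-integrable cube (EFin \o (fun x => 2^-1 * p x)).
    by move=> ip; exact: (integrableZl mC 2^-1 ip).
  have -> : (\int[mu]_(x in D) sqn (f x))%R =
      (\int[mu]_(x in cube) ((fun x => sqn (f x)) \_ D) x)%R.
    by rewrite -Rintegral_mkcondr setIidr.
  rewrite -!RintegralZl // -RintegralD //; [|exact: iZ|exact: iZ].
  apply: le_Rintegral => //.
  - by case: i3.
  - have := integrableD mC (iZ _ iD') (iZ _ iS).
    by apply: eq_integrable => // x _.
  move=> x Cx; rewrite ReM /= mulr0 subr0.
  apply: le_trans (ler_wpM2r (h0 x) (Re_mul_conj_le (f x) (S x))) _.
  rewrite mulrDl -mulrA -[X in _ + X <= _]mulrA lerD2r ler_pM2l ?invr_gt0 //.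
  rewrite patchE; case: ifPn => xD; first by rewrite ler_piMr // sqn_ge0.
  by rewrite /h hD ?mulr0 //; move: xD; rewrite notin_setE.
have E1 : Re (torus_integral (fun x => S x * (S x)^*%C * (h x)%:C%C)) =
    (\int[mu]_(x in cube) (sqn (S x) * h x))%R.
  by apply: eq_Rintegral => x _; rewrite RS.
have h1' : (\int[mu]_(y in cube) box_indic K y)%R ^+ 2 *
    \sum_(nu <- L) sqn (fourier_coef f nu) <=
    Re (torus_integral (fun x => S x * (S x)^*%C * (h x)%:C%C)).
  by move: h1; rewrite torus_integral_sqn_fourier_sum // Re_sum.
by apply: (le_trans h1'); move: le13 le3; rewrite -E1; lra.
Qed.

End wiener_bound.

(** * Density of trigonometric polynomials *)

Lemma cvg_sqr0 (R : realType) (u : nat -> R) : u k @[k --> \oo] --> (0 : R) ->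
  u k ^+ 2 @[k --> \oo] --> (0 : R).
Proof.
by move=> h; under eq_fun do rewrite expr2; rewrite -(mulr0 0); exact: cvgM.
Qed.

Section density.
Context {R : realType} {n : nat}.
Implicit Types (x y : 'rV[R]_n) (f g P : 'rV[R]_n -> R[i]) (A : set 'rV[R]_n).
Notation mu := (@lebesgue_rV R n).
Notation cube := (@unit_cube R n).
Variable w : 'rV[R]_n -> R.
Hypothesis w_ge0 : forall x, 0 <= w x.
Hypothesis w_int : mu.-integrable cube (EFin \o w).

Let mC := @measurable_cube R n.

Definition wnorm f : R := (\int[mu]_(x in cube) (sqn (f x) * w x))%R.

Lemma integrable_sqn_weight B f : cmeasurable f -> cbounded B f ->
  mu.-integrable cube (EFin \o (fun x => sqn (f x) * w x)).
Proof.
move=> mf fB.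
have := integrable_mul_bounded (B := B) w_int (measurable_sqn mf) _.
rewrite (_ : EFin \o _ = fun x => (w x * sqn (f x))%:E); last first.
  by apply/funext => x; rewrite /= mulrC.
by apply => x Cx; rewrite ger0_norm ?sqn_ge0 // fB.
Qed.

Lemma wnorm_ge0 f : 0 <= wnorm f.
Proof. by apply: Rintegral_ge0 => x _; rewrite mulr_ge0 // sqn_ge0. Qed.

Lemma le_wnorm B f g (c : R) : cmeasurable f -> cbounded B f ->
  cmeasurable g -> cbounded B g -> 0 <= c ->
  (forall x, cube x -> sqn (g x) <= c * sqn (f x)) -> wnorm g <= c * wnorm f.
Proof.
move=> mf fB mg gB c0 fg; rewrite /wnorm -RintegralZl //; last exact: integrable_sqn_weight mf fB.
apply: le_Rintegral => //; first exact: integrable_sqn_weight mg gB.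
  exact: (integrableZl mC c (integrable_sqn_weight mf fB)).
by move=> x Cx; rewrite mulrA ler_wpM2r // fg.
Qed.

Lemma wnormD B f g : cmeasurable f -> cbounded B f ->
  cmeasurable g -> cbounded B g ->
  wnorm (fun x => f x + g x) <= 2 * wnorm f + 2 * wnorm g.
Proof.
move=> mf fB mg gB.
have jf := integrable_sqn_weight mf fB; have jg := integrable_sqn_weight mg gB.
have iZ (h : 'rV[R]_n -> R[i]) : mu.-integrable cube (EFin \o (fun x => sqn (h x) * w x)) ->
    mu.-integrable cube (EFin \o (fun x => 2 * (sqn (h x) * w x))).
  by move=> ih; exact: (integrableZl mC 2 ih).
rewrite /wnorm -!RintegralZl // -RintegralD //; [|exact: iZ|exact: iZ].
apply: le_Rintegral => //.
- apply: (integrable_sqn_weight (B := 2 * B + 2 * B)); first exact: cmeasurableD.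
  move=> x Cx; apply: le_trans (sqnD _ _) _.
  by apply: lerD; rewrite ler_pM2l // ?fB // gB.
- have := integrableD mC (iZ _ jf) (iZ _ jg).
  by apply: eq_integrable => // x _.
move=> x Cx; apply: le_trans (ler_wpM2r (w_ge0 x) (sqnD (f x) (g x))) _.
by move: (sqn (f x)) (sqn (g x)) => a b; rewrite mulrDl !mulrA.
Qed.

Lemma wnorm_cvg0 B (f_ : nat -> 'rV[R]_n -> R[i]) :
  (forall k, cmeasurable (f_ k)) -> (forall k, cbounded B (f_ k)) ->
  (forall x, cube x -> sqn (f_ k x) @[k --> \oo] --> (0 : R)) ->
  wnorm (f_ k) @[k --> \oo] --> (0 : R).
Proof.
move=> mf fB cf.
have mw : measurable_fun cube w by case/integrableP: w_int => /measurable_EFinP.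
have [k|x Cx||k x Cx|_] := @Rintegral_dominated _ _ _ mu cube
  (fun k x => sqn (f_ k x) * w x) (cst 0) (fun x => B * w x) mC.
- by apply: measurable_funM => //; exact: measurable_sqn.
- rewrite -(mul0r (w x)); apply: cvgM; [exact: cf | exact: cvg_cst].
- exact: (integrableZl mC B w_int).
- rewrite ger0_norm; last by apply: mulr_ge0 => //; exact: sqn_ge0.
  by apply: ler_wpM2r => //; exact: fB.
by rewrite Rintegral_cst // mul0r.
Qed.

(** The weight [w] is arbitrary because two measures are needed: Lebesgue
    measure, and one against which the square of the error controls its
    product with a function that is merely integrable. *)
Definition approximable g :=
  [/\ cmeasurable g, exists B, cbounded B g &
    forall e : R, 0 < e -> exists2 P, trigpoly P & wnorm (fun x => g x - P x) <= e].

Lemma cboundedB B1 B2 f g : cbounded B1 f -> cbounded B2 g ->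
  cbounded (2 * B1 + 2 * B2) (fun x => f x - g x).
Proof.
move=> fB gB x Cx; apply: le_trans (sqnD _ _) _.
by apply: lerD; rewrite ler_pM2l // ?sqnN ?fB // gB.
Qed.

Lemma cboundedM B1 B2 f g : cbounded B1 f -> cbounded B2 g ->
  cbounded (B1 * B2) (fun x => f x * g x).
Proof.
by move=> fB gB x Cx; rewrite sqnM ler_pM ?sqn_ge0 // ?fB // gB.
Qed.

Lemma cboundedD B1 B2 f g : cbounded B1 f -> cbounded B2 g ->
  cbounded (2 * B1 + 2 * B2) (fun x => f x + g x).
Proof.
move=> fB gB x Cx; apply: le_trans (sqnD _ _) _.
by apply: lerD; rewrite ler_pM2l // ?fB // gB.
Qed.

Lemma cbounded_le B B' f : B <= B' -> cbounded B f -> cbounded B' f.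
Proof. by move=> BB' fB x Cx; apply: le_trans (fB x Cx) BB'. Qed.

Lemma trigpoly_cbounded P : trigpoly P -> exists B, cbounded B P.
Proof. by move=> /trigpoly_bounded[B h]; exists B => x _; exact: h. Qed.

Lemma wnorm0 : wnorm (fun=> 0) = 0.
Proof. by apply: Rintegral_cube0 => x; rewrite sqn0 mul0r. Qed.

Lemma approximable_trigpoly P : trigpoly P -> approximable P.
Proof.
move=> tP; split; [exact: trigpoly_cmeasurable | exact: trigpoly_cbounded |].
move=> e e0; exists P => //.
rewrite (_ : (fun x => _) = fun=> 0) ?wnorm0 ?ltW //.
by apply/funext => x; rewrite subrr.
Qed.

Lemma wnorm_add f g : cmeasurable f -> (exists B, cbounded B f) ->
  cmeasurable g -> (exists B, cbounded B g) ->
  wnorm (fun x => f x + g x) <= 2 * wnorm f + 2 * wnorm g.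
Proof.
move=> mf [B1 f1] mg [B2 g2]; apply: (wnormD (B := Num.max B1 B2)) => //.
  by apply: cbounded_le f1; rewrite le_max lexx.
by apply: cbounded_le g2; rewrite le_max lexx orbT.
Qed.

Lemma approximableD f g : approximable f -> approximable g ->
  approximable (fun x => f x + g x).
Proof.
move=> [mf [B1 f1] af] [mg [B2 g2] ag]; split.
- exact: cmeasurableD.
- by exists (2 * B1 + 2 * B2); exact: cboundedD.
move=> e e0; have e4 : 0 < e / 4 by rewrite divr_gt0.
have [P tP hP] := af _ e4; have [Q tQ hQ] := ag _ e4.
exists (fun x => P x + Q x); first exact: trigpolyD.
have [BP PB] := trigpoly_cbounded tP; have [BQ QB] := trigpoly_cbounded tQ.
rewrite (_ : (fun x => _) = fun x => (f x - P x) + (g x - Q x)); last first.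
  by apply/funext => x; ring.
apply: le_trans (wnorm_add _ _ _ _) _.
- exact: cmeasurableB mf (trigpoly_cmeasurable tP).
- by eexists; exact: cboundedB f1 PB.
- exact: cmeasurableB mg (trigpoly_cmeasurable tQ).
- by eexists; exact: cboundedB g2 QB.
lra.
Qed.

Lemma approximableM_trigpoly g P : trigpoly P -> approximable g ->
  approximable (fun x => P x * g x).
Proof.
move=> tP [mg [B gB] ag]; have [BP PB] := trigpoly_cbounded tP.
split.
- exact: cmeasurableM (trigpoly_cmeasurable tP) mg.
- by eexists; exact: cboundedM PB gB.
move=> e e0; pose c := 1 + `|BP|.
have c0 : 0 < c by rewrite ltr_pwDl.
have [Q tQ hQ] := ag (e / c) (divr_gt0 e0 c0).
exists (fun x => P x * Q x); first exact: trigpolyM.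
have [BQ QB] := trigpoly_cbounded tQ.
have mgQ := cmeasurableB mg (trigpoly_cmeasurable tQ).
have bgQ := cboundedB gB QB.
rewrite (_ : (fun x => _) = fun x => P x * (g x - Q x)); last first.
  by apply/funext => x; ring.
have bPgQ := cboundedM PB bgQ.
apply: (@le_trans _ _ (c * wnorm (fun x => g x - Q x))); last first.
  by rewrite mulrC -ler_pdivlMr.
pose B0 := Num.max (BP * (2 * B + 2 * BQ)) (2 * B + 2 * BQ).
apply: (le_wnorm (B := B0)) => //.
- by apply: cbounded_le bgQ; rewrite le_max lexx orbT.
- exact: cmeasurableM (trigpoly_cmeasurable tP) mgQ.
- by apply: cbounded_le bPgQ; rewrite le_max lexx.
- exact: ltW.
move=> x Cx; rewrite sqnM ler_wpM2r ?sqn_ge0 //.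
apply: le_trans (PB x Cx) _; apply: le_trans (ler_norm _) _.
by rewrite /c lerDr.
Qed.

Lemma approximable_cvg B (g_ : nat -> 'rV[R]_n -> R[i]) g : cmeasurable g ->
  cbounded B g -> (forall k, approximable (g_ k)) -> (forall k, cbounded B (g_ k)) ->
  (forall x, cube x -> sqn (g x - g_ k x) @[k --> \oo] --> (0 : R)) ->
  approximable g.
Proof.
move=> mg gB ag_ g_B cg; split => //; first by exists B.
move=> e e0; have e4 : 0 < e / 4 by rewrite divr_gt0.
have mg_ k : cmeasurable (g_ k) by case: (ag_ k).
have /cvgrPdist_lt /(_ _ e4) [k _ /(_ k (leqnn k))] := wnorm_cvg0
  (fun k => cmeasurableB mg (mg_ k)) (fun k => cboundedB gB (g_B k)) cg.
rewrite /= sub0r normrN ger0_norm ?wnorm_ge0 // => hk.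
have [_ _ /(_ _ e4)[P tP hP]] := ag_ k; exists P => //.
have [BP PB] := trigpoly_cbounded tP.
rewrite (_ : (fun x => _) = fun x => (g x - g_ k x) + (g_ k x - P x)); last first.
  by apply/funext => x; ring.
apply: le_trans (wnorm_add _ _ _ _) _.
- exact: cmeasurableB.
- by eexists; exact: cboundedB gB (g_B k).
- exact: cmeasurableB (mg_ k) (trigpoly_cmeasurable tP).
- by eexists; exact: cboundedB (g_B k) PB.
lra.
Qed.

Lemma approximable_eq f g : (forall x, cube x -> f x = g x) -> approximable f ->
  approximable g.
Proof.
move=> fg [[mR mI] [B fB] af]; split.
- split.
    by apply: eq_measurable_fun mR => x /set_mem Cx; rewrite fg.
  by apply: eq_measurable_fun mI => x /set_mem Cx; rewrite fg.
- by exists B => x Cx; rewrite -fg // fB.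
move=> e e0; have [P tP hP] := af e e0; exists P => //.
apply: le_trans hP; rewrite /wnorm (_ : Rintegral _ _ _ = Rintegral mu cube (fun x => sqn (f x - P x) * w x)) //.
by apply: eq_Rintegral => x /set_mem Cx; rewrite fg.
Qed.

Definition indicC A x : R[i] := (\1_A x)%:C%C.

(** Closure under products with an indicator function, unlike approximability
    of the indicator function itself, is visibly inherited by intersections;
    so these sets form a sigma-algebra and may be checked on generators. *)
Definition approx_multiplier A := measurable A /\
  forall g, approximable g -> approximable (fun x => indicC A x * g x).

Lemma approx_multiplierC A : approx_multiplier A -> approx_multiplier (~` A).
Proof.
move=> [mA gA]; split; first exact: measurableC.
move=> g ag.
have := approximableD ag (approximableM_trigpoly (trigpoly_cst (-1)) (gA g ag)).
apply: approximable_eq => x _.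
rewrite /indicC !indicE in_setC; case: (x \in A) => /=; rewrite ?rmorph1 ?rmorph0; ring.
Qed.

Lemma cbounded_indicC A : cbounded 1 (indicC A).
Proof.
by move=> x _; rewrite /indicC sqnE /= indicE; case: (_ \in _); rewrite ?expr1n !expr0n addr0.
Qed.

Lemma cmeasurable_indicC A : measurable A -> cmeasurable (indicC A).
Proof.
by move=> mA; split; [exact: measurable_indic | exact: measurable_cst].
Qed.

Lemma approx_multiplier_bigcap (A_ : nat -> set 'rV[R]_n) : (forall k, approx_multiplier (A_ k)) ->
  approx_multiplier (\bigcap_k A_ k).
Proof.
move=> gA; have mA : measurable (\bigcap_k A_ k).
  by apply: bigcap_measurableType => k _; case: (gA k).
split => // g ag; have [mg [B gB] _] := ag.
pose A' k := \bigcap_(i < k) A_ i.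
have aA k : approximable (fun x => indicC (A' k) x * g x).
  elim: k => [|k IHk].
    apply: approximable_eq ag => x _; rewrite /A' bigcap_mkord big_ord0.
    by rewrite /indicC indicT mul1r.
  have [_ /(_ _ IHk)] := gA k; apply: approximable_eq => x _.
  rewrite /A' !bigcap_mkord big_ord_recr /= mulrA; congr (_ * _).
  by rewrite /indicC indicI /= -rmorphM mulrC.
have bA k : cbounded (1 * B) (fun x => indicC (A' k) x * g x).
  exact: cboundedM (cbounded_indicC _) gB.
apply: (approximable_cvg (B := 1 * B) (g_ := fun k x => indicC (A' k) x * g x)) => //.
- by apply: cmeasurableM => //; exact: cmeasurable_indicC.
- exact: cboundedM (cbounded_indicC _) gB.
move=> x Cx; apply: cvg_near_cst.
have [Ax|nAx] := pselect ((\bigcap_k A_ k) x).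
  apply: nearW => k; rewrite /indicC !indicE !mem_set ?subrr ?sqn0 //.
  by move=> i _; exact: Ax.
have [k nAk] : exists k, ~ A_ k x by apply: contrapT => /forallNP h; apply: nAx => k _; apply: contrapT.
exists k.+1 => // m /= km; rewrite /indicC !indicE !memNset ?subrr ?sqn0 //.
by move=> /(_ k km) /nAk.
Qed.

Lemma approx_multiplierT : approx_multiplier setT.
Proof.
split => // g; apply: approximable_eq => x _.
by rewrite /indicC indicT mul1r.
Qed.

Lemma approx_multiplier_sigma_algebra : sigma_algebra setT approx_multiplier.
Proof.
split.
- by rewrite -setCT; exact/approx_multiplierC/approx_multiplierT.
- by move=> A gA; rewrite setTD; exact: approx_multiplierC.
- move=> A gA; rewrite -[\bigcup_k _]setCK setC_bigcup; apply: approx_multiplierC.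
  by apply: approx_multiplier_bigcap => k; exact: approx_multiplierC.
Qed.

Lemma approx_multiplier_arc i (c t : R) : 0 < t -> t <= 1 ->
  approx_multiplier [set x : 'rV[R]_n | sin (pi * (x ord0 i - c)) ^+ 2 < t].
Proof.
move=> t0 t1; set A := [set x | _].
have mA : measurable A.
  have cF : continuous (fun s : R => sin (pi * (s - c)) ^+ 2).
    have c1 : continuous (fun s : R => sin (pi * (s - c))).
      move=> s; apply: (@continuous_comp _ _ _ (fun s : R => pi * (s - c)) sin).
        apply: continuous_mulf; first exact: continuous_cstf.
        by apply: continuous_subf; [move=> s'; exact: cvg_id | exact: continuous_cstf].
      exact: continuous_sin.
    exact: (continuous_mulf c1 c1).
  have mF := measurableT_comp (continuous_measurable_fun cF) (@measurable_coord _ R n i).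
  rewrite (_ : A = setT `&` (fun x : 'rV[R]_n => sin (pi * (x ord0 i - c)) ^+ 2) @^-1` `]-oo, t[).
    by apply: mF => //; exact: measurable_itv.
  by rewrite setTI; apply/seteqP; split => x /=; rewrite in_itv.
split => // g ag; have [mg [B gB] _] := ag.
(* scaling by [s <= 1] turns the threshold [t] into the reciprocal of a natural
   number, as required by the limit of [sharpen] *)
have [K Kt] : exists K : nat, 1 <= K%:R * t.
  exists (Num.truncn (t^-1)).+1; have /andP[_ h] := truncn_itv (ltW (etrans (invr_gt0 t) t0)).
  by rewrite -ler_pdivrMr // mul1r ltW.
have K0 : (0 : R) < K%:R.
  by rewrite ltr0n lt0n; apply: contraTneq Kt => ->; rewrite mul0r ler10.
pose s := (K%:R * t)^-1.
have Kt0 : 0 < K%:R * t by rewrite mulr_gt0.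
have s0 : 0 < s by rewrite invr_gt0.
have s1 : s <= 1 by rewrite invf_le1.
have Ks : K%:R * s = t^-1 by rewrite /s invfM mulrA mulfV ?mul1r // gt_eqF.
pose p j x := sharpen K j (s * sin (pi * (x ord0 i - c)) ^+ 2).
have su x : 0 <= s * sin (pi * (x ord0 i - c)) ^+ 2 <= 1.
  by apply: mul_itv01; [rewrite ltW | exact: sin2_itv].
have tp j : trigpoly (fun x => (p j x)%:C%C).
  apply: rtrigpoly_sharpen; apply: rtrigpolyM; first exact: rtrigpoly_cst.
  exact: rtrigpoly_sin2.
have pb j : cbounded 1 (fun x => (p j x)%:C%C).
  move=> x _; rewrite sqnE /= expr0n addr0; have /andP[p0 p1] := sharpen_itv K j (su x).
  by rewrite exprn_ile1.
have pA x : p j x @[j --> \oo] --> (\1_A x : R).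
  rewrite indicE (_ : x \in A = (K%:R * (s * sin (pi * (x ord0 i - c)) ^+ 2) < 1)).
    exact: sharpen_cvg.
  rewrite (mulrA K%:R s) Ks mulrC ltr_pdivrMr // mul1r.
  by apply/idP/idP; rewrite inE.
apply: (approximable_cvg (B := 1 * B) (g_ := fun j x => (p j x)%:C%C * g x)).
- by apply: cmeasurableM => //; exact: cmeasurable_indicC.
- exact: cboundedM (cbounded_indicC _) gB.
- by move=> j; exact: approximableM_trigpoly.
- by move=> j; exact: cboundedM (pb j) gB.
move=> x Cx.
have E j : sqn (indicC A x * g x - (p j x)%:C%C * g x) = (\1_A x - p j x) ^+ 2 * sqn (g x).
  by rewrite -mulrBl sqnM /indicC -rmorphB sqnE /= expr0n addr0.
under eq_fun do rewrite E.
rewrite -(mul0r (sqn (g x))); apply: cvgM; last exact: cvg_cst.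
have h : (\1_A x - p j x) @[j --> \oo] --> (0 : R).
  by rewrite -(subrr (\1_A x)); apply: cvgB; [exact: cvg_cst | exact: pA].
exact: cvg_sqr0 h.
Qed.

Lemma eq_approx_multiplier A A' : measurable A' -> (forall x, cube x -> A x <-> A' x) ->
  approx_multiplier A -> approx_multiplier A'.
Proof.
move=> mA' AA' [_ gA]; split => // g /gA; apply: approximable_eq => x Cx.
congr (_ * _); rewrite /indicC !indicE.
have [Ax|nAx] := pselect (A x); first by rewrite !mem_set //; exact/(AA' x Cx).
by rewrite !memNset // => /(AA' x Cx).
Qed.

(** Inside the cube, a half space is the arc centred at the middle of its
    trace on the axis. *)
Lemma approx_multiplier_ray i (a : R) : approx_multiplier [set x : 'rV[R]_n | a < x ord0 i].
Proof.
have mA : measurable [set x : 'rV[R]_n | a < x ord0 i].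
  rewrite (_ : [set x | _] = setT `&` (fun x : 'rV[R]_n => x ord0 i) @^-1` `]a, +oo[).
    by apply: measurable_coord => //; exact: measurable_itv.
  by rewrite setTI; apply/seteqP; split => x /=; rewrite in_itv /= andbT.
have Cxi x : cube x -> - 2^-1 <= x ord0 i < 2^-1 by move=> /(_ i); rewrite in_itv.
have [a1|a1] := ltrP a (- 2^-1).
  apply: (eq_approx_multiplier (A := setT)) approx_multiplierT => // x /Cxi /andP[h1 _] /=.
  by split => // _; exact: lt_le_trans h1.
have [a2|a2] := lerP 2^-1 a.
  apply: (eq_approx_multiplier (A := set0)) => //; last by case: approx_multiplier_sigma_algebra.
  move=> x /Cxi /andP[_ h2] /=; split => // ax; exfalso; lra.
pose c := (a + 2^-1) / 2; pose r := (2^-1 - a) / 2.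
have r0 : 0 < r by rewrite /r divr_gt0 // subr_gt0.
have r1 : r <= 2^-1 by rewrite /r; lra.
have p0 := pi_gt0 R.
have t0 : 0 < sin (pi * r) ^+ 2.
  rewrite exprn_gt0 // sin_gt0_pi // mulr_gt0 //= gtr_pMr //; lra.
have t1 : sin (pi * r) ^+ 2 <= 1 by case/andP: (sin2_itv (pi * r)).
apply: eq_approx_multiplier mA _ (approx_multiplier_arc i c t0 t1) => x /Cxi /andP[h1 h2] /=.
move: (x ord0 i) h1 h2 => v h1 h2; split => h.
  rewrite ltNge; apply/negP => va; move: h; rewrite ltNge => /negP; apply.
  have [d1|d1] := lerP (c - v) 2^-1.
    apply: sin2_ge => //.
      by rewrite distrC ger0_norm /c /r; lra.
    by rewrite distrC; rewrite /c in d1 *; rewrite ger0_norm; lra.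
  have -> : sin (pi * (v - c)) ^+ 2 = sin (pi * (1 + v - c)) ^+ 2.
    rewrite (_ : pi * (1 + v - c) = pi * (v - c) + pi); last by ring.
    by rewrite sinDpi sqrrN.
  by apply: sin2_ge => //; rewrite ger0_norm /c /r; rewrite /c in d1; lra.
have vr : `|v - c| < r by rewrite ltr_norml /c /r; apply/andP; split; lra.
rewrite lt_neqAle andbC; apply/andP; split.
  have [v0|v0] := eqVneq (v - c) 0.
    by rewrite v0 mulr0 sin0 expr0n /= ltW.
  have := @sin2_ge R `|v - c| r _ _ _; rewrite normr_gt0 v0 => /(_ isT).
  rewrite (gtr0_norm r0) => /(_ (ltW vr) r1).
  by have [h0|h0] := ger0P (v - c); rewrite // mulrN sinN sqrrN.
apply/eqP => E; have vr' : 0 <= `|v - c| <= 2^-1 by rewrite normr_ge0 /=; lra.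
have E2 : sin (pi * `|v - c|) ^+ 2 = sin (pi * r) ^+ 2.
  by rewrite -E; have [h0|h0] := ger0P (v - c); rewrite // mulrN sinN sqrrN.
have s0 : 0 <= sin (pi * `|v - c|) by apply: sin_ge0_pi; apply/andP; split; nra.
have s1 : 0 <= sin (pi * r) by apply: sin_ge0_pi; apply/andP; split; nra.
move/eqP: E2; rewrite eqrXn2 // => /eqP /sin_inj.
rewrite !in_itv /= => /(_ _ _)/wrap[]; last 1 first.
- by move/(mulfI (lt0r_neq0 p0)) => e; move: vr; rewrite e ltxx.
- by apply/andP; split; nra.
- by apply/andP; split; nra.
Qed.

Lemma approx_multiplier_cylinder i (Y : set (measurableTypeR R)) : measurable Y ->
  approx_multiplier ((fun x : 'rV[R]_n => x ord0 i) @^-1` Y).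
Proof.
rewrite RGenOInfty.measurableE; move: Y.
apply: smallest_sub.
  have [g0 gC gU] := approx_multiplier_sigma_algebra; split.
  - by rewrite preimage_set0.
  - by move=> Y gY; rewrite setTD preimage_setC; exact: approx_multiplierC.
  - by move=> Y gY; rewrite preimage_bigcup; exact: gU.
move=> _ [a ->]; apply: eq_approx_multiplier (approx_multiplier_ray i a) => [|x _ /=]; last first.
  by rewrite in_itv /= andbT.
by rewrite -[X in measurable X]setTI; apply: measurable_coord.
Qed.

Lemma measurable_approx_multiplier A : measurable A -> approx_multiplier A.
Proof.
move: A; apply: (@smallest_sub _ _ _ approx_multiplier); first exact: approx_multiplier_sigma_algebra.
move=> A; rewrite -bigcup_seq/= => -[i _ [Y mY]].
by rewrite setTI => <-; exact: approx_multiplier_cylinder.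
Qed.

Lemma approximableZ (z : R[i]) g : approximable g -> approximable (fun x => z * g x).
Proof. by move=> ag; exact: (approximableM_trigpoly (trigpoly_cst z) ag). Qed.

Lemma approximable_sum (I : Type) (s : seq I) (F : I -> 'rV[R]_n -> R[i]) :
  (forall i, approximable (F i)) -> approximable (fun x => \sum_(i <- s) F i x).
Proof.
move=> aF; elim: s => [|i s IHs].
  apply: approximable_eq (approximable_trigpoly (trigpoly_cst 0)) => x _.
  by rewrite big_nil.
apply: approximable_eq (approximableD (aF i) IHs) => x _.
by rewrite big_cons.
Qed.

Lemma approximable_indicC A : measurable A -> approximable (indicC A).
Proof.
move=> /measurable_approx_multiplier[_ /(_ _ (approximable_trigpoly (trigpoly_cst 1)))].
by apply: approximable_eq => x _; rewrite mulr1.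
Qed.

Import HBNNSimple.

Lemma approximable_ge0 (p : 'rV[R]_n -> R) (B : R) : measurable_fun cube p ->
  (forall x, cube x -> 0 <= p x) -> (forall x, cube x -> p x <= B) ->
  approximable (fun x => (p x)%:C%C).
Proof.
move=> mp p0 pB.
have mp' : measurable_fun cube (EFin \o p) by exact/measurable_EFinP.
have ep0 x : cube x -> (0 <= (EFin \o p) x)%E by move=> Cx; rewrite lee_fin p0.
pose q := nnsfun_approx mC mp'.
have qp k x : cube x -> q k x <= p x.
  move=> Cx; rewrite -lee_fin /q nnsfun_approxE.
  exact: (le_approx k ep0 Cx).
have q_cvg x : cube x -> q k x @[k --> \oo] --> p x.
  by move=> Cx; have /fine_cvgP[_] := cvg_nnsfun_approx mC mp' ep0 Cx.
have bnd (t : R) x : cube x -> 0 <= t -> t <= p x -> sqn t%:C%C <= B ^+ 2.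
  move=> Cx t0 tp; rewrite sqnE /= expr0n addr0 ler_pXn2r ?nnegrE //.
    exact: le_trans tp (pB x Cx).
  by apply: le_trans (pB x Cx); exact: p0.
apply: (approximable_cvg (B := B ^+ 2) (g_ := fun k x => (q k x)%:C%C)).
- by split => //; exact: measurable_cst.
- by move=> x Cx; apply: (bnd _ _ Cx); rewrite ?p0.
- move=> k.
  have /finite_seqP[s sE] : finite_set (range (q k)) by exact: fimfunP.
  have ay (y : R) : approximable (fun x => y%:C%C * indicC (q k @^-1` [set y]) x).
    apply/approximableZ/approximable_indicC/measurable_funPTI.
    exact: measurable_set1.
  apply: approximable_eq (approximable_sum (undup s) ay) => x Cx.
  have xs : q k x \in undup s.
    by rewrite mem_undup; have : range (q k) (q k x) by []; rewrite sE.
  rewrite (bigD1_seq (q k x)) ?undup_uniq //= big1 ?addr0.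
    by rewrite /indicC indicE mem_set // mulr1.
  by move=> y /eqP yq; rewrite /indicC indicE memNset ?mulr0 // => /esym.
- by move=> k x Cx; apply: (bnd _ _ Cx); [exact: fun_ge0 | exact: qp].
move=> x Cx.
have E k : sqn ((p x)%:C%C - (q k x)%:C%C) = (p x - q k x) ^+ 2.
  by rewrite -rmorphB sqnE /= expr0n addr0.
under eq_fun do rewrite E.
have h : (p x - q k x) @[k --> \oo] --> (0 : R).
  by rewrite -(subrr (p x)); apply: cvgB; [exact: cvg_cst | exact: q_cvg].
exact: cvg_sqr0 h.
Qed.

Lemma approximable_real (p : 'rV[R]_n -> R) (B : R) : measurable_fun cube p ->
  (forall x, cube x -> `|p x| <= B) -> approximable (fun x => (p x)%:C%C).
Proof.
move=> mp pB.
have h1 : approximable (fun x => (p x + B)%:C%C).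
  apply: (@approximable_ge0 (fun x => p x + B) (B + B)).
  - by apply: measurable_funD => //; exact: measurable_cst.
  - by move=> x /pB; rewrite ler_norml => /andP[? _]; lra.
  - by move=> x /pB; rewrite ler_norml => /andP[_ ?]; lra.
have := approximableD h1 (approximable_trigpoly (trigpoly_cst (- B)%:C%C)).
by apply: approximable_eq => x _; rewrite -rmorphD addrK.
Qed.

Lemma bounded_approximable B g : cmeasurable g -> cbounded B g -> approximable g.
Proof.
move=> [mR mI] gB.
have aR := approximable_real mR (fun x Cx => cbounded_Re gB Cx).
have aI := approximable_real mI (fun x Cx => cbounded_Im gB Cx).
apply: approximable_eq (approximableD aR (approximableZ (Complex 0 1) aI)) => x _.
by apply: complex_ext; rewrite ?ReD ?ImD ?ReM ?ImM /=; ring.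
Qed.

End density.

(** * Square integrability *)

Section square_integrability.
Context {R : realType} {n : nat}.
Implicit Types (x y : 'rV[R]_n) (f g P : 'rV[R]_n -> R[i]).
Notation mu := (@lebesgue_rV R n).
Notation cube := (@unit_cube R n).

Let mC := @measurable_cube R n.

Definition sqn_int (D : set 'rV[R]_n) f : R := (\int[mu]_(x in D) sqn (f x))%R.

Definition sqn_integrable (D : set 'rV[R]_n) f :=
  mu.-integrable D (EFin \o (fun x => sqn (f x))).

Lemma sqn_integrable_bounded B f : cmeasurable f -> cbounded B f ->
  sqn_integrable cube f.
Proof.
move=> mf fB; apply: (integrable_bounded_cube (B := B)); first exact: measurable_sqn.
by move=> x Cx; rewrite ger0_norm ?sqn_ge0 // fB.
Qed.

Lemma sqn_int_ge0 D f : 0 <= sqn_int D f.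
Proof. by apply: Rintegral_ge0 => x _; exact: sqn_ge0. Qed.

Lemma measurable_sqnC f (D : set 'rV[R]_n) : D `<=` cube -> cmeasurable f ->
  measurable_fun D (fun x => sqn (f x)).
Proof. by move=> DC mf; apply: (measurable_funS mC DC); exact: measurable_sqn. Qed.

(** For small [t] the factor of [sqn z] is close to [1], so that a small
    perturbation [w] preserves sharp constants. *)
Lemma sqnD_young (t : R) (z w : R[i]) : 0 < t ->
  sqn (z + w) <= (1 + t) * sqn z + (1 + t^-1) * sqn w.
Proof.
move=> t0; case: z => a b; case: w => c d; rewrite !sqnE /= -subr_ge0.
rewrite (_ : _ - _ = t^-1 * ((t * a - c) ^+ 2 + (t * b - d) ^+ 2)).
  by apply: mulr_ge0; [rewrite invr_ge0 ltW | rewrite addr_ge0 ?sqr_ge0].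
by field; rewrite gt_eqF.
Qed.

Lemma sqn_integrableD (D : set 'rV[R]_n) f g : measurable D -> D `<=` cube ->
  cmeasurable f -> cmeasurable g -> sqn_integrable D f -> sqn_integrable D g ->
  sqn_integrable D (fun x => f x + g x).
Proof.
move=> mD DC mf mg jf jg.
have jZ (h : 'rV[R]_n -> R[i]) : sqn_integrable D h ->
    mu.-integrable D (EFin \o (fun x => 2 * sqn (h x))).
  by move=> jh; exact: (integrableZl mD 2 jh).
apply: le_integrable (integrableD mD (jZ _ jf) (jZ _ jg)) => //.
  apply/measurable_EFinP; apply: measurable_sqnC => //; exact: cmeasurableD.
move=> x Dx; rewrite /= lee_fin !ger0_norm ?sqn_ge0 //; first exact: sqnD.
by rewrite addr_ge0 // mulr_ge0 // sqn_ge0.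
Qed.

Lemma sqn_integrableN (D : set 'rV[R]_n) f : sqn_integrable D f ->
  sqn_integrable D (fun x => - f x).
Proof.
rewrite /sqn_integrable; congr (is_true (integrable _ _ _)).
by apply/funext => x; rewrite /= sqnN.
Qed.

Lemma sqn_int_young (D : set 'rV[R]_n) (t : R) f g : 0 < t -> measurable D -> D `<=` cube ->
  cmeasurable f -> cmeasurable g -> sqn_integrable D f -> sqn_integrable D g ->
  sqn_int D (fun x => f x + g x) <= (1 + t) * sqn_int D f + (1 + t^-1) * sqn_int D g.
Proof.
move=> t0 mD DC mf mg jf jg.
have jZ (c : R) (h : 'rV[R]_n -> R[i]) : sqn_integrable D h ->
    mu.-integrable D (EFin \o (fun x => c * sqn (h x))).
  by move=> jh; exact: (integrableZl mD c jh).
rewrite /sqn_int -!RintegralZl // -RintegralD //; [|exact: jZ|exact: jZ].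
apply: le_Rintegral => //.
- exact: sqn_integrableD.
- have := integrableD mD (jZ (1 + t) _ jf) (jZ (1 + t^-1) _ jg).
  by apply: eq_integrable => // x _.
by move=> x Dx; exact: sqnD_young.
Qed.

Lemma sqn_int_sub (D : set 'rV[R]_n) f : measurable D -> D `<=` cube ->
  sqn_integrable cube f -> sqn_int D f <= sqn_int cube f.
Proof.
move=> mD DC jf; rewrite /sqn_int -{1}(setIidr DC) Rintegral_mkcondr.
apply: le_Rintegral => //.
  have jD := integrableS mC mD DC jf.
  have := jD; rewrite -{1}(setIidr DC) integrable_restrict //.
  by apply: eq_integrable => // x _; rewrite restrict_EFin.
by move=> x _; rewrite patchE; case: ifP => _ //; exact: sqn_ge0.
Qed.

Lemma sqn_int_fourier_sum L f : uniq L ->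
  sqn_int cube (fourier_sum L f) = \sum_(nu <- L) sqn (fourier_coef f nu).
Proof.
move=> uL; have := congr1 (fun z : R[i] => Re z) (torus_integral_sqn_fourier_sum f uL).
rewrite Re_sum => <-; apply: eq_Rintegral => x _; by rewrite Re_mul_conj.
Qed.

Definition truncated f (m : nat) x : R[i] :=
  indicC (cube `&` [set x | sqn (f x) <= m%:R]) x * f x.

Lemma truncated_measurable f m : cmeasurable f -> cmeasurable (truncated f m).
Proof.
move=> mf; apply: cmeasurableM => //; apply: cmeasurable_indicC.
rewrite (_ : [set x | _] = (fun x => sqn (f x)) @^-1` `]-oo, m%:R]).
  by apply: measurable_sqn => //; exact: measurable_itv.
by apply/seteqP; split => x /=; rewrite in_itv.
Qed.

Lemma truncatedE f m x : cube x ->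
  truncated f m x = if sqn (f x) <= m%:R then f x else 0.
Proof.
move=> Cx; rewrite /truncated /indicC indicE; case: ifPn => h.
  by rewrite mem_set ?mul1r.
by rewrite memNset ?mul0r // => -[_]; exact/negP.
Qed.

Lemma truncated_cbounded f m : cbounded m%:R (truncated f m).
Proof. by move=> x Cx; rewrite truncatedE //; case: ifP => // _; rewrite sqn0. Qed.

Lemma truncated_near f x : cube x -> \forall m \near \oo, truncated f m x = f x.
Proof.
move=> Cx; exists (Num.truncn (sqn (f x))).+1 => // m /= hm.
have /andP[_ h] := truncn_itv (sqn_ge0 (f x)).
by rewrite truncatedE // ifT // ltW // (lt_le_trans h) // ler_nat.
Qed.

(** The truncations of [f] are tested against trigonometric polynomials that
    approximate them in the weighted norm, where the weight makes the error
    integrable against [f] itself; a bound on the sum of the squared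
    coefficients then bounds their square norms. *)
Lemma sqn_int_truncated_le f (M : R) m : cintegrable f ->
  (forall L, uniq L -> \sum_(nu <- L) sqn (fourier_coef f nu) <= M) ->
  sqn_int cube (truncated f m) <= 2 * M + 8 +
    2 * (\int[mu]_(x in cube) (1 + `|Re (f x)| + `|Im (f x)|))%R.
Proof.
move=> fi fM; have [iR iI] := fi; have mf := cintegrable_measurable fi.
pose w x := 1 + `|Re (f x)| + `|Im (f x)|.
have w1 x : 1 <= w x by rewrite /w -addrA lerDl addr_ge0.
have w0 x : 0 <= w x by apply: le_trans (w1 x).
have iw : mu.-integrable cube (EFin \o w).
  rewrite (_ : _ \o _ = fun x => ((1 : R)%:E + `|Re (f x)|%:E + `|Im (f x)|%:E)%E) //.
  apply: integrableD => //; last exact: (integrable_norm (f := fun x => Im (f x)) iI).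
  apply: integrableD => //; first exact: integrable_one.
  exact: (integrable_norm (f := fun x => Re (f x)) iR).
pose g := truncated f m.
have mg : cmeasurable g := truncated_measurable m mf.
have gB : cbounded m%:R g := @truncated_cbounded f m.
have [_ _ /(_ 1 ltr01)[P tP hP]] := bounded_approximable w0 iw mg gB.
have mP := trigpoly_cmeasurable tP; have [BP PB] := trigpoly_cbounded tP.
have mgP := cmeasurableB mg mP; have bgP := cboundedB gB PB.
have jg := sqn_integrable_bounded mg gB.
have jP := sqn_integrable_bounded mP PB.
have jgP := sqn_integrable_bounded mgP bgP.
have jgPw := integrable_sqn_weight iw mgP bgP.
have h1 : sqn_int cube (fun x => g x - P x) <= 1.
  apply: le_trans hP; apply: le_Rintegral => // x Cx.
  by rewrite ler_peMr // sqn_ge0.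
have h2 : sqn_int cube P <= (1 + 2^-1) * sqn_int cube g + (1 + 2) * 1.
  rewrite -[X in (1 + X) * 1]invrK.
  apply: (le_trans (y := (1 + 2^-1) * sqn_int cube g + (1 + 2^-1^-1) * sqn_int cube (fun x => - (g x - P x)))).
    rewrite [leLHS](_ : _ = sqn_int cube (fun x => g x + - (g x - P x))); last first.
      by apply: eq_Rintegral => x _; congr sqn; ring.
    apply: sqn_int_young => //.
    - by under [X in cmeasurable X]eq_fun do rewrite -mulN1r; apply: cmeasurableM => //; exact: cmeasurable_cst.
    - exact: sqn_integrableN.
  rewrite lerD2l ler_wpM2l // (_ : sqn_int _ _ = sqn_int cube (fun x => g x - P x)) //.
  by apply: eq_Rintegral => x _; rewrite sqnN.
have [L0 hL] := trigpoly_spectrum tP.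
pose L := undup L0; have uL : uniq L := undup_uniq _.
have PE : P = fourier_sum L P by apply: hL => // nu; rewrite mem_undup.
have h3 : Re (torus_integral (fun x => f x * (P x)^*%C)) <=
    2^-1 * M + 2^-1 * sqn_int cube P.
  rewrite {1 2}PE torus_integral_mul_fourier_sum // sqn_int_fourier_sum // Re_sum.
  apply: (le_trans (y := \sum_(nu <- L) (2^-1 * sqn (fourier_coef f nu) +
     2^-1 * sqn (fourier_coef P nu)))).
    by apply: ler_sum => nu _; exact: Re_mul_conj_le.
  by rewrite big_split /= -!mulr_sumr lerD2r ler_pM2l ?invr_gt0 // fM.
have jfP : cintegrable (fun x => f x * (P x)^*%C).
  apply: (cintegrableM_bounded (B := BP)) => //; first exact: cmeasurable_conj.
  by move=> x Cx; rewrite sqnE Re_conj Im_conj sqrrN -sqnE PB.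
have h4 : sqn_int cube g <= Re (torus_integral (fun x => f x * (P x)^*%C)) +
    (2^-1 * (\int[mu]_(x in cube) w x)%R + 2^-1 * wnorm w (fun x => g x - P x)).
  have iZ (p : 'rV[R]_n -> R) : mu.-integrable cube (EFin \o p) ->
      mu.-integrable cube (EFin \o (fun x => 2^-1 * p x)).
    by move=> ip; exact: (integrableZl mC 2^-1 ip).
  have iDf (p q : 'rV[R]_n -> R) : mu.-integrable cube (EFin \o p) ->
      mu.-integrable cube (EFin \o q) -> mu.-integrable cube (EFin \o (fun x => p x + q x)).
    by move=> ip iq; have := integrableD mC ip iq; apply: eq_integrable.
  have i1 := iZ _ iw; have i2 := iZ _ jgPw; have [i3 _] := jfP.
  rewrite /wnorm -!RintegralZl // -[X in _ + X]RintegralD // -RintegralD //; last exact: iDf.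
  apply: le_Rintegral => //; first exact: (iDf _ _ i3 (iDf _ _ i1 i2)).
  move=> x Cx.
  have -> : sqn (g x) = Re (f x * (P x)^*%C) + Re (f x * (g x - P x)^*%C).
    rewrite -ReD -mulrDr -conjD addrC subrK /g truncatedE //.
    by case: ifP => _; rewrite ?Re_mul_conj // sqn0 conjc0 mulr0.
  rewrite lerD2l; move: (g x - P x) => d.
  rewrite /w sqnE; case: (f x) => a b; case: d => c e; rewrite ReM /= mulrN opprK.
  have ha : a * c <= `|a| * (2^-1 + 2^-1 * c ^+ 2).
    apply: le_trans (ler_norm _) _; rewrite normrM ler_wpM2l //.
    have := sqr_ge0 (`|c| - 1); rewrite -[c ^+ 2]real_normK ?num_real //; nra.
  have hb : b * e <= `|b| * (2^-1 + 2^-1 * e ^+ 2).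
    apply: le_trans (ler_norm _) _; rewrite normrM ler_wpM2l //.
    have := sqr_ge0 (`|e| - 1); rewrite -[e ^+ 2]real_normK ?num_real //; nra.
  have a0 := normr_ge0 a; have b0 := normr_ge0 b.
  have c0 := sqr_ge0 c; have e0 := sqr_ge0 e.
  move: ha hb c0 e0 a0 b0; move: `|a| `|b| (c ^+ 2) (e ^+ 2) (a * c) (b * e) => A B C E X Y.
  move=> ha hb c0 e0 a0 b0.
  have := mulr_ge0 a0 e0; have := mulr_ge0 b0 c0; nra.
have -> : (\int[mu]_(x in cube) (1 + `|Re (f x)| + `|Im (f x)|))%R =
  (\int[mu]_(x in cube) w x)%R by [].
move: h2 h3 h4 hP; rewrite -/g.
move: (sqn_int cube g) (sqn_int cube P) (Re _) (wnorm _ _) (Rintegral _ _ _) => A1 A2 A3 A4 A5.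
lra.
Qed.

Lemma sqn_integrable_of_coef f (M : R) : cintegrable f ->
  (forall L, uniq L -> \sum_(nu <- L) sqn (fourier_coef f nu) <= M) ->
  sqn_integrable cube f.
Proof.
move=> fi fM; have mf := cintegrable_measurable fi.
have [C hC] : exists C : R, forall m, sqn_int cube (truncated f m) <= C.
  by eexists => m; exact: (sqn_int_truncated_le m fi fM).
pose q m x := (sqn (truncated f m x))%:E.
have jq m := sqn_integrable_bounded (truncated_measurable m mf) (@truncated_cbounded f m).
have mq m : measurable_fun cube (q m) by case/integrableP: (jq m).
have q0 m x : cube x -> (0 <= q m x)%E by rewrite lee_fin sqn_ge0.
apply/integrableP; split; first by apply/measurable_EFinP; exact: measurable_sqn.
have nq x : cube x -> {homo q^~ x : m m' / (m <= m')%N >-> (m <= m')%E}.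
  move=> Cx m m' mm'; rewrite /q lee_fin !truncatedE //; case: ifPn => h.
    by rewrite ifT // (le_trans h) // ler_nat.
  by rewrite sqn0 sqn_ge0.
have cq x : cube x -> q m x @[m --> \oo] --> (sqn (f x))%:E.
  move=> Cx; apply: cvg_near_cst.
  by apply: filterS (truncated_near f Cx) => m; rewrite /q => ->.
have -> : (\int[mu]_(x in cube) `|(EFin \o (fun x => sqn (f x))) x|)%E =
    (\int[mu]_(x in cube) limn (q^~ x))%E.
  apply: eq_integral => x /set_mem Cx; rewrite /= ger0_norm ?sqn_ge0 //.
  by apply/esym/cvg_lim => //; exact: cq.
rewrite monotone_convergence //.
apply: (@le_lt_trans _ _ C%:E); last exact: ltry.
apply: lime_le.
  by apply: ereal_nondecreasing_is_cvgn => m m' mm'; apply: ge0_le_integral => // x Cx;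
    [exact: q0 | exact: nq].
apply: nearW => m.
have := hC m; rewrite -lee_fin; apply: le_trans.
by rewrite /sqn_int /Rintegral fineK //; exact: integrable_fin_num (jq m).
Qed.

End square_integrability.

(** * Approximation by partial Fourier sums *)

Section mean_square_approximation.
Context {R : realType} {n : nat}.
Implicit Types (x y : 'rV[R]_n) (f g P : 'rV[R]_n -> R[i]).
Notation mu := (@lebesgue_rV R n).
Notation cube := (@unit_cube R n).

Let mC := @measurable_cube R n.

Lemma sqn_int_truncated_cvg f : cmeasurable f -> sqn_integrable cube f ->
  sqn_int cube (fun x => f x - truncated f m x) @[m --> \oo] --> (0 : R).
Proof.
move=> mf jf.
have [m|x Cx|m x Cx|_] := @Rintegral_dominated _ _ _ mu cube
  (fun m x => sqn (f x - truncated f m x)) (cst 0) (fun x => sqn (f x)) mC _ _ jf.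
- exact: measurable_sqn (cmeasurableB mf (truncated_measurable m mf)).
- apply: cvg_near_cst; apply: filterS (truncated_near f Cx) => m ->.
  by rewrite subrr sqn0.
- rewrite ger0_norm ?sqn_ge0 // truncatedE //.
  by case: ifP => _; rewrite ?subrr ?sqn0 ?subr0 // sqn_ge0.
by rewrite Rintegral_cst // mul0r.
Qed.

Lemma trigpoly_dense f (e : R) : cmeasurable f -> sqn_integrable cube f -> 0 < e ->
  exists2 P, trigpoly P & sqn_int cube (fun x => f x - P x) <= e.
Proof.
move=> mf jf e0; have e4 : 0 < e / 4 by rewrite divr_gt0.
have /cvgrPdist_lt /(_ _ e4) [m _ /(_ m (leqnn m))] := sqn_int_truncated_cvg mf jf.
rewrite /= sub0r normrN ger0_norm ?sqn_int_ge0 // => hm.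
pose g := truncated f m.
have mg : cmeasurable g := truncated_measurable m mf.
have gB : cbounded m%:R g := @truncated_cbounded _ _ f m.
have [_ _ /(_ _ e4)[P tP hP]] := bounded_approximable (w := cst 1)
  (fun=> ler01) (integrable_one (R := R) (n := n)) mg gB.
exists P => //.
have mP := trigpoly_cmeasurable tP; have [BP PB] := trigpoly_cbounded tP.
have hP' : sqn_int cube (fun x => g x - P x) <= e / 4.
  apply: le_trans hP; rewrite /wnorm /sqn_int.
  rewrite [leRHS](_ : _ = sqn_int cube (fun x => g x - P x)) //.
  by apply: eq_Rintegral => x _; rewrite mulr1.
rewrite (_ : sqn_int _ _ = sqn_int cube (fun x => (f x - g x) + (g x - P x))); last first.
  by apply: eq_Rintegral => x _; congr sqn; ring.
have jg := sqn_integrable_bounded mg gB.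
have jfg : sqn_integrable cube (fun x => f x - g x).
  apply: le_integrable jf => //.
    apply/measurable_EFinP; exact: measurable_sqn (cmeasurableB mf mg).
  move=> x Cx; rewrite /= lee_fin !ger0_norm ?sqn_ge0 // /g truncatedE //.
  by case: ifP => _; rewrite ?subrr ?sqn0 ?subr0 // sqn_ge0.
apply: le_trans (sqn_int_young ltr01 mC _ _ _ jfg _) _ => //.
- exact: cmeasurableB.
- exact: cmeasurableB.
- exact: sqn_integrable_bounded (cmeasurableB mg mP) (cboundedB gB PB).
rewrite invr1; move: hm hP'; rewrite -/g.
move: (sqn_int _ _) (sqn_int _ _) => a b; lra.
Qed.

(** Among the trigonometric polynomials with spectrum in [L], the partial
    Fourier sum is the closest to [f] in mean square, by orthogonality. *)
Lemma fourier_sum_best f P L : cintegrable f -> sqn_integrable cube f ->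
  uniq L -> trigpoly P -> P = fourier_sum L P ->
  sqn_int cube (fun x => f x - fourier_sum L f x) <= sqn_int cube (fun x => f x - P x).
Proof.
move=> fi jf uL tP PE; have mf := cintegrable_measurable fi.
have iP := cintegrable_trigpoly tP.
pose S := fourier_sum L f; pose Q := fourier_sum L (fun x => f x - P x).
have tS : trigpoly S := trigpoly_fourier_sum L f.
have tQ : trigpoly Q := trigpoly_fourier_sum L _.
have QE x : Q x = S x - P x.
  rewrite [in RHS]PE /Q /S /fourier_sum -sumrB; apply: eq_bigr => nu _.
  by rewrite fourier_coefB // mulrBl.
have mS := trigpoly_cmeasurable tS; have mQ := trigpoly_cmeasurable tQ.
have [BS SB] := trigpoly_cbounded tS; have [BQ QB] := trigpoly_cbounded tQ.
have jS := sqn_integrable_bounded mS SB; have jQ := sqn_integrable_bounded mQ QB.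
have ifS := cintegrableB fi (cintegrable_trigpoly tS).
have mfS := cmeasurableB mf mS.
have jfS : sqn_integrable cube (fun x => f x - S x).
  by apply: sqn_integrableD => //; [under [X in cmeasurable X]eq_fun do rewrite -mulN1r;
    apply: cmeasurableM => //; exact: cmeasurable_cst | exact: sqn_integrableN].
have orth : torus_integral (fun x => (f x - S x) * (Q x)^*%C) = 0.
  rewrite torus_integral_mul_fourier_sum // big_seq big1 // => nu nuL.
  rewrite fourier_coefB //; last exact: cintegrable_trigpoly.
  by rewrite fourier_coef_fourier_sum // nuL subrr mul0r.
have [iR _] : cintegrable (fun x => (f x - S x) * (Q x)^*%C).
  apply: (cintegrableM_bounded (B := BQ)) => //; first exact: cmeasurable_conj.
  by move=> x Cx; rewrite sqnE Re_conj Im_conj sqrrN -sqnE QB.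
have i2 : mu.-integrable cube (EFin \o (fun x => 2 * Re ((f x - S x) * (Q x)^*%C))).
  exact: (integrableZl mC 2 iR).
have i3 : mu.-integrable cube (EFin \o (fun x => sqn (f x - S x) + 2 * Re ((f x - S x) * (Q x)^*%C))).
  by have := integrableD mC jfS i2; apply: eq_integrable.
have -> : sqn_int cube (fun x => f x - fourier_sum L f x) =
    (\int[mu]_(x in cube) (sqn (f x - S x) + 2 * Re ((f x - S x) * (Q x)^*%C)))%R.
  rewrite RintegralD // RintegralZl //.
  have -> : (\int[mu]_(x in cube) Re ((f x - S x) * (Q x)^*%C))%R = 0.
    by have := congr1 (fun z : R[i] => Re z) orth.
  by rewrite mulr0 addr0.
apply: le_Rintegral => //.
  apply: sqn_integrableD => //; last first.
  - apply: sqn_integrableN; have [BP PB] := trigpoly_cbounded tP.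
    exact: sqn_integrable_bounded (trigpoly_cmeasurable tP) PB.
  - under [X in cmeasurable X]eq_fun do rewrite -mulN1r.
    apply: cmeasurableM (cmeasurable_cst _) _; exact: trigpoly_cmeasurable.
move=> x Cx; have -> : f x - P x = (f x - S x) + Q x by rewrite QE; ring.
move: (f x - S x) (Q x) => z w.
case: z => a b; case: w => c d; rewrite !sqnE ReM /= -subr_ge0.
rewrite (_ : _ - _ = c ^+ 2 + d ^+ 2); last by ring.
by rewrite addr_ge0 ?sqr_ge0.
Qed.

Lemma fourier_sum_approx f (e : R) : cintegrable f -> sqn_integrable cube f -> 0 < e ->
  exists2 L, uniq L & sqn_int cube (fun x => f x - fourier_sum L f x) <= e.
Proof.
move=> fi jf e0.
have [P tP hP] := trigpoly_dense (cintegrable_measurable fi) jf e0.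
have [L0 hL] := trigpoly_spectrum tP.
exists (undup L0); first exact: undup_uniq.
apply: le_trans hP; apply: fourier_sum_best => //; first exact: undup_uniq.
by apply: hL; [exact: undup_uniq | move=> nu; rewrite mem_undup].
Qed.

(** Partial sums approximate [f] in mean square over the torus, hence over [D],
    and both sides of the inequality are continuous for that convergence. *)
Lemma sqn_int_transfer f (D : set 'rV[R]_n) (c : R) : measurable D -> D `<=` cube ->
  0 <= c -> cintegrable f -> sqn_integrable cube f ->
  (forall L, uniq L -> sqn_int cube (fourier_sum L f) <= c * sqn_int D (fourier_sum L f)) ->
  sqn_int cube f <= c * sqn_int D f.
Proof.
move=> mD DC c0 fi jf hS; have mf := cintegrable_measurable fi.
set A := sqn_int cube f; set B := sqn_int D f.
have B0 : 0 <= B := sqn_int_ge0 D f.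
have key (t : R) : 0 < t -> t <= 1 -> A <= c * B + t * (3 * (c * B) + 4 * c + 2).
  move=> t0 t1; have t20 : 0 < t ^+ 2 by rewrite exprn_gt0.
  (* distance [t ^+ 2] compensates the factor [1 + t^-1] below *)
  have [L uL hL] := fourier_sum_approx fi jf t20.
  pose S := fourier_sum L f; pose d x := f x - S x.
  have tS : trigpoly S := trigpoly_fourier_sum L f.
  have mS := trigpoly_cmeasurable tS; have [BS SB] := trigpoly_cbounded tS.
  have jS := sqn_integrable_bounded mS SB.
  have md : cmeasurable d := cmeasurableB mf mS.
  have mNd : cmeasurable (fun x => - d x).
    by under [X in cmeasurable X]eq_fun do rewrite -mulN1r; apply: cmeasurableM => //; exact: cmeasurable_cst.
  have mNS : cmeasurable (fun x => - S x).
    by under [X in cmeasurable X]eq_fun do rewrite -mulN1r; apply: cmeasurableM => //; exact: cmeasurable_cst.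
  have jd : sqn_integrable cube d.
    by apply: sqn_integrableD => //; exact: sqn_integrableN.
  have onD h : sqn_integrable cube h -> sqn_integrable D h by exact: integrableS.
  have h1 : A <= (1 + t) * sqn_int cube S + (1 + t^-1) * sqn_int cube d.
    rewrite /A (_ : sqn_int cube f = sqn_int cube (fun x => S x + d x)).
      exact: sqn_int_young.
    by apply: eq_Rintegral => x _; congr sqn; rewrite /d addrC subrK.
  have h2 : sqn_int D S <= (1 + t) * B + (1 + t^-1) * sqn_int D (fun x => - d x).
    rewrite (_ : sqn_int D S = sqn_int D (fun x => f x + - d x)).
      by apply: sqn_int_young => //; [exact: onD | exact/sqn_integrableN/onD].
    by apply: eq_Rintegral => x _; congr sqn; rewrite /d; ring.
  have h3 : sqn_int D (fun x => - d x) <= t ^+ 2.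
    rewrite (_ : sqn_int D _ = sqn_int D d); last by apply: eq_Rintegral => x _; rewrite sqnN.
    exact: le_trans (sqn_int_sub mD DC jd) hL.
  have E : (1 + t^-1) * t ^+ 2 = t ^+ 2 + t by field; rewrite gt_eqF.
  have ti0 : 0 <= 1 + t^-1 by rewrite addr_ge0 // invr_ge0 ltW.
  have {}h2 : sqn_int D S <= (1 + t) * B + (t ^+ 2 + t).
    by apply: (le_trans h2); rewrite -E lerD2l ler_wpM2l.
  have {}h1 : A <= (1 + t) * (c * ((1 + t) * B + (t ^+ 2 + t))) + (t ^+ 2 + t).
    apply: (le_trans h1); rewrite -[X in _ <= _ + X]E; apply: lerD.
      apply: ler_wpM2l; first by rewrite addr_ge0 // ltW.
      by apply: le_trans (hS L uL) _; rewrite ler_wpM2l.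
    by rewrite ler_wpM2l.
  apply: (le_trans h1); have cB := mulr_ge0 c0 B0.
  have tt : t ^+ 2 <= t by rewrite expr2 ler_piMr // ltW.
  have -> : (1 + t) * (c * ((1 + t) * B + (t ^+ 2 + t))) + (t ^+ 2 + t) =
    (1 + t) ^+ 2 * (c * B) + c * ((1 + t) * (t ^+ 2 + t)) + (t ^+ 2 + t) by ring.
  have -> : c * B + t * (3 * (c * B) + 4 * c + 2) =
    (1 + 3 * t) * (c * B) + c * (4 * t) + 2 * t by ring.
  apply: lerD; last by lra.
  apply: lerD; first by apply: ler_wpM2r => //; rewrite sqrrD !expr1n; lra.
  apply: ler_wpM2l => //; nra.
set k := 3 * (c * B) + 4 * c + 2 in key.
have k0 : 0 < k by rewrite /k ltr_wpDl // addr_ge0 // !mulr_ge0.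
apply/ler_addgt0Pr => e e0.
pose t := Num.min 1 (e / k).
have t0 : 0 < t by rewrite lt_min ltr01 divr_gt0.
have t1 : t <= 1 by rewrite ge_min lexx.
apply: le_trans (key t t0 t1) _; rewrite lerD2l -ler_pdivlMr //.
by rewrite ge_min lexx orbT.
Qed.

End mean_square_approximation.

(** * Continuous positive definite functions *)

Section complex_continuity.
Context {R : realType}.

Lemma complex_normE (z : R[i]) : `|z| = (Num.sqrt (sqn z))%:C%C.
Proof. by rewrite sqnE normc_def. Qed.

Lemma Re_le_sqrt (z : R[i]) : `|Re z| <= Num.sqrt (sqn z).
Proof. by rewrite -sqrtr_sqr ler_sqrt ?sqn_ge0 // sqnE lerDl sqr_ge0. Qed.

Lemma Im_le_sqrt (z : R[i]) : `|Im z| <= Num.sqrt (sqn z).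
Proof. by rewrite -sqrtr_sqr ler_sqrt ?sqn_ge0 // sqnE lerDr sqr_ge0. Qed.

Lemma sqrt_sqn_le (z : R[i]) : Num.sqrt (sqn z) <= `|Re z| + `|Im z|.
Proof.
have h : 0 <= `|Re z| + `|Im z| by rewrite addr_ge0.
rewrite -[leRHS]ger0_norm // -sqrtr_sqr ler_sqrt ?sqr_ge0 // sqnE.
rewrite sqrrD !real_normK ?num_real // addrAC lerDl.
by rewrite mulrn_wge0 // mulr_ge0.
Qed.

(** The topology of [R[i]] is that of the modulus, so continuity is continuity
    of the real and imaginary parts. *)
Lemma complex_continuousP (T : topologicalType) (f : T -> R[i]) :
  continuous (f : T -> R[i]^o) <->
  continuous (fun x => Re (f x)) /\ continuous (fun x => Im (f x)).
Proof.
have cR (e : R) : (0 < e%:C%C) = (0 < e) by rewrite ltcE /= eqxx.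
split=> [cf|[cfR cfI]].
  split=> x; apply/cvgrPdist_lt => e e0; have := cf x; move/cvgrPdist_lt => /(_ e%:C%C).
    rewrite cR => /(_ e0); apply: filterS => y; rewrite complex_normE ltcE /= eqxx /=.
    by apply: le_lt_trans; rewrite -ReB; exact: Re_le_sqrt.
  rewrite cR => /(_ e0); apply: filterS => y; rewrite complex_normE ltcE /= eqxx /=.
  by apply: le_lt_trans; rewrite -ImB; exact: Im_le_sqrt.
move=> x; apply/cvgrPdist_lt => e; rewrite ltcE /= => /andP[/eqP Ie Re0].
have e2 : 0 < Re e / 2 by rewrite divr_gt0.
have /cvgrPdist_lt /(_ _ e2) h1 := cfR x.
have /cvgrPdist_lt /(_ _ e2) h2 := cfI x.
near=> y.
have hR : `|Re (f x) - Re (f y)| < Re e / 2 by near: y; exact: h1.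
have hI : `|Im (f x) - Im (f y)| < Re e / 2 by near: y; exact: h2.
rewrite complex_normE ltcE /= Ie eqxx /=.
apply: le_lt_trans (sqrt_sqn_le _) _; rewrite ReB ImB; lra.
Unshelve. all: by end_near. Qed.

End complex_continuity.

Section continuous_posdef.
Context {R : realType} {n : nat}.
Implicit Types (x y : 'rV[R]_n) (f g : 'rV[R]_n -> R[i]).
Notation mu := (@lebesgue_rV R n).
Notation cube := (@unit_cube R n).

Lemma ccontinuousP f : continuous (f : 'rV[R]_n -> R[i]^o) <-> ccontinuous f.
Proof. exact: complex_continuousP. Qed.

Lemma sqn_continuous f : ccontinuous f -> continuous (fun x => sqn (f x)).
Proof.
move=> [cR cI]; under eq_fun do rewrite sqnE !expr2.
by apply: continuous_addf; apply: continuous_mulf.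
Qed.

Lemma periodic_reduce x : exists k : 'rV[int]_n, cube (x + map_mx intr k).
Proof.
exists (\row_i - Num.floor (x ord0 i + 2^-1)) => i; rewrite in_itv /= !mxE.
rewrite mulrNz; have /andP[] := floor_itv (x ord0 i + 2^-1).
rewrite intrD; move: (_%:~R) => a h1 h2; apply/andP; split; lra.
Qed.

Lemma ccontinuous_periodic_bounded f : ccontinuous f -> Zn_periodic f ->
  exists B, forall x, sqn (f x) <= B.
Proof.
move=> cf pf; pose A := [set x : 'rV[R]_n | forall i, `[- 2^-1 : R, 2^-1]%classic (x ord0 i)].
have cA : compact A by apply: (@rV_compact _ n (fun=> `[- 2^-1 : R, 2^-1]%classic)) => i; exact: segment_compact.
have : compact [set sqn (f x) | x in A].
  by apply: continuous_compact => //; apply: continuous_subspaceT; exact: sqn_continuous.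
move/compact_bounded => [M [_ hM]]; exists (M + 1) => x.
have [k Ck] := periodic_reduce x; rewrite -(pf x k).
apply: le_trans (ler_norm _) _; apply: (hM (M + 1)); first by rewrite ltrDl.
exists (x + map_mx intr k) => // i; have := Ck i; rewrite /= !in_itv /= => /andP[-> /ltW ->].
by [].
Qed.

Lemma cell_in_ball x (e : R) : cube x -> 0 < e -> exists (N : nat) (d : grid N),
  cell d x /\ cell d `<=` ball x e.
Proof.
move=> Cx e0; have /cvgrPdist_lt /(_ e e0) [N _ /(_ N (leqnn N))] := @mesh_cvg0 R.
rewrite /= sub0r normrN gtr0_norm ?invr_gt0 ?mesh_gt0 // => Me.
have [d dx] := exists_cell N Cx; exists N, d; split => // y dy.
exact: (cell_ball (ltW Me) dx dy).
Qed.

Lemma mu_cell_gt0 N (d : @grid n N) : (0 < mu (cell d))%E.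
Proof. by rewrite [X in (_ < X)%E]mu_cell lte_fin exprn_gt0 // invr_gt0 mesh_gt0. Qed.

(** A continuous function that vanishes almost everywhere vanishes, because a
    point of the torus has a cell of positive measure in each neighbourhood. *)
Lemma continuous_ae_eq0 f : ccontinuous f -> Zn_periodic f ->
  (\forall x \ae mu, cube x -> f x = 0) -> f = cst 0.
Proof.
move=> cf pf [A [mA A0 sA]]; apply/funext => x.
have [k Ck] := periodic_reduce x; rewrite -(pf x k).
move: (x + _) Ck => y Cy /=; apply/sqn_eq0/eqP; apply: contraT => fy.
have f0 : 0 < sqn (f y) by rewrite lt_neqAle eq_sym fy sqn_ge0.
have /cvgrPdist_lt /(_ _ f0) := sqn_continuous cf (x := y).
rewrite -nbhs_ballE => -[e /= e0 he].
have [N [d [dy de]]] := cell_in_ball Cy e0.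
have dA : cell d `<=` A.
  move=> z dz; apply: sA => /(_ (cell_sub_cube dz)) fz.
  by have := he z (de z dz); rewrite /= fz sqn0 subr0 ger0_norm ?sqn_ge0 // ltxx.
have := le_measure mu (mem_set (measurable_cell d)) (mem_set mA) dA.
by move=> /(lt_le_trans (mu_cell_gt0 d)); rewrite [X in (_ < X)%E]A0 ltxx.
Qed.

Lemma posdef_character nu (a : R[i]) : 0 <= a ->
  positive_definite (fun x : 'rV[R]_n => a * character nu x).
Proof.
move=> a0 N x c; pose z := \sum_(i < N) c i * character nu (x i).
suff -> : \sum_(i < N) \sum_(j < N) c i * (c j)^*%C * (a * character nu (x i - x j)) =
    a * (z * z^*%C) by rewrite mulr_ge0 // mul_conj_ge0.
rewrite /z [X in _ = a * (_ * X)](rmorph_sum (@conjc R)) mulr_suml mulr_sumr.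
apply: eq_bigr => i _; rewrite !mulr_sumr; apply: eq_bigr => j _.
rewrite characterD characterN -character_conj.
rewrite [X in _ = a * (_ * X)](conjM (c j) (character nu (x j))).
by move: (character nu (x j))^*%C (c j)^*%C => u v; ring.
Qed.

Lemma posdefD f g : positive_definite f -> positive_definite g ->
  positive_definite (fun x => f x + g x).
Proof.
move=> pf pg N x c; have := addr_ge0 (pf N x c) (pg N x c).
congr (0 <= _); rewrite -big_split; apply: eq_bigr => i _.
by rewrite -big_split; apply: eq_bigr => j _; rewrite mulrDr.
Qed.

Lemma posdef_fourier_sum L f : pos_coef f -> positive_definite (fourier_sum L f).
Proof.
move=> [_ fp]; rewrite /fourier_sum; elim: L => [|nu L IHL].
  by move=> N x c; rewrite big1 // => i _; rewrite big1 // => j _; rewrite big_nil mulr0.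
have := posdefD (posdef_character (- nu) (fp nu)) IHL.
by congr positive_definite; apply/funext => x; rewrite big_cons.
Qed.

Lemma torus_continuous_posdef_fourier_sum L f : pos_coef f ->
  torus_continuous_posdef (fourier_sum L f).
Proof.
move=> fp; have tS := trigpoly_fourier_sum L f; split.
- exact: trigpoly_periodic.
- exact/ccontinuousP/trigpoly_ccontinuous.
- exact: posdef_fourier_sum.
Qed.

End continuous_posdef.

(** * Symmetric convex bodies *)

Section convex_bodies.
Context {R : realType} {n : nat}.
Implicit Types (x y : 'rV[R]_n) (D : set 'rV[R]_n).
Notation mu := (@lebesgue_rV R n).
Notation cube := (@unit_cube R n).

Lemma convex_body_measurable D : convex_body D -> D `<=` cube -> measurable D.
Proof.
move=> [cD _ _]; apply: closed_measurable_cube.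
by apply: compact_closed => //; exact: norm_hausdorff.
Qed.

(** A point [y] is the midpoint of [x0 + y] and [- (x0 - y)], which lie in the
    body if [x0] is an interior point and [y] is small. *)
Lemma convex_body_ball D : convex_body D -> origin_symmetric D ->
  exists2 r : R, 0 < r & ball (0 : 'rV[R]_n) r `<=` D.
Proof.
move=> [_ cD [x0 ix0]] sD; have : nbhs x0 D by exact: ix0.
rewrite -nbhs_ballE => -[r /= r0 hr].
exists r => // y yr.
have h1 : D (x0 + y).
  apply: hr; apply/row_ballP => // i; move/row_ballP : yr => /(_ r0 i).
  by rewrite !mxE sub0r normrN opprD addrA subrr sub0r normrN.
have h2 : D (- (x0 - y)).
  apply: sD; apply: hr; apply/row_ballP => // i; move/row_ballP : yr => /(_ r0 i).
  by rewrite !mxE sub0r normrN opprB addrC subrK.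
have half0 : (0 : R) <= 2^-1 by rewrite invr_ge0.
have half1 : (2^-1 : R) <= 1 by rewrite invf_le1 ?ler1n.
have := cD (x0 + y) (- (x0 - y)) (Itv01 half0 half1) (mem_set h1) (mem_set h2).
rewrite inE; congr D; apply/rowP => i.
by rewrite /conv /= !mxE /= /unstable.onem; field.
Qed.

Lemma convex_body_mu D : convex_body D -> origin_symmetric D -> D `<=` cube ->
  exists2 v : R, 0 < v & mu D = v%:E.
Proof.
move=> bD sD DC; have mD := convex_body_measurable bD DC.
have [r r0 hr] := convex_body_ball bD sD.
have C0 : cube (0 : 'rV[R]_n).
  by move=> i; rewrite in_itv /= mxE; apply/andP; split; lra.
have [N [d [d0 dr]]] := cell_in_ball C0 r0.
have le1 : (mu D <= 1)%E.
  have := le_measure mu (mem_set mD) (mem_set (@measurable_cube R n)) DC.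
  by rewrite [X in (_ <= X)%E]mu_cube.
have gt0 : (0 < mu D)%E.
  apply: lt_le_trans (mu_cell_gt0 d) _.
  apply: le_measure; rewrite ?inE //; first exact: measurable_cell.
  exact: (subset_trans dr hr).
have fD : mu D \is a fin_num by rewrite ge0_fin_numE ?ltW // (le_lt_trans le1) // ltry.
by exists (fine (mu D)); rewrite ?fineK // -lte_fin fineK.
Qed.

(** For large [K] the kernel is supported in a cube that fits into the ball
    contained in the body. *)
Lemma convex_body_kernel D : convex_body D -> origin_symmetric D ->
  exists2 K : nat, (0 < K)%N & forall x, cube x -> ~ D x -> kernel K x = 0.
Proof.
move=> bD sD; have [r r0 hr] := convex_body_ball bD sD.
pose d := Num.min r 2^-1.
have d0 : 0 < d by rewrite lt_min r0 invr_gt0 ltr0n.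
have d2 : d <= 2^-1 by rewrite ge_min lexx orbT.
have p0 := pi_gt0 R.
have s0 : 0 < sin (pi * d) ^+ 2.
  by rewrite exprn_gt0 // sin_gt0_pi // mulr_gt0 //= gtr_pMr //; lra.
pose K := (Num.truncn (4 / sin (pi * d) ^+ 2)).+1.
exists K => // x Cx nDx; apply: (kernel_support d0 Cx).
  rewrite -ler_pdivrMr //; have /andP[_ h] := truncn_itv (divr_ge0 (ler0n R 4) (ltW s0)).
  exact: ltW.
apply: contrapT => /forallNP h; apply: nDx; apply: hr; apply/row_ballP => // i.
rewrite mxE sub0r normrN ltNge; apply/negP => rx; apply: (h i).
by apply: le_trans rx; rewrite ge_min lexx.
Qed.

End convex_bodies.

(** * The two Wiener constants *)

Section wiener_constants.
Context {R : realType} {n : nat}.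
Implicit Types (f : 'rV[R]_n -> R[i]) (D : set 'rV[R]_n).
Notation mu := (@lebesgue_rV R n).
Notation cube := (@unit_cube R n).

Lemma sqr_integralE D f : measurable D -> sqn_integrable D f ->
  sqr_integral D f = (sqn_int D f)%:E.
Proof.
by move=> mD jf; rewrite /sqn_int /Rintegral fineK //; exact: integrable_fin_num jf.
Qed.

Lemma sqn_integrable_lty D f : measurable D -> D `<=` cube -> cmeasurable f ->
  (sqr_integral D f < +oo)%E -> sqn_integrable D f.
Proof.
move=> mD DC mf foo; apply/integrableP; split.
  by apply/measurable_EFinP; exact: measurable_sqnC.
apply: le_lt_trans foo; apply: ge0_le_integral => //.
- apply: measurableT_comp => //; apply/measurable_EFinP; exact: measurable_sqnC.
- by apply/measurable_EFinP; exact: measurable_sqnC.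
- by move=> x _; rewrite /= lee_fin ger0_norm ?sqn_ge0.
Qed.

(** For [B = 0] the left-hand side of the hypothesis is infinite unless
    [A = 0]. *)
Lemma ratio_le (A B v w : R) : 0 <= A -> 0 <= B -> 0 < v ->
  (A%:E / ((v%:E)^-1 * B%:E) <= w%:E)%E -> A <= w / v * B.
Proof.
move=> A0 B0 v0; rewrite inver gt_eqF // -EFinM inver.
have [->|Bn0] := eqVneq B 0.
  rewrite mulr0 eqxx; move: A0; rewrite le_eqVlt => /predU1P[<-|A0].
    by rewrite mulr0.
  by rewrite gt0_muley ?lte_fin // leye_eq.
have Bp : 0 < B by rewrite lt_neqAle eq_sym Bn0.
rewrite mulf_eq0 invr_eq0 !gt_eqF //= -EFinM lee_fin.
by rewrite ler_pdivrMr ?mulr_gt0 ?invr_gt0 // mulrA.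
Qed.

Lemma le_ratio (A B v w : R) : 0 < B -> 0 < v -> A <= w / v * B ->
  (A%:E / ((v%:E)^-1 * B%:E) <= w%:E)%E.
Proof.
move=> B0 v0 h; rewrite inver gt_eqF // -EFinM inver.
rewrite mulf_eq0 invr_eq0 !gt_eqF //= -EFinM lee_fin.
by rewrite ler_pdivrMr ?mulr_gt0 ?invr_gt0 // mulrA.
Qed.

Lemma sqn_int_eq0 f : cmeasurable f -> sqn_integrable cube f ->
  sqn_int cube f = 0 -> \forall x \ae mu, cube x -> f x = 0.
Proof.
move=> mf jf A0; have mC := @measurable_cube R n.
have : (\int[mu]_(x in cube) `|(EFin \o (fun x => sqn (f x))) x|)%E = 0%E.
  rewrite (eq_integral (fun x => (sqn (f x))%:E)); last first.
    by move=> x _; rewrite /= ger0_norm ?sqn_ge0.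
  by rewrite -[RHS]/(0%:E) -A0; exact: sqr_integralE.
move/(ae_eq_integral_abs mu mC); case/integrableP: (jf) => mjf _ /(_ mjf).
by apply: filterS => x h Cx; apply/sqn_eq0; case: (h Cx).
Qed.

Lemma wiener_ratioE D f v : measurable D -> D `<=` cube -> mu D = v%:E ->
  sqn_integrable cube f ->
  wiener_ratio D f = ((sqn_int cube f)%:E / ((v%:E)^-1 * (sqn_int D f)%:E))%E.
Proof.
move=> mD DC Dv jf; have mC := @measurable_cube R n.
rewrite /wiener_ratio !sqr_integralE //; last exact: integrableS mC mD DC jf.
by congr (_ / (_^-1 * _))%E.
Qed.

Lemma torus_L1_plus_pos_coef f : torus_L1_plus f -> pos_coef f.
Proof. by move=> [[_ iR iI] fp]; split. Qed.

Lemma wiener_constant_plus_le D : convex_body D -> D `<=` cube ->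
  (wiener_constant_plus D <= wiener_constant D)%E.
Proof.
move=> bD DC; have mD := convex_body_measurable bD DC.
have mC := @measurable_cube R n.
apply: ge_ereal_sup => _ [f [[pf cf pdf] f0] <-].
apply: ereal_sup_ubound; exists f => //.
have {}cf : ccontinuous f by exact/ccontinuousP.
have mf := ccontinuous_measurable cf.
have [B fB] := ccontinuous_periodic_bounded cf pf.
have fB' : cbounded B f by move=> x _; exact: fB.
have [iR iI] := cintegrable_bounded mf fB'.
have jf := sqn_integrable_bounded mf fB'.
split.
- by split => // nu; exact: posdef_fourier_ge0 pf cf fB pdf nu.
- by move=> ae0; apply: f0; exact: continuous_ae_eq0.
- by rewrite sqr_integralE ?ltry //; exact: integrableS mC mD DC jf.
Qed.

Lemma wiener_constant_le D : convex_body D -> origin_symmetric D -> D `<=` cube ->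
  (wiener_constant D <= wiener_constant_plus D)%E.
Proof.
move=> bD sD DC; have mD := convex_body_measurable bD DC.
have mC := @measurable_cube R n.
have [v v0 Dv] := convex_body_mu bD sD DC.
apply: ge_ereal_sup => _ [f [fL1 fn0 fD] <-].
have fp := torus_L1_plus_pos_coef fL1; have [fi _] := fp.
have mf := cintegrable_measurable fi.
have jD := sqn_integrable_lty mD DC mf fD.
have [K K0 hK] := convex_body_kernel bD sD.
have k0 := integral_box_indic_gt0 (R := R) (n := n) K0.
have jf : sqn_integrable cube f.
  apply: (sqn_integrable_of_coef (M := sqn_int D f /
    (\int[mu]_(y in cube) box_indic K y)%R ^+ 2)) => // L uL.
  rewrite ler_pdivlMr ?exprn_gt0 // mulrC.
  exact: wiener_bound.
rewrite (wiener_ratioE mD DC Dv jf).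
set A := sqn_int cube f; set B := sqn_int D f.
have A0 : 0 < A.
  rewrite lt_neqAle sqn_int_ge0 andbT eq_sym; apply/eqP => A0; apply: fn0.
  exact: sqn_int_eq0.
have B0 : 0 <= B := sqn_int_ge0 D f.
(* an upper bound [w] of the constant for partial sums bounds the ratio of [f] *)
have key (w : R) : 0 <= w -> (wiener_constant_plus D <= w%:E)%E -> A <= w / v * B.
  move=> w0 hw; apply: sqn_int_transfer => //; first by rewrite divr_ge0 // ltW.
  move=> L uL; pose S := fourier_sum L f.
  have [S0|S0] := pselect (S = cst 0).
    rewrite -/S S0 /sqn_int [X in X <= _](_ : _ = 0); last first.
      by apply: Rintegral_cube0 => x; rewrite sqn0.
    by rewrite mulr_ge0 ?sqn_int_ge0 // divr_ge0 // ltW.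
  have tS := trigpoly_fourier_sum L f; have [BS SB] := trigpoly_cbounded tS.
  have jS := sqn_integrable_bounded (trigpoly_cmeasurable tS) SB.
  apply: ratio_le => //; try exact: sqn_int_ge0.
  rewrite -(wiener_ratioE mD DC Dv jS); apply: le_trans hw.
  apply: ereal_sup_ubound; exists S => //; split => //.
  exact: torus_continuous_posdef_fourier_sum.
have Bp (w : R) : A <= w / v * B -> 0 < B.
  move=> h; rewrite lt_neqAle B0 andbT; apply/eqP => B00.
  by move: h; rewrite -B00 mulr0 leNgt A0.
case E : (wiener_constant_plus D) => [w| |]; last 2 first.
- by rewrite leey.
- have := key 0 (lexx 0); rewrite E leNye mul0r mul0r => /(_ isT).
  by rewrite leNgt A0.
have [w0|w0] := lerP 0 w.
  have h : A <= w / v * B by apply: key => //; rewrite E.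
  by apply: le_ratio => //; exact: Bp h.
have := key 0 (lexx 0); rewrite E lee_fin (ltW w0) mul0r mul0r => /(_ isT).
by rewrite leNgt A0.
Qed.

End wiener_constants.

Theorem proposition1 (R : realType) (n : nat) (n_gt0 : (0 < n)%N)
    (D : set 'rV[R]_n) (D_body : convex_body D) (D_sym : origin_symmetric D)
    (D_torus : D `<=` unit_cube) :
  wiener_constant D = wiener_constant_plus D.
Proof.
apply/eqP; rewrite eq_le; apply/andP; split.
  exact: wiener_constant_le.
exact: wiener_constant_plus_le.
Qed.
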